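(* Let $\delta\in\mathbb{R}$. The positive zeros $a'_{\nu,\delta,k}$ of $j'_{\nu,\delta}$ satisfy the following bounds. (1) If $\nu\ge|\delta|$ and $k\ge2$, then $$a'_{\nu,\delta,k}>\sqrt{\nu^2+\pi^2\left(k-\frac54\right)^2}.$$ (2) If $\nu\ge|\delta|$ and $k$ is sufficiently large, then $$\pi\left(k+\frac\nu2-\frac12\right)<h_\nu^{-1}(k)<a'_{\nu,\delta,k}<h_\nu^{-1}\left(k+\frac38\right)<\pi\left(k+\frac\nu2+\frac12\right),$$ where $h_\nu(x)=xg(\nu/x)$.
   Context: $J_\nu$ is the Bessel function of the first kind of order $\nu$ and $j_{\nu,\delta}(x)=x^{-\delta}J_\nu(x)$ for $x>0$. For $\nu\ge|\delta|$, the positive zeros of $j_{\nu,\delta}'$ are simple and are listed in increasing order as $a'_{\nu,\delta,k}$, with the index $k$ beginning with $k=0$ if $\nu>|\delta|$ and with $k=1$ if $\nu=|\delta|$. $g(x)=\left(\sqrt{1-x^2}-x\arccos x\right)/\pi$ for $0\le x\le1$, and $h_\nu$ is a strictly increasing function from $[\nu,\infty)$ onto $[0,\infty)$ (with $h_0(x)=x/\pi$); $h_\nu^{-1}$ is its inverse function.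
   Formalization: Part (2) fails with the stated numbering when δ = −ν < 0 (e.g. ν = 1/2, where j is a multiple of sin x and a'_k = π(k−1/2)); that case is excluded from (2) and instead proved with a'_{ν,δ,k+1} in place of a'_{ν,δ,k}. *)

(* Defs.v *)
From Stdlib Require Import Reals Factorial ClassicalEpsilon.
From Coquelicot Require Import Coquelicot.
Open Scope R_scope.

(** Euler's integral; meaningful for [0 < s]. *)
Definition Gamma (s : R) : R :=
  RInt_gen (fun t => Rpower t (s - 1) * exp (- t))
    (at_right 0) (Rbar_locally p_infty).

(** Meaningful for [0 < x] and [-1 < nu]: [Rpower] requires a positive base,
    and [Gamma] a positive argument. *)
Definition BesselJ (nu x : R) : R :=
  Series (fun m : nat =>
    (-1) ^ m / (INR (fact m) * Gamma (INR m + nu + 1))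
    * Rpower (x / 2) (2 * INR m + nu)).

Definition j (nu delta x : R) : R := Rpower x (- delta) * BesselJ nu x.

Definition lists_pos_zeros (f : R -> R) (k0 : nat) (a : nat -> R) : Prop :=
  (forall k : nat, (k0 <= k)%nat -> 0 < a k /\ f (a k) = 0) /\
  (forall k : nat, (k0 <= k)%nat -> a k < a (S k)) /\
  (forall x : R, 0 < x -> f x = 0 -> exists k : nat, (k0 <= k)%nat /\ a k = x).

(** Used only when [Rabs delta <= nu], so that the second branch is the case
    [nu = Rabs delta]. *)
Definition first_index (nu delta : R) : nat :=
  if Rlt_dec (Rabs delta) nu then 0%nat else 1%nat.

(** The values at indices [k >= first_index nu delta] are determined, because an
    increasing listing is unique there.  [epsilon] returns an unspecified
    sequence when no listing exists, so a bound on [a' nu delta k] cannot hold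
    vacuously. *)
Definition a' (nu delta : R) : nat -> R :=
  epsilon (inhabits (fun _ : nat => 0))
    (lists_pos_zeros (Derive (j nu delta)) (first_index nu delta)).

Definition g (x : R) : R := (sqrt (1 - x ^ 2) - x * acos x) / PI.

Definition h (nu x : R) : R := x * g (nu / x).

(** The inverse of [h nu : [nu, +oo) -> [0, +oo)]. *)
Definition h_inv (nu y : R) : R :=
  epsilon (inhabits 0) (fun x : R => nu <= x /\ h nu x = y).

(* Main.v *)
(** Write [J] for the Bessel function, [N x = x J'(x)] and [phase = PI * h nu], so that
    [phase' = freq / x] with [freq = sqrt (x^2 - nu^2)].  The critical points of
    [x^(-delta) J] are the points where [N = delta * J].

    Counting.  The energy [N^2 + (x^2 - nu^2) J^2] has derivative [2 x J^2] and vanishes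
    at [0], hence is positive; so [N / J] is strictly decreasing between zeros of [J] and
    takes each value [d] exactly once in each gap [(z_k, z_(k+1))], at its level zero (and
    before [z_1] iff [d < nu]).  In the variable [phase], [sqrt freq * J] oscillates faster
    than the sine and [N / sqrt freq] more slowly; so the [k]-th zero of [J] satisfies
    [phase (z_k) <= k PI], and the zero of [N] in the [k]-th gap has [phase >= k PI].  As
    [phase <= freq], this gives the first bound, and it gives the index [k] in the others.

    Asymptotics.  The real part [K] of the integral over [s > 0] of
    [exp (i x - 2 x s) (s (1 + i s))^(nu - 1/2)], turned by [nu PI / 2 + PI / 4], is
    proportional to [x^(-nu) J]: it solves the same equation, because the integrand of the
    equation is an exact derivative in [s], and it is recessive at [0].  By Laplace's
    method [K] behaves like [x^(-nu - 1/2) cos (x - nu PI / 2 - PI / 4)], so at large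
    zeros of [J], resp. of [N - delta J], the cosine, resp. the sine, is [O(1 / x)].  Since
    [phase x = x - nu PI / 2 + O(1 / x)], these zeros have [phase] near [(k - 1/4) PI],
    resp. [(k + 1/4) PI]. *)

Require Import Defs.
From Stdlib Require Import Reals Lra Lia Factorial Ranalysis5 Wf_nat ClassicalEpsilon.
From Coquelicot Require Import Coquelicot.
Open Scope R_scope.
Set Bullet Behavior "Strict Subproofs".

(** * Calculus *)

Lemma is_derive_continuous (f : R -> R) (x l : R) : is_derive f x l -> continuous f x.
Proof. intros Hf. apply (ex_derive_continuous f). now exists l. Qed.

Lemma is_derive_continuity_pt (f : R -> R) (x l : R) : is_derive f x l -> continuity_pt f x.
Proof. intros Hf. apply continuity_pt_filterlim. now apply (is_derive_continuous f x l). Qed.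

Ltac auto_continuous :=
  lazymatch goal with
  | |- continuous ?f ?x => apply (ex_derive_continuous f x); auto_derive; easy
  end.

(* [auto_derive] leaves the derivative of an unknown function [f] as
   [Derive (fun y => f y) x]. *)
Ltac rewrite_known_Derive :=
  repeat match goal with
  | Hf : is_derive ?f ?x ?l |- context [Derive (fun y => ?f y) ?x] =>
      change (Derive (fun y => f y) x) with (Derive f x);
      rewrite (is_derive_unique f x l Hf)
  end.

Lemma is_derive_nonneg_le (f df : R -> R) (a b : R) :
  a <= b -> (forall x, a <= x <= b -> is_derive f x (df x)) ->
  (forall x, a <= x <= b -> 0 <= df x) -> f a <= f b.
Proof.
  intros Hab Hf Hdf.
  destruct (MVT_gen f a b df) as [c [Hc Efab]];
    rewrite ?Rmin_left, ?Rmax_right in * by lra.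
  - intros x Hx. apply Hf. lra.
  - intros x Hx. eapply is_derive_continuity_pt, Hf. lra.
  - specialize (Hdf c Hc). nra.
Qed.

Lemma is_derive_pos_lt (f df : R -> R) (a b : R) :
  a < b -> (forall x, a <= x <= b -> is_derive f x (df x)) ->
  (forall x, a <= x <= b -> 0 < df x) -> f a < f b.
Proof.
  intros Hab Hf Hdf.
  apply (incr_function_le f (Finite a) (Finite b) df); simpl; try lra.
  - intros x Hax Hxb. apply Hf. lra.
  - intros x Hax Hxb. apply Hdf. lra.
Qed.

Lemma is_derive_Rabs_sub_le (f df : R -> R) (a b M : R) :
  a <= b -> (forall x, a <= x <= b -> is_derive f x (df x)) ->
  (forall x, a <= x <= b -> Rabs (df x) <= M) ->
  Rabs (f b - f a) <= M * (b - a).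
Proof.
  intros Hab Hf Hdf. rewrite <- (Rabs_pos_eq (b - a)) by lra.
  destruct (MVT_gen f a b df) as [c [Hc Efab]];
    rewrite ?Rmin_left, ?Rmax_right in * by lra.
  - intros x Hx. apply Hf. lra.
  - intros x Hx. eapply is_derive_continuity_pt, Hf. lra.
  - rewrite Efab, Rabs_mult. apply Rmult_le_compat_r; [apply Rabs_pos|]. now apply Hdf.
Qed.

Lemma at_right_between (x c : R) : x < c -> at_right x (fun y => x < y < c).
Proof. intros Hc. apply (filter_imp _ _ (fun y Hy Hxy => conj Hxy Hy) (open_lt c x Hc)). Qed.

Lemma at_left_between (x c : R) : c < x -> at_left x (fun y => c < y < x).
Proof. intros Hc. apply (filter_imp _ _ (fun y Hy Hyx => conj Hy Hyx) (open_gt c x Hc)). Qed.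

Lemma filterlim_Rabs_lt {T : Type} {F : (T -> Prop) -> Prop} (f : T -> R) (l eps : R) :
  filterlim f F (locally l) -> 0 < eps -> F (fun x => Rabs (f x - l) < eps).
Proof.
  intros Hf Heps. apply (Hf (fun y => Rabs (y - l) < eps)).
  now exists (mkposreal eps Heps).
Qed.

Lemma filterlim_Rabs_le {T : Type} {F : (T -> Prop) -> Prop} {FF : Filter F}
    (f g : T -> R) (l : R) :
  F (fun x => Rabs (f x - l) <= g x) -> filterlim g F (locally 0) ->
  filterlim f F (locally l).
Proof.
  intros Hfg Hg. apply filterlim_locally. intros eps.
  apply (filter_imp (fun x => Rabs (f x - l) <= g x /\ Rabs (g x - 0) < eps)).
  - intros x [Hle Hlt]. change (Rabs (f x - l) < eps).
    rewrite Rminus_0_r in Hlt. pose proof (Rle_abs (g x)). lra.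
  - apply filter_and; [easy|]. apply filterlim_Rabs_lt; [easy|apply cond_pos].
Qed.

Lemma filterlim_at_right_continuous (f : R -> R) (x l : R) :
  continuous f x -> f x = l -> filterlim f (at_right x) (locally l).
Proof.
  intros Hf <-. eapply filterlim_filter_le_1; [apply filter_le_within|exact Hf].
Qed.

Lemma filterlim_at_left_continuous (f : R -> R) (x l : R) :
  continuous f x -> f x = l -> filterlim f (at_left x) (locally l).
Proof.
  intros Hf <-. eapply filterlim_filter_le_1; [apply filter_le_within|exact Hf].
Qed.

Lemma filterlim_div_p_infty (C : R) :
  filterlim (fun x => C / x) (Rbar_locally p_infty) (locally 0).
Proof.
  replace (locally 0) with (Rbar_locally (Rbar_mult C 0))
    by (simpl; now rewrite Rmult_0_r).
  apply (is_lim_scal_l (fun x => / x) C p_infty 0).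
  now apply (is_lim_inv (fun x => x) p_infty p_infty); [apply is_lim_id|].
Qed.

Lemma is_derive_sign (f : R -> R) (x l : R) :
  is_derive f x l -> l <> 0 -> f x = 0 ->
  locally x (fun y => y <> x -> 0 < l * (y - x) * f y).
Proof.
  intros [_ Hf] Hl Hfx.
  pose proof (Rabs_pos_lt l Hl) as Habs.
  assert (Heps : 0 < Rabs l / 2) by lra.
  apply (filter_imp (fun y => Rabs (f y - f x - (y - x) * l) <= Rabs l / 2 * Rabs (y - x))).
  2: { apply (Hf x (fun P HP => HP) (mkposreal _ Heps)). }
  intros y Hy Hyx. rewrite Hfx, Rminus_0_r in Hy.
  assert (Hprod : 0 < (Rabs l * Rabs (y - x)) ^ 2).
  { apply pow2_gt_0. apply Rmult_integral_contrapositive_currified; [lra|].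
    apply Rabs_no_R0. lra. }
  assert (Herr : Rabs (l * (y - x) * (f y - (y - x) * l)) <= (Rabs l * Rabs (y - x)) ^ 2 / 2).
  { rewrite !Rabs_mult. apply Rle_trans with
      (Rabs l * Rabs (y - x) * (Rabs l / 2 * Rabs (y - x))); [|right; field].
    apply Rmult_le_compat_l; [|easy]. apply Rmult_le_pos; apply Rabs_pos. }
  rewrite <- Rabs_mult, pow2_abs in *. apply Rabs_le_between in Herr. nra.
Qed.

Lemma continuous_lt_locally (f : R -> R) (x c : R) :
  continuous f x -> f x < c -> locally x (fun y => f y < c).
Proof. intros Hf Hfx. apply (Hf (fun z => z < c)). now apply open_lt. Qed.

Lemma at_right_interval (x : R) (P : R -> Prop) :
  at_right x P -> exists c, x < c /\ forall y, x < y < c -> P y.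
Proof.
  intros [d Hd]. exists (x + d). pose proof (cond_pos d). split; [lra|].
  intros y Hy. apply Hd; [|lra]. change (Rabs (y - x) < d). apply Rabs_def1; lra.
Qed.

Lemma p_infty_gt (M : R) : Rbar_locally p_infty (fun x => M < x).
Proof. now exists M. Qed.

Lemma eventually_div_lt (C eps : R) : 0 < eps ->
  Rbar_locally p_infty (fun x => C / x < eps).
Proof.
  intros Heps. refine (filter_imp _ _ _
    (filterlim_Rabs_lt _ 0 eps (filterlim_div_p_infty C) Heps)).
  intros x Hx. apply Rabs_def2 in Hx. lra.
Qed.

Lemma Rinv_bounds_ge_1 (r : R) : 1 <= r -> 0 < / r <= 1.
Proof.
  intros Hr. split; [apply Rinv_0_lt_compat; lra|].
  rewrite <- Rinv_1. apply Rinv_le_contravar; lra.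
Qed.

Lemma filterlim_Rinv_p_infty : filterlim Rinv (Rbar_locally p_infty) (at_right 0).
Proof.
  intros P HP. destruct (at_right_interval 0 P HP) as [c [Hc Hcint]].
  exists (/ c). intros r Hr. pose proof (Rinv_0_lt_compat c Hc).
  apply Hcint. split; [apply Rinv_0_lt_compat; lra|].
  rewrite <- (Rinv_inv c). apply Rinv_lt_contravar; [nra|easy].
Qed.

Lemma neq0_const_sign (f : R -> R) (a b : R) :
  (forall x, a < x < b -> continuity_pt f x) ->
  (forall x, a < x < b -> f x <> 0) ->
  (forall x, a < x < b -> 0 < f x) \/ (forall x, a < x < b -> f x < 0).
Proof.
  intros Hcont Hneq.
  destruct (classic (exists x, a < x < b /\ 0 < f x)) as [[x [Hx Hfx]]|Hnone].
  - left. intros y Hy. apply Rnot_le_lt. intros [Hfy|Hfy]; [|now apply (Hneq y)].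
    destruct (Rtotal_order x y) as [Hxy|[<-|Hyx]]; [|lra|].
    + destruct (IVT_interv (fun t => - f t) x y) as [z [Hz Hfz]]; try lra.
      * intros t Ht. apply continuity_pt_opp, Hcont. lra.
      * apply (Hneq z); lra.
    + destruct (IVT_interv f y x) as [z [Hz Hfz]]; try lra.
      * intros t Ht. apply Hcont. lra.
      * apply (Hneq z); lra.
  - right. intros y Hy. apply Rnot_le_lt. intros [Hfy|Hfy].
    + apply Hnone. now exists y.
    + now apply (Hneq y).
Qed.

(** * Exponentials and real powers *)

Lemma exp_le_compat (x y : R) : x <= y -> exp x <= exp y.
Proof. intros [Hxy| ->]; [left; now apply exp_increasing | lra]. Qed.

Lemma exp_neg_le_1 (x : R) : 0 <= x -> exp (- x) <= 1.
Proof. intros Hx. rewrite <- exp_0. apply exp_le_compat. lra. Qed.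

Lemma Rpower_pos (x y : R) : 0 < Rpower x y.
Proof. apply exp_pos. Qed.

Lemma Rpower_succ (x b : R) : 0 < x -> Rpower x (b + 1) = x * Rpower x b.
Proof. intros Hx. rewrite Rpower_plus, Rpower_1 by easy. ring. Qed.

Lemma Rpower_base_1 (b : R) : Rpower 1 b = 1.
Proof. unfold Rpower. now rewrite ln_1, Rmult_0_r, exp_0. Qed.

Lemma Rpower_base_inv (x b : R) : 0 < x -> Rpower (/ x) b = Rpower x (- b).
Proof. intros Hx. unfold Rpower. rewrite ln_Rinv by easy. f_equal. ring. Qed.

Lemma Rpower_ge_1 (x b : R) : 1 <= x -> 0 <= b -> 1 <= Rpower x b.
Proof.
  intros Hx Hb. replace 1 with (Rpower x 0) by (apply Rpower_O; lra). now apply Rle_Rpower.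
Qed.

Lemma Rle_Rpower_small (x b c : R) : 0 < x <= 1 -> b <= c -> Rpower x c <= Rpower x b.
Proof.
  intros Hx Hbc. apply exp_le_compat.
  assert (ln x <= 0) by (rewrite <- ln_1; apply ln_le; lra). nra.
Qed.

Lemma is_derive_Rpower (b x : R) :
  0 < x -> is_derive (fun y => Rpower y b) x (b * Rpower x (b - 1)).
Proof. intros Hx. apply is_derive_Reals. now apply derivable_pt_lim_power. Qed.

Lemma continuous_Rpower (b x : R) : 0 < x -> continuous (fun y => Rpower y b) x.
Proof. intros Hx. eapply is_derive_continuous. now apply is_derive_Rpower. Qed.

Lemma mul_exp_neg_le (t : R) : t * exp (- t) <= 1.
Proof.
  rewrite exp_Ropp. pose proof (exp_pos t). pose proof (exp_ineq1_le t).
  apply Rmult_le_reg_r with (exp t); [easy|].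
  rewrite Rmult_assoc, Rinv_l; lra.
Qed.

Lemma Rpower_le_exp (b c : R) : 0 <= b -> 0 < c ->
  exists C, 0 < C /\ forall y, 0 < y -> Rpower y b <= C * exp (c * y).
Proof.
  intros [Hb|<-] Hc.
  - exists (Rpower (b / c) b). split; [apply Rpower_pos|].
    intros y Hy. unfold Rpower. rewrite <- exp_plus. apply exp_le_compat.
    assert (Hbc : 0 < b / c) by (apply Rdiv_lt_0_compat; lra).
    assert (Hln : ln (y / (b / c)) <= y / (b / c)).
    { assert (Hq : 0 < y / (b / c)) by now apply Rdiv_lt_0_compat.
      pose proof (exp_ineq1_le (ln (y / (b / c)))) as Hexp. rewrite exp_ln in Hexp; lra. }
    rewrite ln_div in Hln by easy.
    apply (Rmult_le_compat_l b) in Hln; [|lra].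
    replace (b * (y / (b / c))) with (c * y) in Hln by (field; lra). lra.
  - exists 1. split; [lra|]. intros y Hy.
    rewrite Rpower_O, Rmult_1_l, <- exp_0 by easy. apply exp_le_compat. nra.
Qed.

Lemma Rpower_at_0 (s : R) : 0 < s ->
  filterlim (fun t => Rpower t s) (at_right 0) (locally 0).
Proof.
  intros Hs. apply filterlim_locally. intros eps.
  apply (filter_imp (fun t => 0 < t < Rpower eps (/ s))).
  2: { apply at_right_between, Rpower_pos. }
  intros t Ht. change (Rabs (Rpower t s - 0) < eps).
  rewrite Rminus_0_r, Rabs_pos_eq by (left; apply Rpower_pos).
  replace (pos eps) with (Rpower (Rpower eps (/ s)) s).
  - now apply Rlt_Rpower_l.
  - rewrite Rpower_mult, Rinv_l by lra. apply Rpower_1, cond_pos.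
Qed.

Lemma Rpower_mul_exp_neg_at_0 (s c : R) : 0 < s -> 0 < c ->
  filterlim (fun t => Rpower t s * exp (- (c * t))) (at_right 0) (locally 0).
Proof.
  intros Hs Hc. apply (filterlim_Rabs_le _ (fun t => Rpower t s)); [|now apply Rpower_at_0].
  apply (filter_imp (fun t => 0 < t < 1)); [|apply at_right_between, Rlt_0_1].
  intros t Ht. pose proof (Rpower_pos t s). pose proof (exp_pos (- (c * t))).
  pose proof (exp_neg_le_1 (c * t) ltac:(nra)).
  rewrite Rminus_0_r, Rabs_pos_eq by nra. nra.
Qed.

Lemma Rpower_mul_exp_neg_at_p_infty (s c : R) : 0 < s -> 0 < c ->
  filterlim (fun t => Rpower t s * exp (- (c * t))) (Rbar_locally p_infty) (locally 0).
Proof.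
  intros Hs Hc. destruct (Rpower_le_exp (s + 1) c) as [C [HC Hexp]]; try lra.
  apply (filterlim_Rabs_le _ (fun t => C / t)); [|apply filterlim_div_p_infty].
  exists 0. intros t Ht.
  rewrite Rminus_0_r, Rabs_pos_eq by (apply Rmult_le_pos; left; apply exp_pos).
  specialize (Hexp t Ht). rewrite Rpower_succ in Hexp by easy.
  apply Rmult_le_reg_l with t; [easy|]. rewrite <- Rmult_assoc.
  replace (t * (C / t)) with (C * exp (c * t) * exp (- (c * t))).
  - apply Rmult_le_compat_r; [left; apply exp_pos|easy].
  - rewrite Rmult_assoc, <- exp_plus, Rplus_opp_r, exp_0. field. lra.
Qed.

Lemma one_plus_sqr_pos (s : R) : 0 < 1 + s ^ 2.
Proof. pose proof (pow2_ge_0 s). lra. Qed.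

Lemma Rdiv_between_0_1 (nu x : R) : 0 <= nu < x -> 0 <= nu / x < 1.
Proof.
  intros Hx. split; [apply Rdiv_le_0_compat; lra|].
  apply Rmult_lt_reg_r with x; [lra|]. unfold Rdiv. rewrite Rmult_assoc, Rinv_l; lra.
Qed.

(** * Trigonometric functions *)

Lemma Rabs_sin_le_1 (u : R) : Rabs (sin u) <= 1.
Proof. apply Rabs_le, SIN_bound. Qed.

Lemma Rabs_cos_le_1 (u : R) : Rabs (cos u) <= 1.
Proof. apply Rabs_le, COS_bound. Qed.

Lemma sin_lipschitz (u v : R) : Rabs (sin u - sin v) <= Rabs (u - v).
Proof.
  rewrite <- (Rmult_1_l (Rabs (u - v))). apply (bounded_variation sin cos).
  intros t _. split; [apply is_derive_sin|apply Rabs_cos_le_1].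
Qed.

Lemma cos_lipschitz (u v : R) : Rabs (cos u - cos v) <= Rabs (u - v).
Proof.
  rewrite <- !sin_shift. eapply Rle_trans; [apply sin_lipschitz|].
  rewrite <- (Rabs_Ropp (u - v)). right. f_equal. ring.
Qed.

Lemma Rabs_sin_le (u : R) : Rabs (sin u) <= Rabs u.
Proof. pose proof (sin_lipschitz u 0) as Hlip. now rewrite sin_0, !Rminus_0_r in Hlip. Qed.

Lemma atan_bounds_nonneg (y : R) : 0 <= y -> 0 <= atan y <= y.
Proof.
  intros Hy. split.
  - rewrite <- atan_0. destruct Hy as [Hy|<-]; [|lra]. left. now apply atan_increasing.
  - assert (Hincr : 0 - atan 0 <= y - atan y); [|rewrite atan_0 in Hincr; lra].
    apply (is_derive_nonneg_le (fun y => y - atan y) (fun y => 1 - / (1 + y²))); [easy| |].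
    + intros t _. apply (is_derive_minus (fun y => y) atan);
        [apply (is_derive_id t)|apply is_derive_atan].
    + intros t _. pose proof (Rle_0_sqr t).
      assert (/ (1 + t²) <= / 1) by (apply Rinv_le_contravar; lra). lra.
Qed.

Lemma mul_acot_bounds (s : R) : 0 < s -> 0 <= s * (PI / 2 - atan s) <= 1.
Proof.
  intros Hs. pose proof (Rinv_0_lt_compat s Hs).
  pose proof (atan_bounds_nonneg (/ s) ltac:(lra)) as Hacot. rewrite atan_inv in Hacot by easy.
  split; [nra|]. rewrite <- (Rinv_r s) by lra. apply Rmult_le_compat_l; lra.
Qed.

Lemma Rabs_sin_add_mul_PI (u : R) (m : nat) : Rabs (sin (u + INR m * PI)) = Rabs (sin u).
Proof.
  induction m as [|m IH].
  - simpl. f_equal. f_equal. ring.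
  - rewrite S_INR. replace (u + (INR m + 1) * PI) with (u + INR m * PI + PI) by ring.
    now rewrite neg_sin, Rabs_Ropp.
Qed.

Lemma Rabs_lt_of_Rabs_sin_lt (c u : R) : 0 <= c <= PI / 2 -> Rabs u <= PI - c ->
  Rabs (sin u) < sin c -> Rabs u < c.
Proof.
  intros Hc Hu Hsin. apply Rnot_le_lt. intros Hcu.
  replace (Rabs (sin u)) with (sin (Rabs u)) in Hsin.
  - destruct (Rle_lt_dec (Rabs u) (PI / 2)) as [Hle|Hgt].
    + pose proof (sin_incr_1 c (Rabs u)). lra.
    + pose proof (sin_decr_1 (Rabs u) (PI - c)) as Hdecr. rewrite sin_PI_x in Hdecr. lra.
  - pose proof (sin_ge_0 (Rabs u)) as Hge0. unfold Rabs at 1 2. unfold Rabs in Hge0, Hu.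
    destruct (Rcase_abs u) as [Hneg|Hpos]; destruct (Rcase_abs (sin u));
      rewrite ?sin_neg in *; lra.
Qed.

Lemma is_derive_acos (y : R) : -1 < y < 1 -> is_derive acos y (- / sqrt (1 - y ^ 2)).
Proof.
  intros Hy. apply is_derive_Reals.
  replace (- / sqrt (1 - y ^ 2)) with (-1 / sqrt (1 - y²)).
  - apply derive_pt_eq_1 with (derivable_pt_acos y Hy). apply derive_pt_acos.
  - rewrite Rsqr_pow2. field. apply Rgt_not_eq, sqrt_lt_R0. nra.
Qed.

Lemma mul_cos_le_sin (t : R) : 0 <= t <= PI -> t * cos t <= sin t.
Proof.
  intros Ht.
  assert (Hincr : sin 0 - 0 * cos 0 <= sin t - t * cos t).
  { apply (is_derive_nonneg_le (fun t => sin t - t * cos t) (fun t => t * sin t)); [lra| |].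
    - intros x _. auto_derive; [easy|ring].
    - intros x Hx. apply Rmult_le_pos; [lra|]. apply sin_ge_0; lra. }
  rewrite sin_0 in Hincr. lra.
Qed.

(** * Integrals over the half-line *)

Lemma ex_RInt_pos_halfline (f : R -> R) (a b : R) :
  (forall x, 0 < x -> continuous f x) -> 0 < a -> 0 < b -> ex_RInt f a b.
Proof.
  intros Hf Ha Hb. apply (ex_RInt_continuous f). intros x Hx. apply Hf.
  pose proof (Rmin_glb_lt a b 0 Ha Hb). lra.
Qed.

Lemma RInt_widen_le (f : R -> R) (a b a' b' : R) :
  (forall x, 0 < x -> continuous f x) -> (forall x, 0 < x -> 0 <= f x) ->
  0 < a' -> a' <= a -> a <= b -> b <= b' -> RInt f a b <= RInt f a' b'.
Proof.
  intros Hf Hpos Ha' Haa Hab Hbb.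
  assert (Hex : forall u v, 0 < u -> 0 < v -> ex_RInt f u v)
    by (intros; now apply ex_RInt_pos_halfline).
  assert (Hge0 : forall u v, 0 < u -> u <= v -> 0 <= RInt f u v).
  { intros u v Hu Huv. apply RInt_ge_0; [easy|apply Hex; lra|].
    intros x Hx. apply Hpos. lra. }
  rewrite <- (RInt_Chasles f a' a b'), <- (RInt_Chasles f a b b') by (apply Hex; lra).
  pose proof (Hge0 a' a Ha' Haa). pose proof (Hge0 b b' ltac:(lra) Hbb).
  unfold plus; simpl. lra.
Qed.

Lemma is_RInt_gen_pos_bounded (f : R -> R) (M : R) :
  (forall x, 0 < x -> continuous f x) -> (forall x, 0 < x -> 0 <= f x) ->
  (forall a b, 0 < a -> a <= b -> RInt f a b <= M) ->
  exists l, is_RInt_gen f (at_right 0) (Rbar_locally p_infty) l /\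
            forall a b, 0 < a -> a <= b -> RInt f a b <= l.
Proof.
  intros Hf Hpos HM.
  destruct (completeness (fun y => exists a b, 0 < a /\ a <= b /\ y = RInt f a b))
    as [l [Hub Hlub]].
  - exists M. intros y (a & b & Ha & Hab & ->). now apply HM.
  - exists (RInt f 1 1), 1, 1. lra.
  - assert (Hle : forall a b, 0 < a -> a <= b -> RInt f a b <= l).
    { intros a b Ha Hab. apply Hub. now exists a, b. }
    exists l. split; [|exact Hle].
    intros P [eps HP].
    assert (Hclose : exists a b, 0 < a /\ a <= b /\ l - eps < RInt f a b).
    { apply NNPP. intros Hnone. pose proof (cond_pos eps).
      assert (l <= l - eps); [|lra].
      apply Hlub. intros y (a & b & Ha & Hab & ->).
      apply Rnot_lt_le. intros Hlt. apply Hnone. now exists a, b. }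
    destruct Hclose as (a0 & b0 & Ha0 & Hab0 & Hlt).
    apply (Filter_prod _ _ _ (fun a => 0 < a < a0) (fun b => b0 < b)).
    + now apply at_right_between.
    + now exists b0.
    + intros a b Ha Hb. exists (RInt f a b). split.
      * apply (RInt_correct f). apply ex_RInt_pos_halfline; auto; simpl; lra.
      * apply HP. change (Rabs (RInt f a b - l) < eps).
        pose proof (Hle a b ltac:(lra) ltac:(lra)).
        pose proof (RInt_widen_le f a0 b0 a b Hf Hpos ltac:(lra) ltac:(lra) Hab0 ltac:(lra)).
        apply Rabs_def1; lra.
Qed.

(** * The Gamma function *)

Definition Gamma_integrand (s t : R) : R := Rpower t (s - 1) * exp (- t).

Lemma continuous_Gamma_integrand (s t : R) :
  0 < t -> continuous (Gamma_integrand s) t.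
Proof.
  intros Ht. apply (continuous_mult (fun t => Rpower t (s - 1)) (fun t => exp (- t))).
  - now apply continuous_Rpower.
  - auto_continuous.
Qed.

Lemma Gamma_integrand_pos (s t : R) : 0 < Gamma_integrand s t.
Proof. apply Rmult_lt_0_compat; apply exp_pos. Qed.

Lemma ex_RInt_Gamma_integrand (s a b : R) :
  0 < a -> 0 < b -> ex_RInt (Gamma_integrand s) a b.
Proof.
  intros Ha Hb. apply ex_RInt_pos_halfline; try easy.
  intros t Ht. now apply continuous_Gamma_integrand.
Qed.

(* The integrand is the derivative of [(t / (1 + t)) ^ s], a bounded function. *)
Lemma is_RInt_Rpower_homographic (s a b : R) : 0 < a -> a <= b ->
  is_RInt (fun t => s * Rpower t (s - 1) * Rpower (1 + t) (- (s + 1))) a b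
    (Rpower b s * Rpower (1 + b) (- s) - Rpower a s * Rpower (1 + a) (- s)).
Proof.
  intros Ha Hab.
  apply (is_RInt_derive (V := R_CompleteNormedModule)
    (fun t => Rpower t s * Rpower (1 + t) (- s)));
    intros t Ht; rewrite Rmin_left in Ht by lra; assert (Ht0 : 0 < t) by lra.
  - assert (Hshift : is_derive (fun t => Rpower (1 + t) (- s)) t
      (scal 1 (- s * Rpower (1 + t) (- s - 1)))).
    { apply (is_derive_comp (fun u => Rpower u (- s)) (fun t => 1 + t)).
      - apply is_derive_Rpower. lra.
      - auto_derive; [easy|ring]. }
    replace (s * Rpower t (s - 1) * Rpower (1 + t) (- (s + 1))) with
      (plus (mult (s * Rpower t (s - 1)) (Rpower (1 + t) (- s)))
            (mult (Rpower t s) (scal 1 (- s * Rpower (1 + t) (- s - 1))))).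
    + apply (is_derive_mult (fun t => Rpower t s) (fun t => Rpower (1 + t) (- s))); [|easy|].
      * now apply is_derive_Rpower.
      * intros; apply Rmult_comm.
    + unfold plus, mult, scal; simpl; unfold mult; simpl.
      replace (- (s + 1)) with (- s - 1) by ring.
      replace (Rpower t s) with (t * Rpower t (s - 1))
        by (rewrite <- Rpower_succ by easy; f_equal; ring).
      replace (Rpower (1 + t) (- s)) with ((1 + t) * Rpower (1 + t) (- s - 1))
        by (rewrite <- Rpower_succ by lra; f_equal; ring).
      ring.
  - apply (continuous_mult (fun t => s * Rpower t (s - 1))
      (fun t => Rpower (1 + t) (- (s + 1)))).
    + apply (continuous_scal_r s (fun t => Rpower t (s - 1))). now apply continuous_Rpower.
    + apply (continuous_comp (fun t => 1 + t) (fun u => Rpower u (- (s + 1)))).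
      * apply (continuous_plus (fun _ => 1) (fun t => t));
          [apply continuous_const|apply continuous_id].
      * apply continuous_Rpower. lra.
Qed.

Lemma RInt_Gamma_integrand_bounded (s : R) : 0 < s ->
  exists M, forall a b, 0 < a -> a <= b -> RInt (Gamma_integrand s) a b <= M.
Proof.
  intros Hs. destruct (Rpower_le_exp (s + 1) 1) as [C [HC Hexp]]; try lra.
  set (k := C * exp 1 / s).
  assert (Hk : 0 < k)
    by (apply Rdiv_lt_0_compat; [apply Rmult_lt_0_compat; [lra|apply exp_pos]|lra]).
  exists k. intros a b Ha Hab.
  assert (Hint : is_RInt (fun t => k * (s * Rpower t (s - 1) * Rpower (1 + t) (- (s + 1))))
    a b (k * (Rpower b s * Rpower (1 + b) (- s) - Rpower a s * Rpower (1 + a) (- s))))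
    by now apply (is_RInt_scal (V := R_NormedModule)), is_RInt_Rpower_homographic.
  eapply Rle_trans.
  - apply RInt_le; [easy|apply ex_RInt_Gamma_integrand; lra|eexists; exact Hint|].
    intros t Ht. unfold Gamma_integrand.
    replace (k * (s * Rpower t (s - 1) * Rpower (1 + t) (- (s + 1)))) with
      (Rpower t (s - 1) * (C * exp 1 * / Rpower (1 + t) (s + 1)))
      by (unfold k; rewrite Rpower_Ropp; field; split; [apply Rgt_not_eq, Rpower_pos|lra]).
    apply Rmult_le_compat_l; [left; apply Rpower_pos|].
    specialize (Hexp (1 + t) ltac:(lra)). rewrite Rmult_1_l, exp_plus in Hexp.
    pose proof (Rpower_pos (1 + t) (s + 1)) as Hpow. pose proof (exp_pos t) as Het.
    rewrite exp_Ropp. apply Rmult_le_reg_l with (exp t * Rpower (1 + t) (s + 1)); [nra|].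
    field_simplify; lra.
  - rewrite (is_RInt_unique _ _ _ _ Hint).
    rewrite <- (Rmult_1_r k) at 2. apply Rmult_le_compat_l; [lra|].
    pose proof (Rpower_pos a s). pose proof (Rpower_pos (1 + a) (- s)).
    apply Rle_trans with (Rpower b s * Rpower (1 + b) (- s)); [nra|].
    rewrite Rpower_Ropp. pose proof (Rpower_pos (1 + b) s) as Hb1.
    apply Rmult_le_reg_r with (Rpower (1 + b) s); [easy|].
    rewrite Rmult_assoc, Rinv_l, Rmult_1_r, Rmult_1_l by lra. apply Rle_Rpower_l; lra.
Qed.

Lemma Gamma_integral (s : R) : 0 < s ->
  is_RInt_gen (Gamma_integrand s) (at_right 0) (Rbar_locally p_infty) (Gamma s) /\
  forall a b, 0 < a -> a <= b -> RInt (Gamma_integrand s) a b <= Gamma s.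
Proof.
  intros Hs. destruct (RInt_Gamma_integrand_bounded s Hs) as [M HM].
  destruct (is_RInt_gen_pos_bounded (Gamma_integrand s) M) as [l [Hl Hle]]; try easy.
  - intros. now apply continuous_Gamma_integrand.
  - intros. left. apply Gamma_integrand_pos.
  - assert (El : Gamma s = l) by (unfold Gamma; now apply is_RInt_gen_unique).
    now rewrite El.
Qed.

Lemma Gamma_pos (s : R) : 0 < s -> 0 < Gamma s.
Proof.
  intros Hs. apply Rlt_le_trans with (RInt (Gamma_integrand s) 1 2).
  - apply RInt_gt_0; [lra| |].
    + intros; apply Gamma_integrand_pos.
    + intros; apply continuous_Gamma_integrand; lra.
  - apply Gamma_integral; lra.
Qed.

Lemma is_derive_Rpower_mul_exp_neg (s t : R) : 0 < t ->
  is_derive (fun t => Rpower t s * exp (- t)) t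
    (s * Gamma_integrand s t - Gamma_integrand (s + 1) t).
Proof.
  intros Ht.
  replace (s * Gamma_integrand s t - Gamma_integrand (s + 1) t) with
    (plus (mult (s * Rpower t (s - 1)) (exp (- t))) (mult (Rpower t s) (- exp (- t)))).
  - apply (is_derive_mult (fun t => Rpower t s) (fun t => exp (- t))).
    + now apply is_derive_Rpower.
    + auto_derive; [easy|ring].
    + intros; apply Rmult_comm.
  - unfold Gamma_integrand, plus, mult; simpl. replace (s + 1 - 1) with s by ring. ring.
Qed.

Lemma is_RInt_gen_Gamma_succ_integrand (s : R) : 0 < s ->
  is_RInt_gen (fun t => s * Gamma_integrand s t - Gamma_integrand (s + 1) t)
    (at_right 0) (Rbar_locally p_infty) 0.
Proof.
  intros Hs. set (D := fun t => s * Gamma_integrand s t - Gamma_integrand (s + 1) t).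
  assert (Hpos : filter_prod (at_right 0) (Rbar_locally p_infty)
     (fun ab : R * R => 0 < Rmin (fst ab) (snd ab))).
  { apply (Filter_prod _ _ _ (fun a => 0 < a < 1) (fun b => 0 < b)).
    - apply at_right_between, Rlt_0_1.
    - now exists 0.
    - intros a b Ha Hb. now apply Rmin_glb_lt. }
  assert (HD : forall t, 0 < t -> Derive (fun t => Rpower t s * exp (- t)) t = D t)
    by (intros t Ht; now apply is_derive_unique, is_derive_Rpower_mul_exp_neg).
  apply (is_RInt_gen_ext (Derive (fun t => Rpower t s * exp (- t)))).
  { refine (filter_imp _ _ _ Hpos). intros ab Hab t Ht. apply HD. lra. }
  rewrite <- (Rminus_0_r 0) at 2.
  apply is_RInt_gen_Derive.
  - refine (filter_imp _ _ _ Hpos). intros ab Hab t Ht.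
    eexists. apply is_derive_Rpower_mul_exp_neg. lra.
  - refine (filter_imp _ _ _ Hpos). intros ab Hab t Ht. assert (Ht0 : 0 < t) by lra.
    apply (continuous_ext_loc _ D).
    + apply (filter_imp (fun u => 0 < u)); [|now apply open_gt].
      intros u Hu. symmetry. now apply HD.
    + apply (continuous_minus (fun t => s * Gamma_integrand s t) (Gamma_integrand (s + 1))).
      * apply (continuous_scal_r s (Gamma_integrand s)). now apply continuous_Gamma_integrand.
      * now apply continuous_Gamma_integrand.
  - apply (filterlim_ext (fun t => Rpower t s * exp (- (1 * t)))).
    { intros t. now rewrite Rmult_1_l. }
    apply Rpower_mul_exp_neg_at_0; lra.
  - apply (filterlim_ext (fun t => Rpower t s * exp (- (1 * t)))).
    { intros t. now rewrite Rmult_1_l. }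
    apply Rpower_mul_exp_neg_at_p_infty; lra.
Qed.

Lemma Gamma_succ (s : R) : 0 < s -> Gamma (s + 1) = s * Gamma s.
Proof.
  intros Hs.
  destruct (Gamma_integral s Hs) as [Hint _].
  destruct (Gamma_integral (s + 1)) as [Hint1 _]; [lra|].
  assert (Hdiff : is_RInt_gen (fun t => s * Gamma_integrand s t - Gamma_integrand (s + 1) t)
    (at_right 0) (Rbar_locally p_infty) (s * Gamma s - Gamma (s + 1)))
    by exact (is_RInt_gen_minus _ _ _ _ (is_RInt_gen_scal _ s _ Hint) Hint1).
  assert (Hzero : s * Gamma s - Gamma (s + 1) = 0); [|lra].
  rewrite <- (is_RInt_gen_unique _ _ (is_RInt_gen_Gamma_succ_integrand s Hs)).
  symmetry. now apply is_RInt_gen_unique.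
Qed.

(** * The Bessel power series *)

Definition bessel_coef (nu : R) (m : nat) : R :=
  (-1) ^ m / (INR (fact m) * Gamma (INR m + nu + 1)) * (/ 4) ^ m.

Definition bessel_series (nu z : R) : R := PSeries (bessel_coef nu) z.
Definition bessel_series' (nu z : R) : R := PSeries (PS_derive (bessel_coef nu)) z.
Definition bessel_series'' (nu z : R) : R :=
  PSeries (PS_derive (PS_derive (bessel_coef nu))) z.

(* [(x / 2) ^ (- nu) * J_nu x], an entire function of [x]. *)
Definition bessel_entire (nu x : R) : R := bessel_series nu (x ^ 2).
Definition bessel_entire' (nu x : R) : R := 2 * x * bessel_series' nu (x ^ 2).

(* [x * J_nu' x] *)
Definition bessel_N (nu x : R) : R :=
  Rpower (x / 2) nu * (nu * bessel_entire nu x + x * bessel_entire' nu x).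

Lemma BesselJ_eq (nu x : R) :
  0 < x -> BesselJ nu x = Rpower (x / 2) nu * bessel_entire nu x.
Proof.
  intros Hx. unfold BesselJ, bessel_entire, bessel_series, PSeries.
  rewrite <- Series_scal_l. apply Series_ext. intros m.
  unfold bessel_coef. rewrite Rpower_plus.
  replace (Rpower (x / 2) (2 * INR m)) with ((/ 4) ^ m * (x ^ 2) ^ m); [ring|].
  rewrite <- Rpow_mult_distr.
  replace (2 * INR m) with (INR (2 * m)) by (rewrite mult_INR; simpl; ring).
  rewrite Rpower_pow by lra. rewrite pow_mult. f_equal. field.
Qed.

Section BesselSeries.
Variable nu : R.
Hypothesis Hnu : -1 < nu.

Lemma Gamma_shift_pos (m : nat) : 0 < Gamma (INR m + nu + 1).
Proof. apply Gamma_pos. pose proof (pos_INR m). lra. Qed.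

Lemma bessel_coef_neq0 (m : nat) : bessel_coef nu m <> 0.
Proof.
  unfold bessel_coef. pose proof (Gamma_shift_pos m). pose proof (INR_fact_neq_0 m).
  repeat apply Rmult_integral_contrapositive_currified; try (apply pow_nonzero; lra).
  apply Rinv_neq_0_compat, Rmult_integral_contrapositive_currified; lra.
Qed.

Lemma bessel_coef_succ (m : nat) :
  bessel_coef nu (S m) = - bessel_coef nu m / (4 * (INR m + 1) * (INR m + nu + 1)).
Proof.
  unfold bessel_coef. pose proof (Gamma_shift_pos m).
  pose proof (INR_fact_neq_0 m). pose proof (pos_INR m).
  rewrite S_INR. replace (INR m + 1 + nu + 1) with ((INR m + nu + 1) + 1) by ring.
  rewrite Gamma_succ, fact_simpl, mult_INR, S_INR by lra.
  simpl pow. field. repeat split; lra.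
Qed.

Lemma CV_radius_bessel_coef : CV_radius (bessel_coef nu) = p_infty.
Proof.
  apply CV_radius_infinite_DAlembert; [exact bessel_coef_neq0|].
  apply is_lim_seq_le_le with (u := fun _ => 0) (w := fun n => / (INR n + (nu + 1))).
  - intros n. pose proof (bessel_coef_neq0 n). pose proof (pos_INR n).
    rewrite bessel_coef_succ.
    replace (- bessel_coef nu n / (4 * (INR n + 1) * (INR n + nu + 1)) / bessel_coef nu n)
      with (- / (4 * (INR n + 1) * (INR n + nu + 1))) by (field; repeat split; lra).
    assert (0 < 4 * (INR n + 1) * (INR n + nu + 1)) by (apply Rmult_lt_0_compat; lra).
    rewrite Rabs_Ropp, Rabs_pos_eq by (left; apply Rinv_0_lt_compat; lra).
    split; [left; apply Rinv_0_lt_compat; lra|]. apply Rinv_le_contravar; nra.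
  - apply is_lim_seq_const.
  - replace (Finite 0) with (Rbar_inv p_infty) by easy.
    apply is_lim_seq_inv; [|easy].
    apply (is_lim_seq_plus _ _ p_infty (nu + 1)); [|apply is_lim_seq_const|easy].
    apply is_lim_seq_INR.
Qed.

Lemma is_derive_bessel_series (z : R) :
  is_derive (bessel_series nu) z (bessel_series' nu z).
Proof. apply is_derive_PSeries. now rewrite CV_radius_bessel_coef. Qed.

Lemma is_derive_bessel_series' (z : R) :
  is_derive (bessel_series' nu) z (bessel_series'' nu z).
Proof. apply is_derive_PSeries. now rewrite CV_radius_derive, CV_radius_bessel_coef. Qed.

Lemma bessel_series_ode (z : R) :
  4 * z * bessel_series'' nu z + 4 * (nu + 1) * bessel_series' nu z
    + bessel_series nu z = 0.
Proof.
  unfold bessel_series, bessel_series', bessel_series''.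
  set (a := bessel_coef nu). set (a1 := PS_derive a). set (a2 := PS_derive a1).
  assert (Hrad : CV_radius a = p_infty) by exact CV_radius_bessel_coef.
  assert (Hex1 : ex_pseries a1 z)
    by (apply CV_radius_inside; unfold a1; now rewrite CV_radius_derive, Hrad).
  assert (Hex2 : ex_pseries a2 z)
    by (apply CV_radius_inside; unfold a2, a1; now rewrite !CV_radius_derive, Hrad).
  rewrite (PSeries_ext a (PS_opp (PS_plus (PS_scal 4 (PS_incr_1 a2))
                                 (PS_scal (4 * (nu + 1)) a1)))).
  - rewrite PSeries_opp, PSeries_plus, !PSeries_scal, PSeries_incr_1; [ring| |].
    + apply ex_pseries_scal; [apply Rmult_comm|]. now apply ex_pseries_incr_1.
    + apply ex_pseries_scal; [apply Rmult_comm|easy].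
  - intros n. unfold PS_opp, PS_plus, PS_scal, PS_incr_1, a2, a1, PS_derive, a.
    unfold opp, plus, scal; cbn -[INR]; unfold mult; cbn -[INR].
    destruct n as [|n].
    + rewrite bessel_coef_succ. unfold zero; simpl. field. lra.
    + pose proof (pos_INR n). rewrite (bessel_coef_succ (S n)), !S_INR. field. lra.
Qed.

Lemma is_derive_bessel_entire (x : R) :
  is_derive (bessel_entire nu) x (bessel_entire' nu x).
Proof.
  apply (is_derive_comp (bessel_series nu) (fun x => x ^ 2)).
  - apply is_derive_bessel_series.
  - auto_derive; [easy|ring].
Qed.

Lemma is_derive_bessel_entire' (x : R) : 0 < x ->
  is_derive (bessel_entire' nu) x
    (- ((2 * nu + 1) / x) * bessel_entire' nu x - bessel_entire nu x).
Proof.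
  intros Hx. pose proof (bessel_series_ode (x ^ 2)) as Hode.
  unfold bessel_entire', bessel_entire.
  set (b' := fun x => bessel_series' nu (x ^ 2)).
  assert (Hb' : is_derive b' x (2 * x * bessel_series'' nu (x ^ 2))).
  { apply (is_derive_comp (bessel_series' nu) (fun x => x ^ 2)).
    - apply is_derive_bessel_series'.
    - auto_derive; [easy|ring]. }
  change (bessel_series' nu (x ^ 2)) with (b' x) in *.
  change (is_derive (fun x => 2 * x * b' x) x
    (- ((2 * nu + 1) / x) * (2 * x * b' x) - bessel_series nu (x ^ 2))).
  auto_derive.
  - now exists (2 * x * bessel_series'' nu (x ^ 2)).
  - rewrite_known_Derive.
    replace (- ((2 * nu + 1) / x) * (2 * x * b' x)) with (- (2 * nu + 1) * 2 * b' x)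
      by (field; lra).
    lra.
Qed.

Lemma continuous_bessel_entire (x : R) : continuous (bessel_entire nu) x.
Proof. eapply is_derive_continuous, is_derive_bessel_entire. Qed.

Lemma continuous_bessel_series'_sqr (x : R) :
  continuous (fun x => bessel_series' nu (x ^ 2)) x.
Proof.
  apply (continuous_comp (fun x => x ^ 2) (bessel_series' nu)).
  - auto_continuous.
  - eapply is_derive_continuous, is_derive_bessel_series'.
Qed.

Lemma bessel_entire_0_pos : 0 < bessel_entire nu 0.
Proof.
  unfold bessel_entire. rewrite pow_i by lia. unfold bessel_series.
  rewrite PSeries_0. unfold bessel_coef. simpl. rewrite !Rmult_1_r, Rmult_1_l.
  apply Rdiv_lt_0_compat; [lra|]. exact (Gamma_shift_pos 0).
Qed.

Lemma bessel_series'_0 : bessel_series' nu 0 = - bessel_entire nu 0 / (4 * (nu + 1)).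
Proof.
  unfold bessel_entire. rewrite pow_i by lia. unfold bessel_series, bessel_series'.
  rewrite !PSeries_0. unfold PS_derive. rewrite bessel_coef_succ. simpl. field. lra.
Qed.

Lemma bessel_entire_bounded_at_0 : exists B, 0 < B /\
  at_right 0 (fun x => Rabs (bessel_entire nu x) <= B /\ Rabs (bessel_entire' nu x) <= B).
Proof.
  exists (Rabs (bessel_entire nu 0) + 1).
  pose proof (Rabs_pos (bessel_entire nu 0)). split; [lra|].
  apply filter_le_within.
  apply (filter_imp (fun x => Rabs (bessel_entire nu x) < Rabs (bessel_entire nu 0) + 1 /\
    Rabs (bessel_entire' nu x) < Rabs (bessel_entire nu 0) + 1)); [intros x Hx; lra|].
  apply filter_and; apply continuous_lt_locally.
  - apply continuous_Rabs_comp, continuous_bessel_entire.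
  - lra.
  - apply continuous_Rabs_comp.
    apply (continuous_mult (fun x => 2 * x) (fun x => bessel_series' nu (x ^ 2))).
    + auto_continuous.
    + apply continuous_bessel_series'_sqr.
  - unfold bessel_entire' at 1. rewrite Rmult_0_r, Rmult_0_l, Rabs_R0. lra.
Qed.

Lemma bessel_entire_pos_at_0 : at_right 0 (fun x => 0 < bessel_entire nu x).
Proof.
  apply filter_le_within. apply (continuous_bessel_entire 0 (fun y => 0 < y)).
  apply open_gt, bessel_entire_0_pos.
Qed.

End BesselSeries.

Lemma bessel_entire'_le_at_0 (nu : R) : 0 <= nu ->
  at_right 0 (fun x => Rabs (bessel_entire' nu x) <= x * bessel_entire nu x).
Proof.
  intros Hnu. assert (Hnu1 : -1 < nu) by lra.
  apply (filter_imp (fun x => 0 < x < 1 /\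
    2 * Rabs (bessel_series' nu (x ^ 2)) - bessel_entire nu x < 0)).
  { intros x [Hx Hlt]. unfold bessel_entire'.
    rewrite !Rabs_mult, (Rabs_pos_eq 2), (Rabs_pos_eq x) by lra. nra. }
  apply filter_and; [apply at_right_between; lra|]. apply filter_le_within.
  apply continuous_lt_locally.
  - apply (continuous_minus (fun x => 2 * Rabs (bessel_series' nu (x ^ 2)))).
    + apply (continuous_scal_r 2 (fun x => Rabs (bessel_series' nu (x ^ 2)))).
      now apply continuous_Rabs_comp, continuous_bessel_series'_sqr.
    + now apply continuous_bessel_entire.
  - pose proof (bessel_entire_0_pos nu Hnu1) as Hpos.
    rewrite pow_i, bessel_series'_0 by (lia || easy).
    unfold Rdiv. rewrite Rabs_mult, Rabs_Ropp, Rabs_inv.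
    rewrite (Rabs_pos_eq (bessel_entire nu 0)), (Rabs_pos_eq (4 * _)) by lra.
    assert (/ (4 * (nu + 1)) <= / 4) by (apply Rinv_le_contravar; lra). nra.
Qed.

(** * Bessel's equation as a first-order system *)

Record bessel_system (nu : R) (J N : R -> R) : Prop := {
  is_derive_J (x : R) : 0 < x -> is_derive J x (N x / x);
  is_derive_N (x : R) : 0 < x -> is_derive N x ((nu ^ 2 - x ^ 2) * J x / x)
}.

(** The solution that behaves like [x ^ nu] at [0]. *)
Record recessive_solution (nu : R) (J N : R -> R) : Prop := {
  order_nonneg : 0 <= nu;
  recessive_system : bessel_system nu J N;
  recessive_at_0 : exists B, 0 < B /\
    at_right 0 (fun x => 0 < J x <= B /\ Rabs (N x - nu * J x) <= x ^ 2 * J x)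
}.

Lemma is_derive_Rpower_half (nu x : R) : 0 < x ->
  is_derive (fun x => Rpower (x / 2) nu) x (nu / x * Rpower (x / 2) nu).
Proof. intros Hx. unfold Rpower. auto_derive; [lra|]. unfold Rdiv. field. lra. Qed.

Lemma bessel_system_BesselJ (nu : R) : -1 < nu ->
  bessel_system nu (BesselJ nu) (bessel_N nu).
Proof.
  intros Hnu. split; intros x Hx;
    set (p := fun x => Rpower (x / 2) nu);
    assert (Hpow : is_derive p x (nu / x * p x)) by (now apply is_derive_Rpower_half);
    assert (Hent := is_derive_bessel_entire nu Hnu x);
    assert (Hent' := is_derive_bessel_entire' nu Hnu x Hx);
    unfold bessel_N; change (Rpower (x / 2) nu) with (p x).
  - apply (is_derive_ext_loc (fun x => p x * bessel_entire nu x)).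
    + apply (filter_imp (fun y => 0 < y)); [|now apply open_gt].
      intros y Hy. symmetry. now apply BesselJ_eq.
    + auto_derive; [repeat split; eexists; eassumption|].
      rewrite_known_Derive. field. lra.
  - rewrite BesselJ_eq by easy. change (Rpower (x / 2) nu) with (p x).
    apply (is_derive_ext (fun x => p x * (nu * bessel_entire nu x + x * bessel_entire' nu x)));
      [easy|].
    auto_derive; [repeat split; eexists; eassumption|].
    rewrite_known_Derive. field. lra.
Qed.

Lemma recessive_BesselJ (nu : R) : 0 <= nu ->
  recessive_solution nu (BesselJ nu) (bessel_N nu).
Proof.
  intros Hnu. assert (Hnu1 : -1 < nu) by lra.
  split; [easy|now apply bessel_system_BesselJ|].
  destruct (bessel_entire_bounded_at_0 nu Hnu1) as [B [HB Hbound]].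
  exists B. split; [easy|].
  refine (filter_imp _ _ _ (filter_and _ _ (at_right_between 0 1 Rlt_0_1)
    (filter_and _ _ Hbound (filter_and _ _ (bessel_entire_pos_at_0 nu Hnu1)
      (bessel_entire'_le_at_0 nu Hnu))))).
  intros x (Hx & [Hle _] & Hpos & Hle').
  rewrite Rabs_pos_eq in Hle by lra. rewrite BesselJ_eq by easy. unfold bessel_N.
  pose proof (Rpower_pos (x / 2) nu) as Hpow.
  assert (Rpower (x / 2) nu <= 1).
  { rewrite <- (Rpower_O (x / 2)) by lra. apply Rle_Rpower_small; lra. }
  split; [split; nra|].
  replace (Rpower (x / 2) nu * (nu * bessel_entire nu x + x * bessel_entire' nu x) -
    nu * (Rpower (x / 2) nu * bessel_entire nu x))
    with (Rpower (x / 2) nu * x * bessel_entire' nu x) by ring.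
  rewrite Rabs_mult, Rabs_pos_eq by nra.
  replace (x ^ 2 * (Rpower (x / 2) nu * bessel_entire nu x))
    with (Rpower (x / 2) nu * x * (x * bessel_entire nu x)) by ring.
  apply Rmult_le_compat_l; nra.
Qed.

(** * The phase *)

(* The local frequency and the phase of the WKB approximation. *)
Definition freq (nu x : R) : R := sqrt (x ^ 2 - nu ^ 2).
Definition phase (nu x : R) : R := PI * h nu x.

Lemma freq_pos (nu x : R) : 0 <= nu < x -> 0 < freq nu x.
Proof. intros Hx. apply sqrt_lt_R0. nra. Qed.

Lemma freq_sqr (nu x : R) : 0 <= nu <= x -> freq nu x ^ 2 = x ^ 2 - nu ^ 2.
Proof. intros Hx. unfold freq. rewrite pow2_sqrt; nra. Qed.

Lemma freq_le (nu x : R) : 0 <= nu < x -> freq nu x <= x.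
Proof.
  intros Hx. pose proof (freq_sqr nu x ltac:(lra)). nra.
Qed.

Lemma freq_order_0 (x : R) : 0 <= x -> freq 0 x = x.
Proof.
  intros Hx. unfold freq. replace (x ^ 2 - 0 ^ 2) with (x ^ 2) by ring.
  now apply sqrt_pow2.
Qed.

Lemma is_derive_freq (nu x : R) : 0 <= nu < x -> is_derive (freq nu) x (x / freq nu x).
Proof.
  intros Hx. pose proof (freq_pos nu x Hx) as Hpos. unfold freq in *.
  auto_derive; [nra|].
  replace (x * (x * 1) + - (nu * (nu * 1))) with (x ^ 2 - nu ^ 2) by ring. field. lra.
Qed.

Lemma phase_eq (nu x : R) : 0 <= nu <= x -> 0 < x ->
  phase nu x = freq nu x - nu * acos (nu / x).
Proof.
  intros Hnu Hx. pose proof PI_RGT_0. unfold phase, h, g.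
  replace (PI * (x * ((sqrt (1 - (nu / x) ^ 2) - nu / x * acos (nu / x)) / PI)))
    with (x * sqrt (1 - (nu / x) ^ 2) - nu * acos (nu / x)) by (field; lra).
  f_equal. unfold freq. rewrite <- (sqrt_pow2 x) at 1 by lra.
  rewrite <- sqrt_mult_alt by nra. f_equal. field. lra.
Qed.

Lemma is_derive_phase (nu x : R) : 0 <= nu < x ->
  is_derive (phase nu) x (freq nu x / x).
Proof.
  intros Hx. pose proof (freq_pos nu x Hx) as Hpos.
  pose proof (freq_sqr nu x ltac:(lra)) as Hsqr. pose proof (Rdiv_between_0_1 nu x Hx) as Hratio.
  apply (is_derive_ext_loc (fun x => freq nu x - nu * acos (nu / x))).
  { apply (filter_imp (fun y => nu < y)); [|apply open_gt; lra].
    intros y Hy. symmetry. apply phase_eq; lra. }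
  assert (Hfreq := is_derive_freq nu x Hx).
  assert (Hacos := is_derive_acos (nu / x) ltac:(lra)).
  replace (sqrt (1 - (nu / x) ^ 2)) with (freq nu x / x) in Hacos.
  2: { unfold freq. replace (1 - (nu / x) ^ 2) with ((x ^ 2 - nu ^ 2) / x ^ 2) by (field; lra).
       rewrite sqrt_div_alt by nra. now rewrite sqrt_pow2 by lra. }
  auto_derive.
  - repeat split; try (eexists; eassumption); lra.
  - change (nu * / x) with (nu / x). rewrite_known_Derive.
    transitivity ((x ^ 2 - nu ^ 2) / (freq nu x * x)); [field; lra|].
    rewrite <- Hsqr. field. lra.
Qed.

Lemma phase_incr (nu a b : R) : 0 <= nu < a -> a < b -> phase nu a < phase nu b.
Proof.
  intros Ha Hab. apply (is_derive_pos_lt (phase nu) (fun x => freq nu x / x)); [lra| |].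
  - intros x Hx. apply is_derive_phase. lra.
  - intros x Hx. apply Rdiv_lt_0_compat; [apply freq_pos|]; lra.
Qed.

Lemma phase_nonneg (nu x : R) : 0 <= nu < x -> 0 <= phase nu x.
Proof.
  intros Hx. pose proof (Rdiv_between_0_1 nu x Hx) as Hratio. pose proof PI_RGT_0.
  unfold phase, h, g. apply Rmult_le_pos; [lra|]. apply Rmult_le_pos; [lra|].
  apply Rdiv_le_0_compat; [|lra].
  pose proof (mul_cos_le_sin _ (acos_bound (nu / x))) as Hle.
  rewrite cos_acos, sin_acos, Rsqr_pow2 in Hle by lra. lra.
Qed.

Lemma phase_pos (nu x : R) : 0 <= nu < x -> 0 < phase nu x.
Proof.
  intros Hx. apply Rle_lt_trans with (phase nu ((nu + x) / 2)).
  - apply phase_nonneg. lra.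
  - apply phase_incr; lra.
Qed.

Lemma phase_le_freq (nu x : R) : 0 <= nu < x -> phase nu x <= freq nu x.
Proof.
  intros Hx. rewrite phase_eq by lra. pose proof (acos_bound (nu / x)). nra.
Qed.

Lemma filterlim_phase_at_right (nu x : R) : 0 <= nu < x ->
  filterlim (phase nu) (at_right x) (locally (phase nu x)).
Proof.
  intros Hx. apply filterlim_at_right_continuous; [|easy].
  eapply is_derive_continuous. now apply is_derive_phase.
Qed.

Lemma filterlim_phase_turning_point (nu : R) : 0 <= nu ->
  filterlim (phase nu) (at_right nu) (locally 0).
Proof.
  intros Hnu. apply (filterlim_Rabs_le _ (freq nu)).
  - apply (filter_imp (fun x => nu < x < nu + 1)); [|apply at_right_between; lra].
    intros x Hx.
    pose proof (phase_nonneg nu x ltac:(lra)).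
    rewrite Rminus_0_r, Rabs_pos_eq by easy. apply phase_le_freq. lra.
  - apply filterlim_at_right_continuous.
    + apply (continuous_sqrt_comp (fun x => x ^ 2 - nu ^ 2)).
      auto_continuous.
    + unfold freq. now rewrite Rminus_diag, sqrt_0.
Qed.

Lemma filterlim_freq_sub_id (nu : R) : 0 <= nu ->
  filterlim (fun x => freq nu x - x) (Rbar_locally p_infty) (locally 0).
Proof.
  intros Hnu. apply (filterlim_Rabs_le _ (fun x => nu ^ 2 / x)); [|apply filterlim_div_p_infty].
  exists nu. intros x Hx.
  pose proof (freq_pos nu x ltac:(lra)). pose proof (freq_sqr nu x ltac:(lra)).
  pose proof (freq_le nu x ltac:(lra)).
  rewrite Rminus_0_r, Rabs_left1 by lra.
  apply Rmult_le_reg_r with x; [lra|].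
  unfold Rdiv. rewrite Rmult_assoc, Rinv_l by lra. nra.
Qed.

Lemma phase_asymptotic (nu : R) : 0 <= nu ->
  filterlim (fun x => phase nu x - (x - nu * PI / 2)) (Rbar_locally p_infty) (locally 0).
Proof.
  intros Hnu.
  apply (filterlim_ext_loc (fun x => (freq nu x - x) - nu * (acos (nu / x) - PI / 2))).
  { exists nu. intros x Hx. rewrite phase_eq by lra. field. }
  replace 0 with (0 - nu * (PI / 2 - PI / 2)) by ring.
  apply (is_lim_minus' (fun x => freq nu x - x) (fun x => nu * (acos (nu / x) - PI / 2))
    p_infty); [now apply filterlim_freq_sub_id|].
  apply (is_lim_scal_l (fun x => acos (nu / x) - PI / 2) nu p_infty (PI / 2 - PI / 2)).
  apply (is_lim_minus' (fun x => acos (nu / x)) (fun _ => PI / 2) p_infty);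
    [|apply is_lim_const].
  rewrite <- acos_0. apply (filterlim_comp _ _ _ (fun x => nu / x) acos _ (locally 0)).
  - apply filterlim_div_p_infty.
  - apply (is_derive_continuous acos 0 (- / sqrt (1 - 0 ^ 2))), is_derive_acos. lra.
Qed.

Lemma phase_at_p_infty (nu : R) : 0 <= nu ->
  filterlim (phase nu) (Rbar_locally p_infty) (Rbar_locally p_infty).
Proof.
  intros Hnu P [M HM]. change (Rbar_locally p_infty (fun x => P (phase nu x))).
  apply (filter_imp (fun x => Rabs (phase nu x - (x - nu * PI / 2) - 0) < 1 /\
    M + 1 + nu * PI / 2 < x)).
  - intros x [Hx HMx]. apply (HM (phase nu x)). apply Rabs_def2 in Hx. lra.
  - apply filter_and; [|now exists (M + 1 + nu * PI / 2)].
    apply filterlim_Rabs_lt; [now apply phase_asymptotic|lra].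
Qed.

(** * Oscillation of solutions *)

Definition energy (nu : R) (J N : R -> R) (x : R) : R :=
  N x ^ 2 + (x ^ 2 - nu ^ 2) * J x ^ 2.

(* The logarithmic derivative of [sqrt freq * J] with respect to [phase]. *)
Definition riccati (nu : R) (J N : R -> R) (x : R) : R :=
  N x / J x / freq nu x + x ^ 2 / (2 * freq nu x ^ 3).

(* The Wronskian, with respect to [phase], of [N / sqrt freq] and [sin (phase - p)]. *)
Definition sturm_wronskian (nu : R) (J N : R -> R) (p x : R) : R :=
  ((- (freq nu x * J x) - x ^ 2 * N x / (2 * freq nu x ^ 3)) * sin (phase nu x - p)
   - N x * cos (phase nu x - p)) / sqrt (freq nu x).

Lemma bessel_system_opp (nu : R) (J N : R -> R) :
  bessel_system nu J N -> bessel_system nu (fun x => - J x) (fun x => - N x).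
Proof.
  intros HS. split; intros x Hx.
  - replace (- N x / x) with (opp (N x / x)) by (unfold opp; simpl; field; lra).
    now apply (is_derive_opp J), (is_derive_J nu J N).
  - replace ((nu ^ 2 - x ^ 2) * - J x / x) with (opp ((nu ^ 2 - x ^ 2) * J x / x))
      by (unfold opp; simpl; field; lra).
    now apply (is_derive_opp N), (is_derive_N nu J N).
Qed.

Section Oscillation.
Variables (nu : R) (J N : R -> R).
Hypothesis Hnu : 0 <= nu.
Hypothesis HS : bessel_system nu J N.

Lemma is_derive_energy (x : R) : 0 < x ->
  is_derive (energy nu J N) x (2 * x * J x ^ 2).
Proof.
  intros Hx. assert (HJ := is_derive_J nu J N HS x Hx).
  assert (HN := is_derive_N nu J N HS x Hx). unfold energy. auto_derive.
  - repeat split; eexists; eassumption.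
  - rewrite_known_Derive. field. lra.
Qed.

Lemma energy_nondecreasing (a b : R) : 0 < a -> a <= b ->
  energy nu J N a <= energy nu J N b.
Proof.
  intros Ha Hab. apply (is_derive_nonneg_le _ (fun x => 2 * x * J x ^ 2)); [easy| |].
  - intros x Hx. apply is_derive_energy. lra.
  - intros x Hx. apply Rmult_le_pos; [lra|]. apply pow2_ge_0.
Qed.

Lemma energy_increasing (a b : R) : 0 < a -> a < b ->
  (forall x, a <= x <= b -> J x <> 0) -> energy nu J N a < energy nu J N b.
Proof.
  intros Ha Hab HJ. apply (is_derive_pos_lt _ (fun x => 2 * x * J x ^ 2)); [easy| |].
  - intros x Hx. apply is_derive_energy. lra.
  - intros x Hx. apply Rmult_lt_0_compat; [lra|]. now apply pow2_gt_0, HJ.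
Qed.

Lemma is_derive_N_freq (x : R) : nu < x ->
  is_derive N x (- (freq nu x ^ 2 * J x / x)).
Proof.
  intros Hx. rewrite freq_sqr by lra.
  replace (- ((x ^ 2 - nu ^ 2) * J x / x)) with ((nu ^ 2 - x ^ 2) * J x / x)
    by (field; lra).
  apply (is_derive_N nu J N HS). lra.
Qed.

Lemma is_derive_riccati (x : R) : nu < x -> J x <> 0 ->
  is_derive (riccati nu J N) x
    (- ((1 + riccati nu J N x ^ 2) * (freq nu x / x))
     - x * (5 / 4 * x ^ 2 - freq nu x ^ 2) / freq nu x ^ 5).
Proof.
  intros Hx HJx. assert (HJ := is_derive_J nu J N HS x ltac:(lra)).
  assert (HN := is_derive_N_freq x Hx). assert (Hfreq := is_derive_freq nu x ltac:(lra)).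
  pose proof (freq_pos nu x ltac:(lra)) as Hpos.
  unfold riccati. auto_derive.
  - repeat split; try (eexists; eassumption); try easy; try lra.
    apply Rmult_integral_contrapositive_currified; [lra|].
    apply (pow_nonzero (freq nu x) 3). lra.
  - rewrite_known_Derive. field. repeat split; try lra; easy.
Qed.

(* By the Riccati equation, [atan riccati + phase] is nonincreasing between zeros of [J]. *)
Lemma phase_gap_lt_PI (a b : R) : nu < a -> a < b ->
  (forall x, a <= x <= b -> J x <> 0) -> phase nu b - phase nu a < PI.
Proof.
  intros Ha Hab HJ. set (r := riccati nu J N).
  assert (Hmono : - (atan (r a) + phase nu a) <= - (atan (r b) + phase nu b)).
  { apply (is_derive_nonneg_le (fun x => - (atan (r x) + phase nu x))
      (fun x => x * (5 / 4 * x ^ 2 - freq nu x ^ 2) / freq nu x ^ 5 / (1 + r x ^ 2))); [lra| |];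
      intros x Hx; pose proof (freq_pos nu x ltac:(lra)) as Hpos;
      assert (Hden : 0 < 1 + r x ^ 2) by (pose proof (pow2_ge_0 (r x)); lra).
    - assert (Hr : is_derive r x _) by (apply is_derive_riccati; [lra|now apply HJ]).
      assert (Hphase := is_derive_phase nu x ltac:(lra)).
      fold r in Hr. auto_derive.
      + repeat split; eexists; eassumption.
      + rewrite_known_Derive. unfold Rsqr. field. repeat split; lra.
    - pose proof (freq_le nu x ltac:(lra)).
      apply Rdiv_le_0_compat; [|lra]. apply Rdiv_le_0_compat; [|apply pow_lt; lra].
      apply Rmult_le_pos; [lra|nra]. }
  pose proof (atan_bound (r a)). pose proof (atan_bound (r b)). lra.
Qed.

Lemma phase_gap_le_PI (c d l : R) : nu <= c -> c < d ->
  (forall x, c < x < d -> J x <> 0) ->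
  filterlim (phase nu) (at_right c) (locally l) -> phase nu d <= l + PI.
Proof.
  intros Hc Hcd HJ Hlim. apply Rnot_lt_le. intros Hlt.
  set (eps := (phase nu d - (l + PI)) / 2). assert (Heps : 0 < eps) by (unfold eps; lra).
  assert (Hcont : filterlim (phase nu) (at_left d) (locally (phase nu d))).
  { apply filterlim_at_left_continuous; [|easy].
    eapply is_derive_continuous. apply is_derive_phase. lra. }
  destruct (filter_ex (F := at_left d) _ (filter_and _ _ (at_left_between d c Hcd)
    (filterlim_Rabs_lt _ _ _ Hcont Heps))) as [b [Hb Hphb]].
  destruct (filter_ex (F := at_right c) _ (filter_and _ _ (at_right_between c b (proj1 Hb))
    (filterlim_Rabs_lt _ _ _ Hlim Heps))) as [a [Ha Hpha]].
  assert (phase nu b - phase nu a < PI).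
  { apply phase_gap_lt_PI; try lra. intros x Hx. apply HJ. lra. }
  apply Rabs_def2 in Hphb. apply Rabs_def2 in Hpha. unfold eps in *. lra.
Qed.

Lemma J_zero_after (a : R) : exists z, a < z /\ J z = 0.
Proof.
  apply NNPP. intros Hnone. pose proof (Rmax_l nu a). pose proof (Rmax_r nu a).
  set (b := Rmax nu a + 1) in *.
  destruct (filter_ex (F := Rbar_locally p_infty) _ (filter_and _ _ (p_infty_gt b)
    (phase_at_p_infty nu Hnu _ (p_infty_gt (phase nu b + PI))))) as [x [Hbx Hx]].
  assert (phase nu x - phase nu b < PI); [|lra].
  apply phase_gap_lt_PI; unfold b in *; try lra.
  intros y Hy HJy. apply Hnone. exists y. split; [lra|easy].
Qed.

Lemma is_derive_sqrt_freq (x : R) : nu < x ->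
  is_derive (fun x => sqrt (freq nu x)) x (x * sqrt (freq nu x) / (2 * freq nu x ^ 2)).
Proof.
  intros Hx. assert (Hfreq := is_derive_freq nu x ltac:(lra)).
  pose proof (freq_pos nu x ltac:(lra)) as Hpos.
  assert (Hsqrt : 0 < sqrt (freq nu x)) by now apply sqrt_lt_R0.
  auto_derive.
  - split; [eexists; eassumption|easy].
  - rewrite_known_Derive.
    transitivity (x * sqrt (freq nu x) /
      (2 * freq nu x * (sqrt (freq nu x) * sqrt (freq nu x)))); [field; lra|].
    rewrite sqrt_sqrt by lra. field. lra.
Qed.

Lemma is_derive_sturm_wronskian (p x : R) : nu < x ->
  is_derive (sturm_wronskian nu J N p) x
    (x * (7 / 4 * x ^ 2 - freq nu x ^ 2) / freq nu x ^ 5 *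
     (N x / sqrt (freq nu x)) * sin (phase nu x - p)).
Proof.
  intros Hx. assert (HJ := is_derive_J nu J N HS x ltac:(lra)).
  assert (HN := is_derive_N_freq x Hx). assert (Hfreq := is_derive_freq nu x ltac:(lra)).
  assert (Hphase := is_derive_phase nu x ltac:(lra)).
  pose proof (freq_pos nu x ltac:(lra)) as Hpos.
  set (q := fun x => sqrt (freq nu x)).
  assert (Hq : is_derive q x (x * q x / (2 * freq nu x ^ 2)))
    by now apply is_derive_sqrt_freq.
  assert (Hqpos : 0 < q x) by now apply sqrt_lt_R0.
  change (sqrt (freq nu x)) with (q x).
  apply (is_derive_ext (fun x =>
    ((- (freq nu x * J x) - x ^ 2 * N x / (2 * freq nu x ^ 3)) * sin (phase nu x - p)
     - N x * cos (phase nu x - p)) / q x)); [easy|].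
  auto_derive.
  - repeat split; try (eexists; eassumption); try easy; try lra.
    apply Rmult_integral_contrapositive_currified; [lra|].
    apply (pow_nonzero (freq nu x) 3). lra.
  - rewrite_known_Derive. change (phase nu x + - p) with (phase nu x - p).
    field. repeat split; lra.
Qed.

Lemma J_nonneg_of_N_pos_left (c1 c2 : R) : nu < c2 -> c1 < c2 ->
  (forall x, c1 < x < c2 -> 0 < N x) -> N c2 = 0 -> 0 <= J c2.
Proof.
  intros Hc2 Hc HN HNc2. apply Rnot_lt_le. intros HJ.
  pose proof (freq_pos nu c2 ltac:(lra)) as Hpos.
  assert (Hslope : 0 < - (freq nu c2 ^ 2 * J c2 / c2)).
  { replace (- (freq nu c2 ^ 2 * J c2 / c2)) with (freq nu c2 ^ 2 * - J c2 / c2)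
      by (field; lra).
    apply Rdiv_lt_0_compat; [|lra]. apply Rmult_lt_0_compat; [now apply pow_lt|lra]. }
  destruct (filter_ex (F := at_left c2) _ (filter_and _ _ (at_left_between c2 c1 Hc)
    (filter_le_within _ _ (is_derive_sign N c2 _ (is_derive_N_freq c2 Hc2)
      (Rgt_not_eq _ _ Hslope) HNc2)))) as [y [Hy Hsign]].
  specialize (Hsign ltac:(lra)). specialize (HN y Hy).
  assert (0 < - (freq nu c2 ^ 2 * J c2 / c2) * (c2 - y) * N y).
  { apply Rmult_lt_0_compat; [|easy]. apply Rmult_lt_0_compat; lra. }
  lra.
Qed.

Lemma sturm_wronskian_nondecreasing (p a b : R) : nu < a -> a <= b ->
  (forall x, a <= x <= b -> 0 <= N x) ->
  (forall x, a <= x <= b -> 0 <= phase nu x - p <= PI) ->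
  sturm_wronskian nu J N p a <= sturm_wronskian nu J N p b.
Proof.
  intros Ha Hab HN Hphase.
  apply (is_derive_nonneg_le _ (fun x => x * (7 / 4 * x ^ 2 - freq nu x ^ 2) / freq nu x ^ 5 *
     (N x / sqrt (freq nu x)) * sin (phase nu x - p))); [easy| |]; intros x Hx.
  - apply is_derive_sturm_wronskian. lra.
  - pose proof (freq_pos nu x ltac:(lra)) as Hpos. pose proof (freq_le nu x ltac:(lra)).
    assert (0 < sqrt (freq nu x)) by now apply sqrt_lt_R0.
    specialize (Hphase x Hx). apply Rmult_le_pos; [|apply sin_ge_0; lra].
    apply Rmult_le_pos.
    + apply Rdiv_le_0_compat; [|now apply pow_lt]. apply Rmult_le_pos; [lra|nra].
    + apply Rdiv_le_0_compat; [now apply HN|easy].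
Qed.

Lemma N_pos_excludes_zero_within_PI (p c1 c2 : R) : nu <= c1 -> c1 < c2 ->
  (forall x, c1 < x < c2 -> 0 < N x) -> N c2 = 0 -> J c2 <> 0 ->
  (forall x, c1 < x <= c2 -> 0 < phase nu x - p < PI) ->
  ~ filterlim (sturm_wronskian nu J N p) (at_right c1) (locally 0).
Proof.
  intros Hc1 Hc HN HNc2 HJc2 Hphase Hlim.
  pose proof (freq_pos nu c2 ltac:(lra)) as Hpos.
  assert (HJ : 0 < J c2).
  { destruct (J_nonneg_of_N_pos_left c1 c2) as [HJ|HJ]; try easy; [lra|]. now symmetry in HJ. }
  assert (Hneg : sturm_wronskian nu J N p c2 < 0).
  { unfold sturm_wronskian. rewrite HNc2.
    assert (Hsqrt : 0 < sqrt (freq nu c2)) by now apply sqrt_lt_R0.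
    assert (Hsin : 0 < sin (phase nu c2 - p)) by (apply sin_gt_0; apply Hphase; lra).
    replace (((- (freq nu c2 * J c2) - c2 ^ 2 * 0 / (2 * freq nu c2 ^ 3)) *
        sin (phase nu c2 - p) - 0 * cos (phase nu c2 - p)) / sqrt (freq nu c2))
      with (- (freq nu c2 * J c2 * sin (phase nu c2 - p) / sqrt (freq nu c2)))
      by (field; split; lra).
    apply Ropp_lt_gt_0_contravar, Rdiv_lt_0_compat; [|easy].
    apply Rmult_lt_0_compat; [nra|easy]. }
  destruct (filter_ex (F := at_right c1) _ (filter_and _ _ (at_right_between c1 c2 Hc)
    (filterlim_Rabs_lt _ _ (- sturm_wronskian nu J N p c2) Hlim ltac:(lra))))
    as [a [Ha Hwa]].
  assert (sturm_wronskian nu J N p a <= sturm_wronskian nu J N p c2).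
  { apply sturm_wronskian_nondecreasing; try lra; intros x Hx.
    - destruct (Rle_lt_or_eq_dec x c2 (proj2 Hx)) as [Hlt| ->]; [|lra].
      left. apply HN. lra.
    - specialize (Hphase x ltac:(lra)). lra. }
  apply Rabs_def2 in Hwa. lra.
Qed.

End Oscillation.

Lemma N_zero_phase_ge (nu : R) (J N : R -> R) (p c1 c2 : R) :
  0 <= nu -> bessel_system nu J N -> nu <= c1 -> c1 < c2 ->
  (forall x, c1 < x < c2 -> N x <> 0) -> N c2 = 0 -> J c2 <> 0 ->
  (forall x, c1 < x <= c2 -> p < phase nu x) ->
  filterlim (sturm_wronskian nu J N p) (at_right c1) (locally 0) ->
  p + PI <= phase nu c2.
Proof.
  intros Hnu HS Hc1 Hc HN HNc2 HJc2 Hp Hlim. apply Rnot_lt_le. intros Hlt.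
  assert (Hphase : forall x, c1 < x <= c2 -> 0 < phase nu x - p < PI).
  { intros x Hx. specialize (Hp x Hx).
    destruct (Rle_lt_or_eq_dec x c2 (proj2 Hx)) as [Hxc| ->]; [|lra].
    pose proof (phase_incr nu x c2 ltac:(lra) Hxc). lra. }
  destruct (neq0_const_sign N c1 c2) as [Hpos|Hneg]; [|easy| |].
  - intros x Hx. eapply is_derive_continuity_pt, (is_derive_N nu J N HS). lra.
  - revert Hlim. now apply (N_pos_excludes_zero_within_PI nu J N Hnu HS p c1 c2).
  - apply (N_pos_excludes_zero_within_PI nu (fun x => - J x) (fun x => - N x) Hnu
      (bessel_system_opp nu J N HS) p c1 c2); try easy; try lra.
    + intros x Hx. specialize (Hneg x Hx). lra.
    + apply (filterlim_ext_loc (fun x => - sturm_wronskian nu J N p x)).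
      * apply (filter_imp (fun x => c1 < x < c2)); [|now apply at_right_between].
        intros x Hx. pose proof (freq_pos nu x ltac:(lra)) as Hfreq.
        assert (0 < sqrt (freq nu x)) by now apply sqrt_lt_R0.
        unfold sturm_wronskian. field. split; lra.
      * rewrite <- Ropp_0. eapply filterlim_comp; [exact Hlim|].
        apply (filterlim_opp (V := R_NormedModule) 0).
Qed.

Section RecessiveSolution.
Variables (nu : R) (J N : R -> R).
Hypothesis HP : recessive_solution nu J N.

Let Hnu : 0 <= nu := order_nonneg nu J N HP.
Let HS : bessel_system nu J N := recessive_system nu J N HP.

Lemma J_pos_near_0 : exists c, 0 < c /\ forall x, 0 < x < c -> 0 < J x.
Proof.
  destruct (recessive_at_0 nu J N HP) as [B [_ Hnear]].
  apply at_right_interval. refine (filter_imp _ _ _ Hnear). now intros x [[Hx _] _].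
Qed.

Lemma energy_nonneg (x : R) : 0 < x -> 0 <= energy nu J N x.
Proof.
  intros Hx. apply Rnot_lt_le. intros Hneg.
  destruct (recessive_at_0 nu J N HP) as [B [HB Hnear]].
  assert (Hsmall : at_right 0 (fun s => 2 * nu * B ^ 2 * s ^ 2 < - energy nu J N x)).
  { apply filter_le_within. apply continuous_lt_locally.
    - auto_continuous.
    - rewrite pow_i by lia. lra. }
  destruct (filter_ex (F := at_right 0) _ (filter_and _ _ (at_right_between 0 x Hx)
    (filter_and _ _ Hnear Hsmall))) as (s & Hs & [HJ HN] & Hlt).
  assert (Hlow : - (2 * nu * B ^ 2 * s ^ 2) <= energy nu J N s).
  { unfold energy. set (d := N s - nu * J s) in *.
    replace (N s) with (d + nu * J s) by (unfold d; ring).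
    apply Rabs_le_between in HN. destruct HN as [HN _].
    assert (0 <= nu * J s * (d + s ^ 2 * J s))
      by (apply Rmult_le_pos; [apply Rmult_le_pos|]; lra).
    assert (J s ^ 2 <= B ^ 2) by (apply pow_incr; lra).
    assert (nu * s ^ 2 * J s ^ 2 <= nu * s ^ 2 * B ^ 2).
    { apply Rmult_le_compat_l; [|easy]. apply Rmult_le_pos; [easy|apply pow2_ge_0]. }
    pose proof (pow2_ge_0 d). nra. }
  pose proof (energy_nondecreasing nu J N HS s x ltac:(lra) ltac:(lra)). lra.
Qed.

Lemma energy_pos (x : R) : 0 < x -> 0 < energy nu J N x.
Proof.
  intros Hx. destruct J_pos_near_0 as [c [Hc HJ]].
  pose proof (Rmin_l c x). pose proof (Rmin_r c x). pose proof (Rmin_glb_lt c x 0 Hc Hx).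
  set (t := Rmin c x) in *.
  apply Rle_lt_trans with (energy nu J N (t / 3)); [apply energy_nonneg; lra|].
  apply Rlt_le_trans with (energy nu J N (t / 2)).
  - apply (energy_increasing nu J N HS); try lra.
    intros y Hy. apply Rgt_not_eq, HJ. lra.
  - apply (energy_nondecreasing nu J N HS); lra.
Qed.

Lemma N_zero_spec (x : R) : 0 < x -> N x = 0 -> nu < x /\ J x <> 0.
Proof.
  intros Hx HN. pose proof (energy_pos x Hx) as Hpos. unfold energy in Hpos.
  rewrite HN in Hpos. split.
  - apply Rnot_le_lt. intros Hle. assert (x ^ 2 <= nu ^ 2) by nra. nra.
  - intros HJ. rewrite HJ in Hpos. lra.
Qed.

Lemma J_zero_N_neq0 (x : R) : 0 < x -> J x = 0 -> N x <> 0.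
Proof. intros Hx HJ HN. now apply (N_zero_spec x Hx HN). Qed.

Lemma ratio_decr (a b : R) : 0 < a -> a < b ->
  (forall x, a <= x <= b -> J x <> 0) -> N b / J b < N a / J a.
Proof.
  intros Ha Hab HJ0. apply Ropp_lt_cancel.
  apply (is_derive_pos_lt (fun x => - (N x / J x))
    (fun x => energy nu J N x / (x * J x ^ 2))); [easy| |]; intros x Hx;
    assert (Hx0 : 0 < x) by lra; specialize (HJ0 x Hx).
  - assert (HJ := is_derive_J nu J N HS x Hx0). assert (HN := is_derive_N nu J N HS x Hx0).
    auto_derive.
    + repeat split; try (eexists; eassumption); easy.
    + rewrite_known_Derive. unfold energy. field. split; [easy|lra].
  - apply Rdiv_lt_0_compat; [now apply energy_pos|].
    apply Rmult_lt_0_compat; [easy|]. now apply pow2_gt_0.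
Qed.

Lemma shifted_inv_ratio_incr (d a b : R) : 0 < a -> a < b ->
  (forall x, a <= x <= b -> N x - d * J x <> 0) ->
  J a / (N a - d * J a) < J b / (N b - d * J b).
Proof.
  intros Ha Hab Hneq.
  apply (is_derive_pos_lt (fun x => J x / (N x - d * J x))
    (fun x => energy nu J N x / (x * (N x - d * J x) ^ 2))); [easy| |]; intros x Hx;
    assert (Hx0 : 0 < x) by lra; specialize (Hneq x Hx).
  - assert (HJ := is_derive_J nu J N HS x Hx0). assert (HN := is_derive_N nu J N HS x Hx0).
    auto_derive.
    + repeat split; try (eexists; eassumption); easy.
    + rewrite_known_Derive. unfold energy. field. split; [easy|lra].
  - apply Rdiv_lt_0_compat; [now apply energy_pos|].
    apply Rmult_lt_0_compat; [easy|]. now apply pow2_gt_0.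
Qed.

Lemma N_zero_spacing (c1 c2 : R) : 0 < c1 -> c1 < c2 -> N c1 = 0 -> N c2 = 0 ->
  (forall x, c1 < x < c2 -> N x <> 0) -> phase nu c1 + PI <= phase nu c2.
Proof.
  intros Hc1 Hc HN1 HN2 HN. destruct (N_zero_spec c1 Hc1 HN1) as [Hnu1 _].
  destruct (N_zero_spec c2 ltac:(lra) HN2) as [_ HJ2].
  apply (N_zero_phase_ge nu J N (phase nu c1) c1 c2); try easy; try lra.
  - intros x Hx. apply phase_incr; lra.
  - apply filterlim_at_right_continuous.
    + eapply is_derive_continuous. now apply is_derive_sturm_wronskian.
    + pose proof (freq_pos nu c1 ltac:(lra)) as Hfreq.
      assert (0 < sqrt (freq nu c1)) by now apply sqrt_lt_R0.
      unfold sturm_wronskian. rewrite HN1, Rminus_diag, sin_0. field. split; lra.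
Qed.

End RecessiveSolution.

Lemma sturm_wronskian_order_0_le (J N : R -> R) (B x : R) : 0 < x <= 1 ->
  0 < J x <= B -> Rabs (N x) <= x ^ 2 * J x ->
  Rabs (sturm_wronskian 0 J N 0 x) <= 5 / 2 * B * sqrt x.
Proof.
  intros Hx HJ HN. unfold sturm_wronskian. rewrite freq_order_0 by lra.
  set (S := sin (phase 0 x - 0)). set (C := cos (phase 0 x - 0)).
  assert (HSb : Rabs S <= 1) by apply Rabs_sin_le_1.
  assert (HCb : Rabs C <= 1) by apply Rabs_cos_le_1.
  assert (Hsqrt : 0 < sqrt x) by (apply sqrt_lt_R0; lra).
  assert (HNx : Rabs (N x / x) <= x * B).
  { unfold Rdiv. rewrite Rabs_mult, (Rabs_pos_eq (/ x)) by (left; apply Rinv_0_lt_compat; lra).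
    apply Rmult_le_reg_r with x; [lra|]. rewrite Rmult_assoc, Rinv_l by lra. nra. }
  replace (((- (x * J x) - x ^ 2 * N x / (2 * x ^ 3)) * S - N x * C) / sqrt x)
    with ((- (x * J x * S) - N x / x * (S / 2 + x * C)) / sqrt x) by (field; lra).
  unfold Rdiv at 1. rewrite Rabs_mult, Rabs_inv, (Rabs_pos_eq (sqrt x)) by lra.
  apply Rmult_le_reg_r with (sqrt x); [easy|].
  rewrite Rmult_assoc, Rinv_l, (Rmult_assoc _ (sqrt x)), sqrt_sqrt, Rmult_1_r by lra.
  assert (HJS : Rabs (x * J x * S) <= x * B).
  { rewrite Rabs_mult, (Rabs_pos_eq (x * J x)) by nra.
    rewrite <- (Rmult_1_r (x * B)). apply Rmult_le_compat; try easy; try apply Rabs_pos; nra. }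
  assert (HSC : Rabs (S / 2 + x * C) <= 3 / 2).
  { eapply Rle_trans; [apply Rabs_triang|].
    unfold Rdiv. rewrite !Rabs_mult, (Rabs_pos_eq (/ 2)), (Rabs_pos_eq x) by lra.
    nra. }
  eapply Rle_trans; [apply Rabs_triang|]. rewrite !Rabs_Ropp, (Rabs_mult (N x / x)).
  pose proof (Rabs_pos (N x / x)). nra.
Qed.

Lemma N_first_zero_order_0 (J N : R -> R) (c : R) : recessive_solution 0 J N ->
  0 < c -> N c = 0 -> (forall x, 0 < x < c -> N x <> 0) -> PI <= phase 0 c.
Proof.
  intros HP Hc HNc HN. destruct (N_zero_spec 0 J N HP c Hc HNc) as [_ HJc].
  rewrite <- (Rplus_0_l PI).
  apply (N_zero_phase_ge 0 J N 0 0 c); try easy; try lra.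
  - exact (recessive_system 0 J N HP).
  - intros x Hx. apply phase_pos. lra.
  - destruct (recessive_at_0 0 J N HP) as [B [HB Hnear]].
    apply (filterlim_Rabs_le _ (fun x => 5 / 2 * B * sqrt x)).
    + refine (filter_imp _ _ _ (filter_and _ _ (at_right_between 0 1 Rlt_0_1) Hnear)).
      intros x (Hx & HJ & HNx). rewrite Rmult_0_l, Rminus_0_r in HNx. rewrite Rminus_0_r.
      apply sturm_wronskian_order_0_le; lra.
    + apply filterlim_at_right_continuous.
      * apply (continuous_scal_r (5 / 2 * B) sqrt), continuous_sqrt.
      * rewrite sqrt_0. ring.
Qed.

(** * Zeros of [J] and of [N - d * J] *)

Definition is_next_zero (f : R -> R) (a b : R) : Prop :=
  a < b /\ f b = 0 /\ forall x, a < x < b -> f x <> 0.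

Lemma next_zero_exists (f : R -> R) (a z : R) :
  (forall x, a < x -> continuous f x) -> at_right a (fun x => f x <> 0) ->
  a < z -> f z = 0 -> exists b, is_next_zero f a b.
Proof.
  intros Hcont Hright Haz Hfz.
  destruct (at_right_interval a _ Hright) as [c [Hac Hc]].
  set (S := fun x => a < x /\ forall y, a < y <= x -> f y <> 0).
  assert (Hmid : S ((a + c) / 2)) by (split; [lra|intros y Hy; apply Hc; lra]).
  destruct (completeness S) as [b [Hub Hlub]].
  - exists z. intros x [_ Hx]. apply Rnot_lt_le. intros Hlt. apply (Hx z); lra.
  - now exists ((a + c) / 2).
  - assert (Hab : a < b) by (specialize (Hub _ Hmid); lra).
    assert (Hbelow : forall x, a < x < b -> f x <> 0).
    { intros x Hx Hfx. assert (b <= x); [|lra]. apply Hlub. intros s [_ Hs].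
      apply Rnot_lt_le. intros Hlt. apply (Hs x); lra. }
    exists b. split; [easy|]. split; [|easy]. apply NNPP. intros Hfb.
    destruct (at_right_interval b (fun x => f x <> 0)) as [d [Hbd Hd]].
    { apply filter_le_within. apply (Hcont b Hab (fun u => u <> 0)). now apply open_neq. }
    assert ((b + d) / 2 <= b); [|lra].
    apply Hub. split; [lra|]. intros y Hy.
    destruct (Rtotal_order y b) as [Hlt|[->|Hgt]];
      [apply Hbelow; lra|easy|apply Hd; lra].
Qed.

(* Started at the boundary point [0], which need not itself be a zero. *)
Fixpoint zero_seq (f : R -> R) (k : nat) : R :=
  match k with
  | O => 0
  | S k => epsilon (inhabits 0) (is_next_zero f (zero_seq f k))
  end.

Definition is_level_zero (J N : R -> R) (d : R) (k : nat) (x : R) : Prop :=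
  zero_seq J k < x < zero_seq J (S k) /\ N x = d * J x.

Definition level_zero (J N : R -> R) (d : R) (k : nat) : R :=
  epsilon (inhabits 0) (is_level_zero J N d k).

Section Zeros.
Variables (nu : R) (J N : R -> R).
Hypothesis HP : recessive_solution nu J N.

Let Hnu : 0 <= nu := order_nonneg nu J N HP.
Let HS : bessel_system nu J N := recessive_system nu J N HP.

Notation z := (zero_seq J).

Lemma continuous_J (x : R) : 0 < x -> continuous J x.
Proof. intros Hx. eapply is_derive_continuous. now apply (is_derive_J nu J N HS). Qed.

Lemma J_zero_isolated_right (a : R) : 0 < a -> J a = 0 -> at_right a (fun x => J x <> 0).
Proof.
  intros Ha HJ. apply (filter_imp (fun x => x > a /\ (x <> a -> 0 < N a / a * (x - a) * J x))).
  - intros x [Hxa Hsign] HJx. rewrite HJx, Rmult_0_r in Hsign. lra.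
  - apply filter_and; [now apply (filter_forall (F := locally a))|].
    apply filter_le_within. apply is_derive_sign; [now apply (is_derive_J nu J N HS)| |easy].
    apply Rmult_integral_contrapositive_currified; [|apply Rinv_neq_0_compat; lra].
    now apply (J_zero_N_neq0 nu J N HP).
Qed.

Lemma zero_seq_spec (k : nat) : 0 <= z k /\ is_next_zero J (z k) (z (S k)).
Proof.
  assert (Hnext : forall a, 0 <= a -> at_right a (fun x => J x <> 0) ->
    is_next_zero J a (epsilon (inhabits 0) (is_next_zero J a))).
  { intros a Ha Hright. apply epsilon_spec.
    destruct (J_zero_after nu J N Hnu HS a) as [b [Hab HJb]].
    apply (next_zero_exists J a b); try easy. intros x Hx. apply continuous_J. lra. }
  induction k as [|k [IHpos IHnext]].
  - split; [simpl; lra|]. apply Hnext; [simpl; lra|].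
    destruct (J_pos_near_0 nu J N HP) as [c [Hc HJ]].
    refine (filter_imp _ _ _ (at_right_between 0 c Hc)).
    intros x Hx. now apply Rgt_not_eq, HJ.
  - assert (Hpos : 0 < z (S k)) by (destruct IHnext; lra).
    split; [lra|]. apply Hnext; [lra|]. apply J_zero_isolated_right; [easy|apply IHnext].
Qed.

Lemma zero_seq_nonneg (k : nat) : 0 <= z k.
Proof. apply zero_seq_spec. Qed.

Lemma zero_seq_lt (k : nat) : z k < z (S k).
Proof. apply zero_seq_spec. Qed.

Lemma zero_seq_pos (k : nat) : 0 < z (S k).
Proof. pose proof (zero_seq_nonneg k). pose proof (zero_seq_lt k). lra. Qed.

Lemma zero_seq_zero (k : nat) : J (z (S k)) = 0.
Proof. apply zero_seq_spec. Qed.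

Lemma zero_seq_between (k : nat) (x : R) : z k < x < z (S k) -> J x <> 0.
Proof. apply zero_seq_spec. Qed.

Lemma zero_seq_le (k m : nat) : (k <= m)%nat -> z k <= z m.
Proof. induction 1 as [|m _ IH]; [lra|]. pose proof (zero_seq_lt m). lra. Qed.

Lemma N_zero_seq_neq0 (k : nat) : N (z (S k)) <> 0.
Proof. apply (J_zero_N_neq0 nu J N HP); [apply zero_seq_pos|apply zero_seq_zero]. Qed.

Lemma ratio_lt_order (x : R) : 0 < x < z 1 -> N x / J x < nu.
Proof.
  intros Hx.
  assert (HJ : forall y, 0 < y < z 1 -> J y <> 0) by (intros y; apply (zero_seq_between 0)).
  apply Rlt_le_trans with (N (x / 2) / J (x / 2)).
  { apply (ratio_decr nu J N HP); try lra. intros y Hy. apply HJ. lra. }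
  destruct (recessive_at_0 nu J N HP) as [B [_ Hnear]].
  apply (filterlim_le (F := at_right 0) (fun _ => N (x / 2) / J (x / 2))
    (fun t => nu + t ^ 2) (N (x / 2) / J (x / 2)) nu).
  - assert (Hhalf : 0 < x / 2) by lra.
    refine (filter_imp _ _ _ (filter_and _ _ (at_right_between 0 (x / 2) Hhalf) Hnear)).
    intros t (Ht & [HJt _] & HNt). apply Rle_trans with (N t / J t).
    + left. apply (ratio_decr nu J N HP); try lra. intros y Hy. apply HJ. lra.
    + apply Rabs_le_between in HNt. apply Rmult_le_reg_r with (J t); [easy|].
      unfold Rdiv. rewrite Rmult_assoc, Rinv_l by lra. lra.
  - apply filterlim_const.
  - apply filterlim_at_right_continuous; [|simpl; ring].
    auto_continuous.
Qed.

Lemma is_level_zero_antitone (d1 d2 : R) (k : nat) (x1 x2 : R) :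
  is_level_zero J N d1 k x1 -> is_level_zero J N d2 k x2 -> x1 < x2 -> d2 < d1.
Proof.
  intros [Hx1 HN1] [Hx2 HN2] Hlt. pose proof (zero_seq_nonneg k).
  assert (Hratio : N x2 / J x2 < N x1 / J x1).
  { apply (ratio_decr nu J N HP); try lra. intros x Hx. apply (zero_seq_between k). lra. }
  rewrite HN1, HN2 in Hratio. unfold Rdiv in Hratio.
  rewrite !Rmult_assoc, !Rinv_r in Hratio by now apply (zero_seq_between k). lra.
Qed.

Lemma is_level_zero_unique (d : R) (k : nat) (x1 x2 : R) :
  is_level_zero J N d k x1 -> is_level_zero J N d k x2 -> x1 = x2.
Proof.
  intros Hx1 Hx2. destruct (Rtotal_order x1 x2) as [Hlt|[Heq|Hgt]]; [|easy|].
  - pose proof (is_level_zero_antitone _ _ _ _ _ Hx1 Hx2 Hlt). lra.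
  - pose proof (is_level_zero_antitone _ _ _ _ _ Hx2 Hx1 Hgt). lra.
Qed.

Lemma no_level_zero_in_first_gap (d x : R) : nu <= d -> ~ is_level_zero J N d 0 x.
Proof.
  intros Hd [Hx HN]. pose proof (ratio_lt_order x Hx) as Hratio.
  rewrite HN in Hratio. unfold Rdiv in Hratio.
  rewrite Rmult_assoc, Rinv_r in Hratio by now apply (zero_seq_between 0). lra.
Qed.

Lemma not_level_zero_at_zero_seq (d : R) (k : nat) : N (z (S k)) - d * J (z (S k)) <> 0.
Proof. rewrite zero_seq_zero, Rmult_0_r, Rminus_0_r. apply N_zero_seq_neq0. Qed.

Lemma level_zero_exists_first_gap (d : R) : d < nu -> exists x, is_level_zero J N d 0 x.
Proof.
  intros Hd. apply NNPP. intros Hnone.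
  destruct (recessive_at_0 nu J N HP) as [B [_ Hnear]].
  assert (Hsqr : at_right 0 (fun t => t ^ 2 < nu - d)).
  { apply filter_le_within. apply continuous_lt_locally; [|simpl; lra].
    auto_continuous. }
  destruct (filter_ex (F := at_right 0) _ (filter_and _ _
    (at_right_between 0 (z 1%nat) (zero_seq_pos 0)) (filter_and _ _ Hnear Hsqr)))
    as (t & Ht & [[HJt _] HNt] & Htd).
  apply Rabs_le_between in HNt.
  assert (Hpos : 0 < N t - d * J t) by nra.
  assert (Hincr : J t / (N t - d * J t) < J (z 1%nat) / (N (z 1%nat) - d * J (z 1%nat))).
  { apply (shifted_inv_ratio_incr nu J N HP); try lra. intros x Hx Hx0.
    destruct (Rle_lt_or_eq_dec x (z 1%nat) ltac:(lra)) as [Hlt| ->].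
    - apply Hnone. exists x. split; [simpl (z 0)|]; lra.
    - now apply (not_level_zero_at_zero_seq d 0). }
  rewrite (zero_seq_zero 0), Rdiv_0_l in Hincr.
  assert (0 < J t / (N t - d * J t)) by now apply Rdiv_lt_0_compat. lra.
Qed.

Lemma level_zero_exists_later_gap (d : R) (k : nat) :
  exists x, is_level_zero J N d (S k) x.
Proof.
  apply NNPP. intros Hnone.
  assert (Hincr : J (z (S k)) / (N (z (S k)) - d * J (z (S k))) <
    J (z (S (S k))) / (N (z (S (S k))) - d * J (z (S (S k))))).
  { apply (shifted_inv_ratio_incr nu J N HP); [apply zero_seq_pos|apply zero_seq_lt|].
    intros x Hx Hx0.
    destruct (Rle_lt_or_eq_dec _ x (proj1 Hx)) as [Hlt|<-];
      [|now apply (not_level_zero_at_zero_seq d k)].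
    destruct (Rle_lt_or_eq_dec x _ (proj2 Hx)) as [Hlt'| ->];
      [|now apply (not_level_zero_at_zero_seq d (S k))].
    apply Hnone. exists x. split; lra. }
  rewrite !zero_seq_zero, !Rdiv_0_l in Hincr. lra.
Qed.

Lemma level_zero_spec (d : R) (k : nat) : (1 <= k)%nat \/ d < nu ->
  is_level_zero J N d k (level_zero J N d k).
Proof.
  intros Hk. unfold level_zero. apply epsilon_spec. destruct k as [|k].
  - apply level_zero_exists_first_gap. destruct Hk; [lia|easy].
  - apply level_zero_exists_later_gap.
Qed.

Lemma zero_seq_gt_order (k : nat) : nu < z (S k).
Proof.
  destruct Hnu as [Hpos|Hzero]; [|rewrite <- Hzero; apply zero_seq_pos].
  destruct (level_zero_spec 0 0 (or_intror Hpos)) as [Hx HN]. rewrite Rmult_0_l in HN.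
  pose proof (zero_seq_le 1 (S k) ltac:(lia)).
  destruct (N_zero_spec nu J N HP (level_zero J N 0 0)); simpl in *; lra.
Qed.

Lemma extremum_spec (k : nat) : (1 <= k)%nat \/ 0 < nu ->
  z k < level_zero J N 0 k < z (S k) /\ N (level_zero J N 0 k) = 0 /\
  nu < level_zero J N 0 k.
Proof.
  intros Hk. destruct (level_zero_spec 0 k Hk) as [Hx HN]. rewrite Rmult_0_l in HN.
  pose proof (zero_seq_nonneg k).
  destruct (N_zero_spec nu J N HP (level_zero J N 0 k)); [lra|easy|]. easy.
Qed.

Lemma extremum_only_in_gap (k : nat) (x : R) :
  z k < x < z (S k) -> N x = 0 -> x = level_zero J N 0 k.
Proof.
  intros Hx HN. assert (Hlevel : is_level_zero J N 0 k x) by (split; [easy|lra]).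
  apply (is_level_zero_unique 0 k); [easy|].
  unfold level_zero. apply epsilon_spec. now exists x.
Qed.

Lemma extremum_spacing (k : nat) : (1 <= k)%nat \/ 0 < nu ->
  phase nu (level_zero J N 0 k) + PI <= phase nu (level_zero J N 0 (S k)).
Proof.
  intros Hk. destruct (extremum_spec k Hk) as (Hk1 & HNk & Hnuk).
  destruct (extremum_spec (S k)) as (HSk & HNSk & _); [left; lia|].
  apply (N_zero_spacing nu J N HP); try easy; try lra.
  intros x Hx HNx. destruct (Rtotal_order x (z (S k))) as [Hlt|[->|Hgt]].
  - pose proof (extremum_only_in_gap k x ltac:(lra) HNx). lra.
  - now apply (N_zero_seq_neq0 k).
  - pose proof (extremum_only_in_gap (S k) x ltac:(lra) HNx). lra.
Qed.

Lemma phase_first_extremum_ge : PI <= phase nu (level_zero J N 0 1).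
Proof.
  destruct (extremum_spec 1) as (Hx & HN & _); [left; lia|].
  destruct Hnu as [Hpos|Hzero].
  - pose proof (extremum_spacing 0 (or_intror Hpos)).
    destruct (extremum_spec 0) as (_ & _ & Hgt); [now right|].
    pose proof (phase_nonneg nu (level_zero J N 0 0) ltac:(lra)). lra.
  - pose proof (zero_seq_pos 0).
    assert (HP0 : recessive_solution 0 J N) by (rewrite Hzero; exact HP).
    rewrite <- Hzero. apply (N_first_zero_order_0 J N); try easy; try lra.
    intros x Hx0 HNx. destruct (Rtotal_order x (z 1%nat)) as [Hlt|[->|Hgt]].
    + apply (no_level_zero_in_first_gap 0 x); [lra|]. split; [simpl (z 0)|]; lra.
    + now apply (N_zero_seq_neq0 0).
    + pose proof (extremum_only_in_gap 1 x ltac:(lra) HNx). lra.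
Qed.

Lemma phase_extremum_ge (k : nat) : (1 <= k)%nat ->
  INR k * PI <= phase nu (level_zero J N 0 k).
Proof.
  induction 1 as [|k Hk IH].
  - rewrite INR_1, Rmult_1_l. exact phase_first_extremum_ge.
  - pose proof (extremum_spacing k (or_introl Hk)). rewrite S_INR. lra.
Qed.

Lemma phase_zero_seq_gt (k : nat) : INR k * PI < phase nu (z (S k)).
Proof.
  destruct k as [|k].
  - simpl INR. rewrite Rmult_0_l. apply phase_pos. pose proof (zero_seq_gt_order 0). lra.
  - apply Rle_lt_trans with (phase nu (level_zero J N 0 (S k))).
    + apply phase_extremum_ge. lia.
    + destruct (extremum_spec (S k)) as (Hx & _ & Hgt); [left; lia|].
      apply phase_incr; lra.
Qed.

Lemma phase_zero_seq_le (k : nat) : phase nu (z (S k)) <= (INR k + 1) * PI.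
Proof.
  induction k as [|k IH].
  - simpl INR. rewrite Rplus_0_l, Rmult_1_l, <- (Rplus_0_l PI).
    apply (phase_gap_le_PI nu J N Hnu HS nu); [lra|apply zero_seq_gt_order| |].
    + intros x Hx. apply (zero_seq_between 0). simpl (z 0). lra.
    + now apply filterlim_phase_turning_point.
  - pose proof (zero_seq_gt_order k) as Hgt.
    assert (phase nu (z (S (S k))) <= phase nu (z (S k)) + PI); [|rewrite S_INR; lra].
    apply (phase_gap_le_PI nu J N Hnu HS (z (S k))); [lra|apply zero_seq_lt| |].
    + intros x. apply zero_seq_between.
    + apply filterlim_phase_at_right. lra.
Qed.

Lemma zero_seq_ge (k : nat) : INR k * PI < z (S k).
Proof.
  pose proof (zero_seq_gt_order k). pose proof (phase_zero_seq_gt k).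
  pose proof (phase_le_freq nu (z (S k)) ltac:(lra)).
  pose proof (freq_le nu (z (S k)) ltac:(lra)). lra.
Qed.

Lemma zero_seq_unbounded (x : R) : exists k, x < z k.
Proof.
  pose proof PI_RGT_0. destruct (INR_unbounded (x / PI)) as [k Hk].
  exists (S k). apply Rlt_trans with (INR k * PI); [|apply zero_seq_ge].
  apply (Rmult_lt_compat_r PI) in Hk; [|easy].
  unfold Rdiv in Hk. rewrite Rmult_assoc, Rinv_l in Hk; lra.
Qed.

Lemma zero_seq_covers (x : R) : 0 < x -> J x <> 0 -> exists k, z k < x < z (S k).
Proof.
  intros Hx HJx. destruct (zero_seq_unbounded x) as [k Hk].
  induction k as [|k IH]; [simpl in Hk; lra|].
  destruct (Rtotal_order x (z k)) as [Hlt|[Heq|Hgt]]; [now apply IH| |now exists k].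
  destruct k as [|k]; [simpl in Heq; lra|]. exfalso. apply HJx. rewrite Heq.
  apply zero_seq_zero.
Qed.

End Zeros.

(** * The listing of the critical points *)

Lemma Derive_j (nu delta x : R) : -1 < nu -> 0 < x ->
  Derive (j nu delta) x =
  Rpower x (- delta) / x * (bessel_N nu x - delta * BesselJ nu x).
Proof.
  intros Hnu Hx. apply is_derive_unique.
  assert (HJ := is_derive_J nu _ _ (bessel_system_BesselJ nu Hnu) x Hx).
  assert (Hpow := is_derive_Rpower (- delta) x Hx).
  replace (Rpower x (- delta) / x * (bessel_N nu x - delta * BesselJ nu x)) with
    (plus (mult (- delta * Rpower x (- delta - 1)) (BesselJ nu x))
          (mult (Rpower x (- delta)) (bessel_N nu x / x))).
  - apply (is_derive_mult (fun x => Rpower x (- delta)) (BesselJ nu)); try easy.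
    intros; apply Rmult_comm.
  - unfold plus, mult; simpl.
    replace (Rpower x (- delta)) with (x * Rpower x (- delta - 1))
      by (rewrite <- Rpower_succ by easy; f_equal; ring).
    field. lra.
Qed.

Lemma Derive_j_eq0 (nu delta x : R) : -1 < nu -> 0 < x ->
  Derive (j nu delta) x = 0 <-> bessel_N nu x = delta * BesselJ nu x.
Proof.
  intros Hnu Hx. rewrite Derive_j by easy.
  assert (0 < Rpower x (- delta) / x) by (apply Rdiv_lt_0_compat; [apply Rpower_pos|easy]).
  split; intros Heq; [|rewrite Heq; ring].
  apply Rmult_integral in Heq. lra.
Qed.

Lemma lists_pos_zeros_le (f : R -> R) (k0 : nat) (a : nat -> R) (k m : nat) :
  lists_pos_zeros f k0 a -> (k0 <= k <= m)%nat -> a k <= a m.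
Proof.
  intros (_ & Hincr & _) [Hk Hm]. induction Hm as [|m Hm IH]; [lra|].
  specialize (Hincr m ltac:(lia)). lra.
Qed.

Lemma lists_pos_zeros_unique (f : R -> R) (k0 : nat) (a b : nat -> R) :
  lists_pos_zeros f k0 a -> lists_pos_zeros f k0 b ->
  forall k, (k0 <= k)%nat -> a k = b k.
Proof.
  intros Ha Hb k. induction k as [k IH] using lt_wf_ind. intros Hk.
  assert (Hle : forall c d, lists_pos_zeros f k0 c -> lists_pos_zeros f k0 d ->
    (forall m, (k0 <= m < k)%nat -> c m = d m) -> c k <= d k).
  { intros c d Hc Hd Hcd. destruct (proj1 Hd k Hk) as [Hpos Hzero].
    destruct (proj2 (proj2 Hc) _ Hpos Hzero) as [m [Hm Hcm]].
    destruct (Nat.lt_ge_cases m k) as [Hmk|Hkm].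
    - rewrite Hcd in Hcm by lia.
      pose proof (lists_pos_zeros_le f k0 d (S m) k Hd ltac:(lia)).
      pose proof (proj1 (proj2 Hd) m Hm). lra.
    - rewrite <- Hcm. apply (lists_pos_zeros_le f k0 c); [easy|lia]. }
  apply Rle_antisym; apply Hle; try easy; intros m Hm; [|symmetry]; apply IH; lia.
Qed.

(** Indexed by the gaps between the zeros of [J_nu], not as in the listing [a' nu delta]. *)
Definition critical_point (nu delta : R) : nat -> R :=
  level_zero (BesselJ nu) (bessel_N nu) delta.

Lemma critical_point_spec (nu delta : R) (k : nat) : 0 <= nu -> (1 <= k)%nat \/ delta < nu ->
  is_level_zero (BesselJ nu) (bessel_N nu) delta k (critical_point nu delta k).
Proof. intros Hnu Hk. now apply (level_zero_spec nu _ _ (recessive_BesselJ nu Hnu)). Qed.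

Section Listing.
Variables nu delta : R.
Hypothesis Hnu : 0 <= nu.

Let HP : recessive_solution nu (BesselJ nu) (bessel_N nu) := recessive_BesselJ nu Hnu.

Lemma critical_point_in_gap (x : R) : 0 < x -> Derive (j nu delta) x = 0 ->
  exists k, is_level_zero (BesselJ nu) (bessel_N nu) delta k x.
Proof.
  intros Hx Hzero. apply Derive_j_eq0 in Hzero; [|lra|easy].
  destruct (zero_seq_covers nu _ _ HP x Hx) as [k Hk].
  - intros HJ. apply (J_zero_N_neq0 nu _ _ HP x Hx HJ). rewrite Hzero, HJ. ring.
  - now exists k.
Qed.

(** The shift [s] is [1] when [delta = - nu < 0]: there the listing starts at index
    [1] although a zero precedes the first positive zero of [J]. *)
Lemma critical_points_listing (s k0 : nat) :
  (k0 = s /\ delta < nu) \/ (k0 = S s /\ nu <= delta) ->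
  lists_pos_zeros (Derive (j nu delta)) k0 (fun k => critical_point nu delta (k - s)).
Proof.
  intros Hk0.
  assert (Hspec : forall k, (k0 <= k)%nat ->
    is_level_zero (BesselJ nu) (bessel_N nu) delta (k - s) (critical_point nu delta (k - s))).
  { intros k Hk. apply critical_point_spec; [easy|].
    destruct Hk0 as [[-> Hlt]|[-> _]]; [now right|left; lia]. }
  assert (Hpos : forall k, (k0 <= k)%nat -> 0 < critical_point nu delta (k - s)).
  { intros k Hk. pose proof (zero_seq_nonneg nu _ _ HP (k - s)).
    destruct (Hspec k Hk) as [Hgap _]. lra. }
  split; [|split].
  - intros k Hk. split; [now apply Hpos|].
    apply Derive_j_eq0; [lra|now apply Hpos|now apply Hspec].
  - intros k Hk. destruct (Hspec k Hk) as [Hgap _].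
    destruct (Hspec (S k) ltac:(lia)) as [Hgap' _].
    replace (S k - s)%nat with (S (k - s)) in * by lia. lra.
  - intros x Hx Hzero. destruct (critical_point_in_gap x Hx Hzero) as [m Hm].
    assert (Hk : (k0 <= m + s)%nat).
    { destruct Hk0 as [[-> _]|[-> Hge]]; [lia|]. destruct m as [|m]; [|lia].
      exfalso. now apply (no_level_zero_in_first_gap nu _ _ HP delta x). }
    exists (m + s)%nat. split; [easy|].
    apply (is_level_zero_unique nu _ _ HP delta m); [|easy].
    specialize (Hspec (m + s)%nat Hk). now replace (m + s - s)%nat with m in * by lia.
Qed.

Lemma a'_eq_critical_point (s k : nat) :
  (first_index nu delta = s /\ delta < nu) \/
  (first_index nu delta = S s /\ nu <= delta) ->
  (first_index nu delta <= k)%nat -> a' nu delta k = critical_point nu delta (k - s).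
Proof.
  intros Hs Hk. pose proof (critical_points_listing s _ Hs) as Hlist.
  apply (lists_pos_zeros_unique (Derive (j nu delta)) (first_index nu delta)
    (a' nu delta) (fun k => critical_point nu delta (k - s))); [|easy|easy].
  unfold a'. apply epsilon_spec. eexists. exact Hlist.
Qed.

End Listing.

Lemma a'_generic (nu delta : R) (k : nat) : Rabs delta <= nu ->
  ~ (0 < nu /\ delta = - nu) -> (1 <= k)%nat ->
  a' nu delta k = critical_point nu delta k.
Proof.
  intros Hdelta Hgen Hk. pose proof (Rabs_pos delta). pose proof (Rle_abs delta).
  rewrite (a'_eq_critical_point nu delta ltac:(lra) 0); [now rewrite Nat.sub_0_r| |];
    unfold first_index; destruct (Rlt_dec (Rabs delta) nu) as [Hlt|Hge]; try lia.
  - left. split; [easy|lra].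
  - right. split; [easy|]. apply Rnot_lt_le. intros Hlt. apply Hgen.
    unfold Rabs in *. destruct (Rcase_abs delta); lra.
Qed.

Lemma a'_opposite_order (nu : R) (k : nat) : 0 < nu ->
  a' nu (- nu) (S k) = critical_point nu (- nu) k.
Proof.
  intros Hnu. assert (Hfirst : first_index nu (- nu) = 1%nat).
  { unfold first_index. rewrite Rabs_Ropp, Rabs_pos_eq by lra.
    destruct (Rlt_dec nu nu); [lra|easy]. }
  rewrite (a'_eq_critical_point nu (- nu) ltac:(lra) 1); rewrite ?Hfirst; try lia.
  - now replace (S k - 1)%nat with k by lia.
  - left. split; [easy|lra].
Qed.

(** * The first bound *)

Lemma a'_phase_ge (nu delta : R) (k : nat) :
  Rabs delta <= nu -> (1 <= k)%nat ->
  nu < a' nu delta (S k) /\ INR k * PI <= phase nu (a' nu delta (S k)).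
Proof.
  intros Hdelta Hk. pose proof (Rabs_pos delta).
  assert (HP := recessive_BesselJ nu ltac:(lra)).
  destruct (classic (0 < nu /\ delta = - nu)) as [[Hpos ->]|Hgen].
  - rewrite a'_opposite_order by easy.
    pose proof (phase_extremum_ge nu _ _ HP k Hk) as Hphase.
    pose proof (level_zero_spec nu _ _ HP 0 k (or_introl Hk)) as Hextr.
    pose proof (critical_point_spec nu (- nu) k ltac:(lra) (or_introl Hk)) as Hcrit.
    destruct (extremum_spec nu _ _ HP k (or_introl Hk)) as (_ & _ & Hgt).
    set (c := level_zero (BesselJ nu) (bessel_N nu) 0 k) in *.
    set (d := critical_point nu (- nu) k) in *.
    destruct (Rtotal_order c d) as [Hlt|[<-|Hlt]]; [|easy|].
    + split; [lra|]. pose proof (phase_incr nu c d ltac:(lra) Hlt). lra.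
    + pose proof (is_level_zero_antitone nu _ _ HP _ _ _ _ _ Hcrit Hextr Hlt). lra.
  - rewrite a'_generic by (easy || lia).
    destruct (critical_point_spec nu delta (S k)) as [Hgap _]; [lra|left; lia|].
    pose proof (zero_seq_gt_order nu _ _ HP k). pose proof (phase_zero_seq_gt nu _ _ HP k).
    set (d := critical_point nu delta (S k)) in *.
    split; [lra|].
    pose proof (phase_incr nu (zero_seq (BesselJ nu) (S k)) d ltac:(lra) ltac:(lra)). lra.
Qed.

Lemma sqrt_lt_of_phase_gt (nu x t : R) : 0 <= nu < x -> 0 <= t -> t < phase nu x ->
  sqrt (nu ^ 2 + t ^ 2) < x.
Proof.
  intros Hx Ht Hphase. pose proof (phase_le_freq nu x Hx).
  pose proof (freq_sqr nu x ltac:(lra)).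
  rewrite <- (sqrt_pow2 x) by lra. apply sqrt_lt_1_alt. split; nra.
Qed.

Lemma a'_lower_bound (nu delta : R) (k : nat) : Rabs delta <= nu -> (2 <= k)%nat ->
  sqrt (nu ^ 2 + PI ^ 2 * (INR k - 5 / 4) ^ 2) < a' nu delta k.
Proof.
  intros Hdelta Hk. pose proof (Rabs_pos delta). pose proof PI_RGT_0.
  destruct k as [|k]; [lia|]. assert (Hk1 : (1 <= k)%nat) by lia.
  destruct (a'_phase_ge nu delta k Hdelta Hk1) as [Hgt Hphase].
  apply le_INR in Hk1. simpl in Hk1.
  replace (PI ^ 2 * (INR (S k) - 5 / 4) ^ 2) with ((PI * (INR (S k) - 5 / 4)) ^ 2) by ring.
  rewrite S_INR. apply sqrt_lt_of_phase_gt; [lra| |]; nra.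
Qed.

(** * The Hankel integral *)

(** Modulus and argument of [(s * (1 + i s)) ^ (nu - 1/2) * exp (- i * hankel_shift nu)];
    the modulus is parametrized by the exponent [a = nu - 1/2]. *)
Definition hankel_modulus (a s : R) : R := Rpower s a * Rpower (1 + s ^ 2) (a / 2).
Definition hankel_shift (nu : R) : R := nu * PI / 2 + PI / 4.
Definition hankel_arg (nu s : R) : R := (nu - 1 / 2) * atan s - hankel_shift nu.

(** The real part of [(p - i q) * exp (i x - 2 x s)] times that complex power. *)
Definition hankel_kernel (nu : R) (p q : R -> R) (x s : R) : R :=
  exp (- (2 * x * s)) * hankel_modulus (nu - 1 / 2) s *
  (p s * cos (x + hankel_arg nu s) + q s * sin (x + hankel_arg nu s)).

Definition hankelK_kernel (nu : R) : R -> R -> R :=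
  hankel_kernel nu (fun _ => 1) (fun _ => 0).
Definition hankelK'_kernel (nu : R) : R -> R -> R :=
  hankel_kernel nu (fun s => - 2 * s) (fun _ => -1).
Definition hankelK''_kernel (nu : R) : R -> R -> R :=
  hankel_kernel nu (fun s => 4 * s ^ 2 - 1) (fun s => 4 * s).

Definition hankelK (nu lo hi x : R) : R := RInt (hankelK_kernel nu x) lo hi.
Definition hankelK' (nu lo hi x : R) : R := RInt (hankelK'_kernel nu x) lo hi.
Definition hankelK'' (nu lo hi x : R) : R := RInt (hankelK''_kernel nu x) lo hi.

Definition hankel_boundary (nu : R) : R -> R -> R :=
  hankel_kernel nu (fun s => - 2 * s ^ 2) (fun s => - 2 * s).

Lemma is_derive_hankel_modulus (a s : R) : 0 < s ->
  is_derive (hankel_modulus a) s (a * (/ s + s / (1 + s ^ 2)) * hankel_modulus a s).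
Proof.
  intros Hs. unfold hankel_modulus, Rpower. pose proof (one_plus_sqr_pos s). auto_derive.
  - simpl in *. repeat split; lra.
  - change (s * (s * 1)) with (s ^ 2). field. lra.
Qed.

Lemma is_derive_hankel_arg (nu s : R) :
  is_derive (hankel_arg nu) s ((nu - 1 / 2) / (1 + s ^ 2)).
Proof.
  assert (Hatan := is_derive_atan s). pose proof (one_plus_sqr_pos s).
  unfold hankel_arg. auto_derive; [easy|]. unfold Rsqr. simpl in *. field. lra.
Qed.

Lemma continuous_hankel_kernel_2d (nu : R) (p q : R -> R) (x s : R) :
  0 < s -> continuous p s -> continuous q s ->
  continuous (fun u : R * R => hankel_kernel nu p q (fst u) (snd u)) (x, s).
Proof.
  intros Hs Hp Hq.
  assert (Hfst : continuous (fun u : R * R => fst u) (x, s)) by apply continuous_fst.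
  assert (Hsnd : continuous (fun u : R * R => snd u) (x, s)) by apply continuous_snd.
  assert (Hcomp : forall f : R -> R, continuous f s ->
    continuous (fun u : R * R => f (snd u)) (x, s))
    by (intros f Hf; now apply (continuous_comp snd f)).
  assert (Harg : continuous (fun u : R * R => fst u + hankel_arg nu (snd u)) (x, s)).
  { apply (continuous_plus (fun u : R * R => fst u)); [easy|]. apply Hcomp.
    eapply is_derive_continuous, is_derive_hankel_arg. }
  unfold hankel_kernel. apply (continuous_mult (fun u : R * R =>
    exp (- (2 * fst u * snd u)) * hankel_modulus (nu - 1 / 2) (snd u))).
  - apply (continuous_mult (fun u : R * R => exp (- (2 * fst u * snd u)))).
    + apply (continuous_comp (fun u : R * R => - (2 * fst u * snd u)) exp);
        [|apply continuous_exp].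
      apply (continuous_opp (fun u : R * R => 2 * fst u * snd u)).
      apply (continuous_mult (fun u : R * R => 2 * fst u)); [|easy].
      now apply (continuous_scal_r 2 (fun u : R * R => fst u)).
    + apply Hcomp. eapply is_derive_continuous. now apply is_derive_hankel_modulus.
  - apply (continuous_plus (fun u : R * R => p (snd u) * cos (fst u + hankel_arg nu (snd u)))).
    + apply (continuous_mult (fun u : R * R => p (snd u))); [now apply Hcomp|].
      apply (continuous_comp (fun u : R * R => fst u + hankel_arg nu (snd u)) cos); [easy|].
      apply continuous_cos.
    + apply (continuous_mult (fun u : R * R => q (snd u))); [now apply Hcomp|].
      apply (continuous_comp (fun u : R * R => fst u + hankel_arg nu (snd u)) sin); [easy|].
      apply continuous_sin.
Qed.

Lemma continuous_hankel_kernel (nu : R) (p q : R -> R) (x s : R) :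
  0 < s -> continuous p s -> continuous q s -> continuous (hankel_kernel nu p q x) s.
Proof.
  intros Hs Hp Hq. apply (continuous_comp_2 (fun _ => x) (fun s => s) (hankel_kernel nu p q)).
  - apply continuous_const.
  - apply continuous_id.
  - now apply continuous_hankel_kernel_2d.
Qed.

Lemma continuous_hankelK_kernel (nu x s : R) : 0 < s ->
  continuous (hankelK_kernel nu x) s.
Proof. intros Hs. apply continuous_hankel_kernel; [easy|auto_continuous ..]. Qed.

Lemma continuous_hankelK'_kernel (nu x s : R) : 0 < s ->
  continuous (hankelK'_kernel nu x) s.
Proof. intros Hs. apply continuous_hankel_kernel; [easy|auto_continuous ..]. Qed.

Lemma continuous_hankelK''_kernel (nu x s : R) : 0 < s ->
  continuous (hankelK''_kernel nu x) s.
Proof. intros Hs. apply continuous_hankel_kernel; [easy|auto_continuous ..]. Qed.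

Lemma is_derive_hankel_kernel (nu : R) (p q p' q' : R -> R) (x s : R) :
  p' s = q s - 2 * s * p s -> q' s = - p s - 2 * s * q s ->
  is_derive (fun x => hankel_kernel nu p q x s) x (hankel_kernel nu p' q' x s).
Proof.
  intros Hp' Hq'. unfold hankel_kernel. rewrite Hp', Hq'. auto_derive; [easy|]. ring.
Qed.

Lemma is_derive_RInt_hankel_kernel (nu : R) (p q p' q' : R -> R) (lo hi x : R) :
  0 < lo -> lo <= hi ->
  (forall s, continuous p s) -> (forall s, continuous q s) ->
  (forall s, continuous p' s) -> (forall s, continuous q' s) ->
  (forall s, p' s = q s - 2 * s * p s) -> (forall s, q' s = - p s - 2 * s * q s) ->
  is_derive (fun x => RInt (hankel_kernel nu p q x) lo hi) x
    (RInt (hankel_kernel nu p' q' x) lo hi).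
Proof.
  intros Hlo Hhi Hp Hq Hcp' Hcq' Hp' Hq'.
  assert (HD : forall y s, Derive (fun y => hankel_kernel nu p q y s) y =
    hankel_kernel nu p' q' y s)
    by (intros y s; now apply is_derive_unique, is_derive_hankel_kernel).
  rewrite (RInt_ext (hankel_kernel nu p' q' x)
    (fun s => Derive (fun y => hankel_kernel nu p q y s) x)) by (intros; now rewrite HD).
  apply (is_derive_RInt_param (hankel_kernel nu p q) lo hi x).
  - apply filter_forall. intros y s _. eexists. now apply is_derive_hankel_kernel.
  - intros s Hs. rewrite Rmin_left in Hs by lra.
    apply (continuity_2d_pt_ext (hankel_kernel nu p' q')); [intros y t; now rewrite HD|].
    apply continuity_2d_pt_filterlim. apply continuous_hankel_kernel_2d; auto; lra.
  - apply filter_forall. intros y. apply ex_RInt_pos_halfline; try lra.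
    intros s Hs. now apply continuous_hankel_kernel.
Qed.

Lemma is_derive_hankelK (nu lo hi x : R) : 0 < lo -> lo <= hi ->
  is_derive (hankelK nu lo hi) x (hankelK' nu lo hi x).
Proof.
  intros Hlo Hhi.
  apply (is_derive_RInt_hankel_kernel nu (fun _ => 1) (fun _ => 0)
    (fun s => - 2 * s) (fun _ => -1));
    [easy|easy|intros; auto_continuous ..|intros; ring|intros; ring].
Qed.

Lemma is_derive_hankelK' (nu lo hi x : R) : 0 < lo -> lo <= hi ->
  is_derive (hankelK' nu lo hi) x (hankelK'' nu lo hi x).
Proof.
  intros Hlo Hhi.
  apply (is_derive_RInt_hankel_kernel nu (fun s => - 2 * s) (fun _ => -1)
    (fun s => 4 * s ^ 2 - 1) (fun s => 4 * s));
    [easy|easy|intros; auto_continuous ..|intros; ring|intros; ring].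
Qed.

(** The operator of Bessel's equation for [x ^ (- nu) * J_nu] turns the integrand into an
    exact derivative in [s]. *)
Lemma is_derive_hankel_boundary (nu x s : R) : 0 < s ->
  is_derive (hankel_boundary nu x) s
    (x * hankelK''_kernel nu x s + (2 * nu + 1) * hankelK'_kernel nu x s +
     x * hankelK_kernel nu x s).
Proof.
  intros Hs. assert (Hmod := is_derive_hankel_modulus (nu - 1 / 2) s Hs).
  assert (Harg := is_derive_hankel_arg nu s). pose proof (one_plus_sqr_pos s).
  unfold hankel_boundary, hankelK''_kernel, hankelK'_kernel, hankelK_kernel, hankel_kernel.
  set (m := hankel_modulus (nu - 1 / 2)) in *. set (t := hankel_arg nu) in *.
  auto_derive.
  - repeat split; eexists; eassumption.
  - rewrite_known_Derive. field. simpl in *. lra.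
Qed.

Lemma hankelK_ode (nu lo hi x : R) : 0 < lo -> lo <= hi ->
  x * hankelK'' nu lo hi x + (2 * nu + 1) * hankelK' nu lo hi x + x * hankelK nu lo hi x =
  hankel_boundary nu x hi - hankel_boundary nu x lo.
Proof.
  intros Hlo Hhi.
  pose proof (continuous_hankelK''_kernel nu x) as Hk2.
  pose proof (continuous_hankelK'_kernel nu x) as Hk1.
  pose proof (continuous_hankelK_kernel nu x) as Hk0.
  set (k2 := hankelK''_kernel nu x) in *. set (k1 := hankelK'_kernel nu x) in *.
  set (k0 := hankelK_kernel nu x) in *.
  assert (Hint : forall k : R -> R, (forall s, 0 < s -> continuous k s) ->
    is_RInt k lo hi (RInt k lo hi)).
  { intros k Hk. apply (RInt_correct (V := R_CompleteNormedModule)).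
    apply ex_RInt_pos_halfline; try easy; lra. }
  assert (Hsum : is_RInt (fun s => x * k2 s + (2 * nu + 1) * k1 s + x * k0 s) lo hi
    (x * hankelK'' nu lo hi x + (2 * nu + 1) * hankelK' nu lo hi x + x * hankelK nu lo hi x)).
  { apply (is_RInt_plus (V := R_NormedModule)); [apply (is_RInt_plus (V := R_NormedModule))|];
      now apply (is_RInt_scal (V := R_NormedModule)), Hint. }
  assert (Hexact : is_RInt (fun s => x * k2 s + (2 * nu + 1) * k1 s + x * k0 s) lo hi
    (hankel_boundary nu x hi - hankel_boundary nu x lo)).
  { apply (is_RInt_derive (V := R_CompleteNormedModule) (hankel_boundary nu x));
      intros s Hs; rewrite Rmin_left in Hs by lra; assert (Hs0 : 0 < s) by lra.
    - now apply is_derive_hankel_boundary.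
    - apply (continuous_plus (fun s => x * k2 s + (2 * nu + 1) * k1 s));
        [apply (continuous_plus (fun s => x * k2 s))|].
      + apply (continuous_scal_r x k2). auto.
      + apply (continuous_scal_r (2 * nu + 1) k1). auto.
      + apply (continuous_scal_r x k0). auto. }
  rewrite <- (is_RInt_unique _ _ _ _ Hsum). now apply is_RInt_unique.
Qed.

(** Vanishes identically in the limit [lo -> 0], [hi -> +oo], where both factors solve the
    same equation. *)
Definition hankel_wronskian (nu lo hi x : R) : R :=
  Rpower x (2 * nu + 1) *
  (hankelK nu lo hi x * bessel_entire' nu x - hankelK' nu lo hi x * bessel_entire nu x).

Lemma is_derive_hankel_wronskian (nu lo hi x : R) :
  -1 < nu -> 0 < x -> 0 < lo -> lo <= hi ->
  is_derive (hankel_wronskian nu lo hi) x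
    (- (Rpower x (2 * nu) * bessel_entire nu x *
        (hankel_boundary nu x hi - hankel_boundary nu x lo))).
Proof.
  intros Hnu Hx Hlo Hhi. rewrite <- hankelK_ode by easy.
  set (p := fun x => Rpower x (2 * nu + 1)).
  assert (Hp : is_derive p x ((2 * nu + 1) * Rpower x (2 * nu))).
  { replace (Rpower x (2 * nu)) with (Rpower x (2 * nu + 1 - 1)) by (f_equal; ring).
    now apply is_derive_Rpower. }
  assert (HK := is_derive_hankelK nu lo hi x Hlo Hhi).
  assert (HK' := is_derive_hankelK' nu lo hi x Hlo Hhi).
  assert (HL := is_derive_bessel_entire nu Hnu x).
  assert (HL' := is_derive_bessel_entire' nu Hnu x Hx).
  apply (is_derive_ext (fun x => p x * (hankelK nu lo hi x * bessel_entire' nu x -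
    hankelK' nu lo hi x * bessel_entire nu x))); [easy|].
  auto_derive.
  - repeat split; eexists; eassumption.
  - rewrite_known_Derive. unfold p. rewrite Rpower_succ by easy. field. lra.
Qed.

(** * Laplace integrals *)

Definition laplace_kernel (b x s : R) : R := Rpower s b * exp (- (x * s)).

Lemma continuous_laplace_kernel (b x s : R) : 0 < s -> continuous (laplace_kernel b x) s.
Proof.
  intros Hs. apply (continuous_mult (fun s => Rpower s b) (fun s => exp (- (x * s)))).
  - now apply continuous_Rpower.
  - auto_continuous.
Qed.

Lemma laplace_kernel_pos (b x s : R) : 0 < laplace_kernel b x s.
Proof. apply Rmult_lt_0_compat; apply exp_pos. Qed.

Lemma ex_RInt_laplace_kernel (b x lo hi : R) :
  0 < lo -> 0 < hi -> ex_RInt (laplace_kernel b x) lo hi.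
Proof.
  intros Hlo Hhi. apply ex_RInt_pos_halfline; try easy.
  intros s Hs. now apply continuous_laplace_kernel.
Qed.

Lemma RInt_laplace_kernel_scaling (b x lo hi : R) : 0 < x -> 0 < lo -> lo <= hi ->
  RInt (laplace_kernel b x) lo hi =
  Rpower x (- (b + 1)) * RInt (Gamma_integrand (b + 1)) (x * lo) (x * hi).
Proof.
  intros Hx Hlo Hhi.
  assert (Hex : ex_RInt (Gamma_integrand (b + 1)) (x * lo + 0) (x * hi + 0))
    by (apply ex_RInt_Gamma_integrand; nra).
  assert (Hscale : RInt (Gamma_integrand (b + 1)) (x * lo) (x * hi) =
    Rpower x (b + 1) * RInt (laplace_kernel b x) lo hi).
  { rewrite <- (Rplus_0_r (x * lo)), <- (Rplus_0_r (x * hi)).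
    rewrite <- (RInt_comp_lin _ x 0 lo hi Hex).
    rewrite <- (RInt_scal (V := R_CompleteNormedModule) (laplace_kernel b x))
      by (apply ex_RInt_laplace_kernel; lra).
    apply RInt_ext. intros s Hs. rewrite Rmin_left in Hs by lra.
    unfold Gamma_integrand, laplace_kernel, scal; simpl; unfold mult; simpl.
    replace (b + 1 - 1) with b by ring.
    rewrite Rplus_0_r, Rpower_succ, <- Rpower_mult_distr by lra. ring. }
  rewrite Hscale, <- Rmult_assoc, <- Rpower_plus, Rplus_opp_l, Rpower_O by easy.
  symmetry. apply Rmult_1_l.
Qed.

Lemma RInt_laplace_kernel_le (b x lo hi : R) : -1 < b -> 0 < x -> 0 < lo -> lo <= hi ->
  RInt (laplace_kernel b x) lo hi <= Gamma (b + 1) * Rpower x (- (b + 1)).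
Proof.
  intros Hb Hx Hlo Hhi. rewrite RInt_laplace_kernel_scaling, Rmult_comm by easy.
  apply Rmult_le_compat_r; [left; apply Rpower_pos|]. apply Gamma_integral; nra.
Qed.

Lemma RInt_laplace_kernel_ge (b : R) : exists c, 0 < c /\
  forall x lo hi, 0 < x -> 0 < lo -> x * lo <= 1 -> 2 <= x * hi ->
  c * Rpower x (- (b + 1)) <= RInt (laplace_kernel b x) lo hi.
Proof.
  exists (RInt (Gamma_integrand (b + 1)) 1 2). split.
  - apply RInt_gt_0; [lra| |].
    + intros. apply Gamma_integrand_pos.
    + intros. apply continuous_Gamma_integrand. lra.
  - intros x lo hi Hx Hlo Hxlo Hxhi.
    rewrite RInt_laplace_kernel_scaling, Rmult_comm by nra.
    apply Rmult_le_compat_l; [left; apply Rpower_pos|].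
    apply RInt_widen_le; try lra; [| |nra].
    + intros. now apply continuous_Gamma_integrand.
    + intros. left. apply Gamma_integrand_pos.
Qed.

Lemma Rpower_one_plus_exp_le (p : R) : 0 <= p -> exists C, 0 < C /\
  forall x y s, 0 < y <= 1 -> y <= x -> 0 < s ->
  Rpower (1 + s) p * exp (- (x * s / 2)) <= C * Rpower y (- p).
Proof.
  intros Hp. destruct (Rpower_le_exp p (1 / 2)) as [C [HC Hexp]]; [easy|lra|].
  exists (C * exp (1 / 2)). split; [apply Rmult_lt_0_compat; [easy|apply exp_pos]|].
  intros x y s Hy Hyx Hs.
  assert (Hpow : Rpower (y * (1 + s)) p <= C * exp (1 / 2 * (1 + x * s))).
  { apply Rle_trans with (Rpower (1 + x * s) p); [|apply Hexp; nra].
    apply Rle_Rpower_l; [easy|]. split; nra. }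
  rewrite <- Rpower_mult_distr in Hpow by lra.
  rewrite Rpower_Ropp. pose proof (Rpower_pos y p) as Hyp.
  apply Rmult_le_reg_l with (Rpower y p); [easy|].
  replace (Rpower y p * (C * exp (1 / 2) * / Rpower y p)) with (C * exp (1 / 2))
    by (field; lra).
  replace (C * exp (1 / 2)) with (C * exp (1 / 2 * (1 + x * s)) * exp (- (x * s / 2))).
  - rewrite <- Rmult_assoc. apply Rmult_le_compat_r; [left; apply exp_pos|easy].
  - rewrite Rmult_assoc, <- exp_plus. do 2 f_equal. field.
Qed.

(* The scale [y] only absorbs the growth of [(1 + s) ^ p]; it is [x] for small [x] and [1]
   for large [x]. *)
Lemma RInt_laplace_dominated (b p : R) : -1 < b -> 0 <= p -> exists C, 0 < C /\
  forall (f : R -> R) (M x y lo hi : R),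
  0 < y <= 1 -> y <= x -> 0 < lo -> lo <= hi -> 0 <= M ->
  (forall s, 0 < s -> continuous f s) ->
  (forall s, 0 < s -> Rabs (f s) <= M * (Rpower s b * Rpower (1 + s) p * exp (- (x * s)))) ->
  Rabs (RInt f lo hi) <= M * C * (Rpower y (- p) * Rpower x (- (b + 1))).
Proof.
  intros Hb Hp. destruct (Rpower_one_plus_exp_le p Hp) as [C [HC Hexp]].
  pose proof (Gamma_pos (b + 1) ltac:(lra)) as HG.
  pose proof (Rpower_pos 2 (b + 1)) as Htwo.
  exists (C * (Gamma (b + 1) * Rpower 2 (b + 1))).
  split; [now repeat apply Rmult_lt_0_compat|].
  intros f M x y lo hi Hy Hyx Hlo Hhi HM Hf Hfle.
  pose proof (Rpower_pos y (- p)) as Hyp.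
  assert (Hk : is_RInt (fun s => M * (C * Rpower y (- p)) * laplace_kernel b (x / 2) s) lo hi
    (M * (C * Rpower y (- p)) * RInt (laplace_kernel b (x / 2)) lo hi)).
  { apply (is_RInt_scal (V := R_NormedModule)), (RInt_correct (V := R_CompleteNormedModule)).
    apply ex_RInt_laplace_kernel; lra. }
  assert (Hfint : is_RInt f lo hi (RInt f lo hi)).
  { apply (RInt_correct (V := R_CompleteNormedModule)), ex_RInt_pos_halfline; try easy; lra. }
  eapply Rle_trans.
  - eapply (norm_RInt_le (V := R_NormedModule) f); [exact Hhi| |exact Hfint|exact Hk].
    intros s Hs. assert (Hs0 : 0 < s) by lra. eapply Rle_trans; [now apply Hfle|].
    rewrite (Rmult_assoc M). apply Rmult_le_compat_l; [easy|].
    unfold laplace_kernel.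
    replace (exp (- (x * s))) with (exp (- (x * s / 2)) * exp (- (x / 2 * s)))
      by (rewrite <- exp_plus; f_equal; field).
    replace (Rpower s b * Rpower (1 + s) p * (exp (- (x * s / 2)) * exp (- (x / 2 * s))))
      with (Rpower (1 + s) p * exp (- (x * s / 2)) * (Rpower s b * exp (- (x / 2 * s)))) by ring.
    apply Rmult_le_compat_r; [left; apply laplace_kernel_pos|]. now apply Hexp.
  - replace (M * (C * (Gamma (b + 1) * Rpower 2 (b + 1))) *
      (Rpower y (- p) * Rpower x (- (b + 1)))) with (M * (C * Rpower y (- p)) *
      (Gamma (b + 1) * (Rpower 2 (b + 1) * Rpower x (- (b + 1))))) by ring.
    apply Rmult_le_compat_l; [repeat apply Rmult_le_pos; lra|].
    replace (Rpower 2 (b + 1) * Rpower x (- (b + 1))) with (Rpower (x / 2) (- (b + 1))).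
    + apply RInt_laplace_kernel_le; lra.
    + unfold Rdiv. rewrite <- Rpower_mult_distr, Rpower_base_inv, Ropp_involutive by lra. ring.
Qed.

(** * Bounds for the Hankel integral *)

(* The phase is chosen so that the real part vanishes as [s] tends to infinity; this is
   what makes the integral the solution that is recessive at [x = 0]. *)
Lemma mul_cos_hankel_arg_le (nu x s : R) : 0 < x -> 0 < s ->
  s * Rabs (cos (x + hankel_arg nu s)) <= x * s + Rabs (nu - 1 / 2).
Proof.
  intros Hx Hs. pose proof (mul_acot_bounds s Hs) as Hacot.
  replace (x + hankel_arg nu s) with (- (PI / 2 - (x - (nu - 1 / 2) * (PI / 2 - atan s))))
    by (unfold hankel_arg, hankel_shift; field).
  rewrite cos_neg, cos_shift, <- (Rabs_pos_eq s), <- Rabs_mult at 1 by lra.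
  rewrite Rabs_mult. eapply Rle_trans.
  - apply Rmult_le_compat_l; [apply Rabs_pos|]. apply Rabs_sin_le.
  - rewrite <- Rabs_mult.
    replace (s * (x - (nu - 1 / 2) * (PI / 2 - atan s)))
      with (x * s + - ((nu - 1 / 2) * (s * (PI / 2 - atan s)))) by ring.
    eapply Rle_trans; [apply Rabs_triang|].
    rewrite Rabs_Ropp, !Rabs_mult, (Rabs_pos_eq x), (Rabs_pos_eq s) by lra.
    rewrite (Rabs_pos_eq (PI / 2 - atan s)) by nra.
    pose proof (Rabs_pos (nu - 1 / 2)). nra.
Qed.

Lemma hankel_modulus_pos (a s : R) : 0 < hankel_modulus a s.
Proof. apply Rmult_lt_0_compat; apply Rpower_pos. Qed.

Lemma Rpower_one_plus_sqr_le (a y s : R) : 0 <= y <= s ->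
  Rpower (1 + y ^ 2) (a / 2) <= Rpower (1 + s) (Rmax a 0).
Proof.
  intros Hy. pose proof (Rmax_l a 0). pose proof (Rmax_r a 0).
  apply Rle_trans with (Rpower (1 + y ^ 2) (Rmax a 0 / 2)).
  - apply Rle_Rpower; [pose proof (pow2_ge_0 y)|]; lra.
  - replace (Rpower (1 + s) (Rmax a 0)) with (Rpower ((1 + s) ^ 2) (Rmax a 0 / 2)).
    + apply Rle_Rpower_l; [lra|]. split; nra.
    + rewrite <- Rpower_pow, Rpower_mult by lra. f_equal. simpl. field.
Qed.

Lemma hankel_modulus_le (a s : R) : 0 < s ->
  hankel_modulus a s <= Rpower s a * Rpower (1 + s) (Rmax a 0).
Proof.
  intros Hs. apply Rmult_le_compat_l; [left; apply Rpower_pos|].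
  apply Rpower_one_plus_sqr_le. lra.
Qed.

Lemma hankel_modulus_sub_le (a s : R) : 0 < s ->
  Rabs (hankel_modulus a s - Rpower s a) <=
  Rabs a * (s * (Rpower s a * Rpower (1 + s) (Rmax a 0))).
Proof.
  intros Hs. pose proof (Rpower_pos s a) as Hpow.
  assert (Hvar : Rabs (Rpower (1 + s ^ 2) (a / 2) - Rpower (1 + 0 ^ 2) (a / 2)) <=
    Rabs a * Rpower (1 + s) (Rmax a 0) * (s - 0)).
  { apply (is_derive_Rabs_sub_le (fun y => Rpower (1 + y ^ 2) (a / 2))
      (fun y => a * (y / (1 + y ^ 2)) * Rpower (1 + y ^ 2) (a / 2))); [lra| |];
      intros y Hy; pose proof (one_plus_sqr_pos y) as Hden.
    - unfold Rpower. auto_derive; [simpl in *; lra|].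
      change (y * (y * 1)) with (y ^ 2). field. lra.
    - assert (Hfrac : 0 <= y / (1 + y ^ 2) <= 1).
      { split; [apply Rdiv_le_0_compat; lra|].
        apply Rmult_le_reg_r with (1 + y ^ 2); [easy|].
        unfold Rdiv. rewrite Rmult_assoc, Rinv_l by lra. nra. }
      pose proof (Rpower_one_plus_sqr_le a y s ltac:(lra)).
      pose proof (Rpower_pos (1 + y ^ 2) (a / 2)).
      rewrite !Rabs_mult, (Rabs_pos_eq (y / _)), (Rabs_pos_eq (Rpower _ _)), Rmult_assoc by lra.
      apply Rmult_le_compat_l; [apply Rabs_pos|]. nra. }
  replace (1 + 0 ^ 2) with 1 in Hvar by ring.
  rewrite Rpower_base_1, Rminus_0_r in Hvar. unfold hankel_modulus.
  replace (Rpower s a * Rpower (1 + s ^ 2) (a / 2) - Rpower s a)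
    with (Rpower s a * (Rpower (1 + s ^ 2) (a / 2) - 1)) by ring.
  rewrite Rabs_mult, (Rabs_pos_eq (Rpower s a)) by lra.
  apply Rle_trans with (Rpower s a * (Rabs a * Rpower (1 + s) (Rmax a 0) * s)); [|right; ring].
  apply Rmult_le_compat_l; lra.
Qed.

Lemma hankel_oscillation_error (nu x s : R) (F : R -> R) : 0 < s ->
  (forall u v, Rabs (F u - F v) <= Rabs (u - v)) -> (forall u, Rabs (F u) <= 1) ->
  Rabs (hankel_modulus (nu - 1 / 2) s * F (x + hankel_arg nu s)
        - Rpower s (nu - 1 / 2) * F (x - hankel_shift nu)) <=
  2 * Rabs (nu - 1 / 2) *
  (s * (Rpower s (nu - 1 / 2) * Rpower (1 + s) (Rmax (nu - 1 / 2) 0))).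
Proof.
  intros Hs Hlip Hbound. set (a := nu - 1 / 2).
  pose proof (hankel_modulus_sub_le a s Hs) as Hmod.
  pose proof (Rpower_pos s a) as Hpow. pose proof (Rabs_pos a) as Ha.
  assert (Hone : 1 <= Rpower (1 + s) (Rmax a 0)) by (apply Rpower_ge_1; [lra|apply Rmax_r]).
  set (q := Rpower (1 + s) (Rmax a 0)) in *.
  replace (hankel_modulus a s * F (x + hankel_arg nu s) - Rpower s a * F (x - hankel_shift nu))
    with ((hankel_modulus a s - Rpower s a) * F (x + hankel_arg nu s) +
      Rpower s a * (F (x + hankel_arg nu s) - F (x - hankel_shift nu))) by ring.
  eapply Rle_trans; [apply Rabs_triang|].
  rewrite !Rabs_mult, (Rabs_pos_eq (Rpower s a)) by lra.
  assert (Hdiff : Rabs (F (x + hankel_arg nu s) - F (x - hankel_shift nu)) <= Rabs a * s).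
  { eapply Rle_trans; [apply Hlip|].
    replace (x + hankel_arg nu s - (x - hankel_shift nu)) with (a * atan s)
      by (unfold hankel_arg, a; ring).
    pose proof (atan_bounds_nonneg s ltac:(lra)).
    rewrite Rabs_mult, (Rabs_pos_eq (atan s)) by lra. apply Rmult_le_compat_l; lra. }
  assert (Rabs (hankel_modulus a s - Rpower s a) * Rabs (F (x + hankel_arg nu s)) <=
    Rabs a * (s * (Rpower s a * q)) * 1)
    by (apply Rmult_le_compat; try apply Rabs_pos; [easy|apply Hbound]).
  assert (Rpower s a * Rabs (F (x + hankel_arg nu s) - F (x - hankel_shift nu)) <=
    Rpower s a * q * (Rabs a * s)).
  { apply Rmult_le_compat; [lra|apply Rabs_pos|nra|easy]. }
  lra.
Qed.

Lemma Rabs_hankelK_kernel_le (nu x s : R) : 0 < x -> 0 < s ->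
  Rabs (hankelK_kernel nu x s) <=
  hankel_modulus (nu - 1 / 2) s * exp (- (x * s)).
Proof.
  intros Hx Hs. unfold hankelK_kernel, hankel_kernel. rewrite Rmult_0_l, Rplus_0_r, Rmult_1_l.
  pose proof (hankel_modulus_pos (nu - 1 / 2) s) as Hmod.
  pose proof (exp_pos (- (2 * x * s))).
  assert (exp (- (2 * x * s)) <= exp (- (x * s))) by (apply exp_le_compat; nra).
  pose proof (Rabs_cos_le_1 (x + hankel_arg nu s)).
  rewrite !Rabs_mult, (Rabs_pos_eq (exp _)), (Rabs_pos_eq (hankel_modulus _ _)) by lra.
  rewrite <- (Rmult_1_r (hankel_modulus _ _ * exp _)).
  apply Rmult_le_compat; [nra|apply Rabs_pos|nra|easy].
Qed.

Lemma Rabs_hankelK'_kernel_le (nu x s : R) : 0 < x -> 0 < s ->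
  Rabs (hankelK'_kernel nu x s) <=
  (3 + 2 * Rabs (nu - 1 / 2)) * (hankel_modulus (nu - 1 / 2) s * exp (- (x * s))).
Proof.
  intros Hx Hs. unfold hankelK'_kernel, hankel_kernel.
  pose proof (hankel_modulus_pos (nu - 1 / 2) s) as Hmod.
  pose proof (Rabs_pos (nu - 1 / 2)) as Ha. pose proof (exp_pos (- (x * s))) as Hexp.
  pose proof (mul_cos_hankel_arg_le nu x s Hx Hs) as Hcos.
  pose proof (Rabs_sin_le_1 (x + hankel_arg nu s)) as Hsin.
  set (c := cos (x + hankel_arg nu s)) in *. set (d := sin (x + hankel_arg nu s)) in *.
  assert (Hosc : Rabs (- 2 * s * c + -1 * d) <= 2 * (x * s) + 2 * Rabs (nu - 1 / 2) + 1).
  { eapply Rle_trans; [apply Rabs_triang|].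
    replace (- 2 * s * c) with (- (2 * (s * c))) by ring.
    replace (-1 * d) with (- d) by ring.
    rewrite !Rabs_Ropp, !Rabs_mult, (Rabs_pos_eq 2), (Rabs_pos_eq s) by lra. lra. }
  assert (Habsorb : exp (- (x * s)) * Rabs (- 2 * s * c + -1 * d) <=
    3 + 2 * Rabs (nu - 1 / 2)).
  { eapply Rle_trans; [apply Rmult_le_compat_l; [lra|exact Hosc]|].
    pose proof (mul_exp_neg_le (x * s)).
    assert (exp (- (x * s)) <= 1) by (apply exp_neg_le_1, Rmult_le_pos; lra).
    assert (exp (- (x * s)) * Rabs (nu - 1 / 2) <= 1 * Rabs (nu - 1 / 2))
      by now apply Rmult_le_compat_r.
    lra. }
  rewrite !Rabs_mult, (Rabs_pos_eq (exp _)), (Rabs_pos_eq (hankel_modulus _ _))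
    by (lra || (left; apply exp_pos)).
  replace (- (2 * x * s)) with (- (x * s) + - (x * s)) by ring. rewrite exp_plus.
  replace (exp (- (x * s)) * exp (- (x * s)) * hankel_modulus (nu - 1 / 2) s *
    Rabs (- 2 * s * c + -1 * d)) with (exp (- (x * s)) * Rabs (- 2 * s * c + -1 * d) *
    (hankel_modulus (nu - 1 / 2) s * exp (- (x * s)))) by ring.
  apply Rmult_le_compat_r; [nra|easy].
Qed.

Lemma hankelK_bounds (nu : R) : - (1 / 2) < nu -> exists C, 0 < C /\
  forall x y lo hi, 0 < y <= 1 -> y <= x -> 0 < lo -> lo <= hi ->
  Rabs (hankelK nu lo hi x) <=
    C * (Rpower y (- Rmax (nu - 1 / 2) 0) * Rpower x (- (nu + 1 / 2))) /\
  Rabs (hankelK' nu lo hi x) <=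
    C * (Rpower y (- Rmax (nu - 1 / 2) 0) * Rpower x (- (nu + 1 / 2))).
Proof.
  intros Hnu. set (a := nu - 1 / 2).
  destruct (RInt_laplace_dominated a (Rmax a 0)) as [C [HC Hdom]];
    [unfold a; lra|apply Rmax_r|].
  pose proof (Rabs_pos a). set (M := 3 + 2 * Rabs a).
  exists (M * C). split; [unfold M; nra|]. intros x y lo hi Hy Hyx Hlo Hhi.
  replace (nu + 1 / 2) with (a + 1) by (unfold a; field).
  assert (Hmod : forall s, 0 < s -> hankel_modulus a s * exp (- (x * s)) <=
    Rpower s a * Rpower (1 + s) (Rmax a 0) * exp (- (x * s))).
  { intros s Hs. apply Rmult_le_compat_r; [left; apply exp_pos|].
    now apply hankel_modulus_le. }
  assert (Hpos : forall s, 0 < hankel_modulus a s * exp (- (x * s)))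
    by (intros s; apply Rmult_lt_0_compat; [apply hankel_modulus_pos|apply exp_pos]).
  split; apply Hdom; try easy; try (unfold M; lra).
  - intros s Hs. now apply continuous_hankelK_kernel.
  - intros s Hs. eapply Rle_trans; [apply Rabs_hankelK_kernel_le; lra|]. fold a.
    specialize (Hmod s Hs). specialize (Hpos s). unfold M. nra.
  - intros s Hs. now apply continuous_hankelK'_kernel.
  - intros s Hs. eapply Rle_trans; [apply Rabs_hankelK'_kernel_le; lra|]. fold a M.
    apply Rmult_le_compat_l; [unfold M; lra|now apply Hmod].
Qed.

Lemma Rabs_hankelK_kernel_sub_le (nu x s : R) : 0 < x -> 0 < s ->
  Rabs (hankelK_kernel nu x s -
        cos (x - hankel_shift nu) * laplace_kernel (nu - 1 / 2) (2 * x) s) <=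
  (2 * Rabs (nu - 1 / 2) + 2) * (Rpower s (nu + 1 / 2) *
    Rpower (1 + s) (Rmax (nu - 1 / 2) 0) * exp (- (x * s))).
Proof.
  intros Hx Hs. pose proof (hankel_oscillation_error nu x s cos Hs cos_lipschitz
    Rabs_cos_le_1) as Herr.
  replace (nu + 1 / 2) with (nu - 1 / 2 + 1) by field. rewrite Rpower_succ by easy.
  unfold hankelK_kernel, hankel_kernel, laplace_kernel. set (a := nu - 1 / 2) in *.
  replace (exp (- (2 * x * s)) * hankel_modulus a s *
      (1 * cos (x + hankel_arg nu s) + 0 * sin (x + hankel_arg nu s)) -
      cos (x - hankel_shift nu) * (Rpower s a * exp (- (2 * x * s))))
    with (exp (- (2 * x * s)) * (hankel_modulus a s * cos (x + hankel_arg nu s) -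
      Rpower s a * cos (x - hankel_shift nu))) by ring.
  assert (Hexp : exp (- (2 * x * s)) <= exp (- (x * s))) by (apply exp_le_compat; nra).
  rewrite Rabs_mult, (Rabs_pos_eq (exp _)), <- Rmult_assoc, Rmult_comm by (left; apply exp_pos).
  pose proof (Rpower_pos s a). pose proof (Rpower_pos (1 + s) (Rmax a 0)).
  assert (0 < s * (Rpower s a * Rpower (1 + s) (Rmax a 0)))
    by (repeat apply Rmult_lt_0_compat; lra).
  apply Rmult_le_compat; [apply Rabs_pos|left; apply exp_pos|nra|easy].
Qed.

Lemma Rabs_hankelK'_kernel_sub_le (nu x s : R) : 0 < x -> 0 < s ->
  Rabs (hankelK'_kernel nu x s -
        - sin (x - hankel_shift nu) * laplace_kernel (nu - 1 / 2) (2 * x) s) <=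
  (2 * Rabs (nu - 1 / 2) + 2) * (Rpower s (nu + 1 / 2) *
    Rpower (1 + s) (Rmax (nu - 1 / 2) 0) * exp (- (x * s))).
Proof.
  intros Hx Hs. pose proof (hankel_oscillation_error nu x s sin Hs sin_lipschitz
    Rabs_sin_le_1) as Herr.
  pose proof (hankel_modulus_le (nu - 1 / 2) s Hs) as Hmod.
  pose proof (hankel_modulus_pos (nu - 1 / 2) s) as Hmod0.
  replace (nu + 1 / 2) with (nu - 1 / 2 + 1) by field. rewrite Rpower_succ by easy.
  unfold hankelK'_kernel, hankel_kernel, laplace_kernel. set (a := nu - 1 / 2) in *.
  pose proof (Rabs_cos_le_1 (x + hankel_arg nu s)) as Hcos.
  set (c := cos (x + hankel_arg nu s)) in *. set (d := sin (x + hankel_arg nu s)) in *.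
  replace (exp (- (2 * x * s)) * hankel_modulus a s * (- 2 * s * c + -1 * d) -
      - sin (x - hankel_shift nu) * (Rpower s a * exp (- (2 * x * s))))
    with (- (exp (- (2 * x * s)) * ((hankel_modulus a s * d -
      Rpower s a * sin (x - hankel_shift nu)) + 2 * s * hankel_modulus a s * c))) by ring.
  assert (Hextra : Rabs (2 * s * hankel_modulus a s * c) <=
    2 * (s * (Rpower s a * Rpower (1 + s) (Rmax a 0)))).
  { rewrite Rabs_mult, (Rabs_pos_eq (2 * s * _)) by nra.
    apply Rle_trans with (2 * s * hankel_modulus a s * 1); [apply Rmult_le_compat_l|]; nra. }
  assert (Hexp : exp (- (2 * x * s)) <= exp (- (x * s))) by (apply exp_le_compat; nra).
  rewrite Rabs_Ropp, Rabs_mult, (Rabs_pos_eq (exp _)), <- Rmult_assoc, Rmult_comm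
    by (left; apply exp_pos).
  apply Rmult_le_compat; [apply Rabs_pos|left; apply exp_pos| |easy].
  eapply Rle_trans; [apply Rabs_triang|]. lra.
Qed.

Lemma RInt_sub_laplace_kernel (b c x lo hi : R) (f : R -> R) : 0 < lo -> lo <= hi ->
  (forall s, 0 < s -> continuous f s) ->
  RInt (fun s => f s - c * laplace_kernel b x s) lo hi =
  RInt f lo hi - c * RInt (laplace_kernel b x) lo hi.
Proof.
  intros Hlo Hhi Hf. apply is_RInt_unique.
  apply (is_RInt_minus (V := R_NormedModule) f (fun s => c * laplace_kernel b x s)).
  - apply (RInt_correct (V := R_CompleteNormedModule)). apply ex_RInt_pos_halfline; auto; lra.
  - apply (is_RInt_scal (V := R_NormedModule)), (RInt_correct (V := R_CompleteNormedModule)).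
    apply ex_RInt_laplace_kernel; lra.
Qed.

Lemma continuous_sub_laplace_kernel (b c x s : R) (f : R -> R) : 0 < s ->
  continuous f s -> continuous (fun s => f s - c * laplace_kernel b x s) s.
Proof.
  intros Hs Hf. apply (continuous_minus f (fun s => c * laplace_kernel b x s)); [easy|].
  apply (continuous_scal_r c (laplace_kernel b x)). now apply continuous_laplace_kernel.
Qed.

Lemma hankelK_laplace_asymptotic (nu : R) : - (1 / 2) < nu -> exists C, 0 < C /\
  forall x lo hi, 1 <= x -> 0 < lo -> lo <= hi ->
  let G := RInt (laplace_kernel (nu - 1 / 2) (2 * x)) lo hi in
  Rabs (hankelK nu lo hi x - cos (x - hankel_shift nu) * G) <=
    C * Rpower x (- (nu + 3 / 2)) /\
  Rabs (hankelK' nu lo hi x - - sin (x - hankel_shift nu) * G) <=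
    C * Rpower x (- (nu + 3 / 2)).
Proof.
  intros Hnu.
  destruct (RInt_laplace_dominated (nu + 1 / 2) (Rmax (nu - 1 / 2) 0)) as [C [HC Hdom]];
    [lra|apply Rmax_r|].
  pose proof (Rabs_pos (nu - 1 / 2)). set (M := 2 * Rabs (nu - 1 / 2) + 2) in *.
  exists (M * C). split; [unfold M; nra|]. intros x lo hi Hx Hlo Hhi G.
  assert (Hy : 0 < 1 <= 1) by lra.
  assert (Hbound : forall f, (forall s, 0 < s -> continuous f s) -> (forall s, 0 < s ->
      Rabs (f s) <= M * (Rpower s (nu + 1 / 2) * Rpower (1 + s) (Rmax (nu - 1 / 2) 0) *
        exp (- (x * s)))) ->
    Rabs (RInt f lo hi) <= M * C * Rpower x (- (nu + 3 / 2))).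
  { intros f Hf Hfle.
    pose proof (Hdom f M x 1 lo hi Hy Hx Hlo Hhi ltac:(unfold M; lra) Hf Hfle) as Hint.
    rewrite Rpower_base_1, Rmult_1_l in Hint.
    now replace (nu + 3 / 2) with (nu + 1 / 2 + 1) by field. }
  unfold G. split.
  - unfold hankelK. rewrite <- RInt_sub_laplace_kernel; try easy.
    + apply Hbound; intros s Hs.
      * apply continuous_sub_laplace_kernel; [easy|now apply continuous_hankelK_kernel].
      * apply Rabs_hankelK_kernel_sub_le; lra.
    + intros s Hs. now apply continuous_hankelK_kernel.
  - unfold hankelK'. rewrite <- RInt_sub_laplace_kernel; try easy.
    + apply Hbound; intros s Hs.
      * apply continuous_sub_laplace_kernel; [easy|now apply continuous_hankelK'_kernel].
      * apply Rabs_hankelK'_kernel_sub_le; lra.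
    + intros s Hs. now apply continuous_hankelK'_kernel.
Qed.

(** * Identification of the Hankel integral *)

Lemma Rabs_hankel_boundary_le (nu x s : R) : 0 < s ->
  Rabs (hankel_boundary nu x s) <=
  2 * (Rpower s (nu + 1 / 2) * Rpower (1 + s) (Rmax (nu - 1 / 2) 0 + 1)) *
  exp (- (2 * x * s)).
Proof.
  intros Hs. unfold hankel_boundary, hankel_kernel.
  replace (nu + 1 / 2) with (nu - 1 / 2 + 1) by field. set (a := nu - 1 / 2).
  rewrite !Rpower_succ by lra.
  pose proof (hankel_modulus_pos a s). pose proof (hankel_modulus_le a s Hs).
  pose proof (Rabs_cos_le_1 (x + hankel_arg nu s)) as Hcos.
  pose proof (Rabs_sin_le_1 (x + hankel_arg nu s)) as Hsin.
  set (c := cos (x + hankel_arg nu s)) in *. set (d := sin (x + hankel_arg nu s)) in *.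
  rewrite !Rabs_mult, (Rabs_pos_eq (exp _)), (Rabs_pos_eq (hankel_modulus _ _))
    by (lra || (left; apply exp_pos)).
  replace (exp (- (2 * x * s)) * hankel_modulus a s * Rabs (- 2 * s ^ 2 * c + - 2 * s * d))
    with (Rabs (- 2 * s ^ 2 * c + - 2 * s * d) * hankel_modulus a s * exp (- (2 * x * s)))
    by ring.
  apply Rmult_le_compat_r; [left; apply exp_pos|].
  assert (Hosc : Rabs (- 2 * s ^ 2 * c + - 2 * s * d) <= 2 * s * (1 + s)).
  { replace (- 2 * s ^ 2 * c + - 2 * s * d) with (- (2 * s * (s * c + d))) by ring.
    rewrite Rabs_Ropp, Rabs_mult, (Rabs_pos_eq (2 * s)) by lra.
    apply Rmult_le_compat_l; [lra|]. eapply Rle_trans; [apply Rabs_triang|].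
    rewrite Rabs_mult, (Rabs_pos_eq s) by lra. nra. }
  replace (2 * (s * Rpower s a * ((1 + s) * Rpower (1 + s) (Rmax a 0))))
    with (2 * s * (1 + s) * (Rpower s a * Rpower (1 + s) (Rmax a 0))) by ring.
  apply Rmult_le_compat; [apply Rabs_pos|lra|easy|easy].
Qed.

Lemma hankel_boundary_uniform_le (nu x0 : R) : 0 < x0 -> exists C, 0 < C /\
  forall x s, x0 <= x -> 0 < s ->
  Rabs (hankel_boundary nu x s) <= C * (Rpower s (nu + 1 / 2) * exp (- (x0 * s))).
Proof.
  intros Hx0. set (p := Rmax (nu - 1 / 2) 0 + 1).
  assert (Hp : 0 <= p) by (unfold p; pose proof (Rmax_r (nu - 1 / 2) 0); lra).
  destruct (Rpower_one_plus_exp_le p Hp) as [C [HC Hexp]]. set (y := Rmin 1 x0).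
  assert (Hy : 0 < y <= 1) by (split; [apply Rmin_glb_lt; lra|apply Rmin_l]).
  pose proof (Rpower_pos y (- p)) as Hyp.
  exists (2 * (C * Rpower y (- p))). split; [nra|]. intros x s Hx Hs.
  eapply Rle_trans; [now apply Rabs_hankel_boundary_le|]. fold p.
  assert (Hyx : y <= x) by (pose proof (Rmin_r 1 x0); unfold y; lra).
  specialize (Hexp x y s Hy Hyx Hs).
  replace (exp (- (2 * x * s))) with (exp (- (x * s / 2)) * exp (- (3 / 2 * (x * s))))
    by (rewrite <- exp_plus; f_equal; field).
  assert (Hdecay : exp (- (3 / 2 * (x * s))) <= exp (- (x0 * s))) by (apply exp_le_compat; nra).
  replace (2 * (Rpower s (nu + 1 / 2) * Rpower (1 + s) p) *
      (exp (- (x * s / 2)) * exp (- (3 / 2 * (x * s))))) with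
    (2 * (Rpower (1 + s) p * exp (- (x * s / 2))) *
      (Rpower s (nu + 1 / 2) * exp (- (3 / 2 * (x * s))))) by ring.
  pose proof (Rpower_pos s (nu + 1 / 2)). pose proof (Rpower_pos (1 + s) p).
  pose proof (exp_pos (- (x * s / 2))). pose proof (exp_pos (- (3 / 2 * (x * s)))).
  apply Rmult_le_compat.
  - apply Rmult_le_pos; [lra|]. apply Rmult_le_pos; lra.
  - apply Rmult_le_pos; lra.
  - lra.
  - apply Rmult_le_compat_l; lra.
Qed.

Lemma hankel_boundary_vanishes (nu x0 eps : R) : - (1 / 2) < nu -> 0 < x0 -> 0 < eps ->
  Rbar_locally p_infty (fun r => forall x, x0 <= x ->
    Rabs (hankel_boundary nu x r) < eps /\ Rabs (hankel_boundary nu x (/ r)) < eps).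
Proof.
  intros Hnu Hx0 Heps.
  destruct (hankel_boundary_uniform_le nu x0 Hx0) as [C [HC Hle]].
  set (m := fun s => Rpower s (nu + 1 / 2) * exp (- (x0 * s))).
  assert (HepsC : 0 < eps / C) by now apply Rdiv_lt_0_compat.
  assert (Hinf := filterlim_Rabs_lt m 0 (eps / C)
    (Rpower_mul_exp_neg_at_p_infty (nu + 1 / 2) x0 ltac:(lra) Hx0) HepsC).
  assert (Hzero := filterlim_Rinv_p_infty _ (filterlim_Rabs_lt m 0 (eps / C)
    (Rpower_mul_exp_neg_at_0 (nu + 1 / 2) x0 ltac:(lra) Hx0) HepsC)).
  assert (Hsmall : forall x s, x0 <= x -> 0 < s -> Rabs (m s - 0) < eps / C ->
    Rabs (hankel_boundary nu x s) < eps).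
  { intros x s Hx Hs Hm. eapply Rle_lt_trans; [now apply Hle|].
    apply Rabs_def2 in Hm. fold (m s).
    replace eps with (C * (eps / C)) by (field; lra). apply Rmult_lt_compat_l; lra. }
  refine (filter_imp _ _ _ (filter_and _ _ (p_infty_gt 0) (filter_and _ _ Hinf Hzero))).
  intros r (Hr & Hmr & Hmr') x Hx. split; [now apply Hsmall|].
  apply Hsmall; [easy|now apply Rinv_0_lt_compat|easy].
Qed.

Lemma hankel_wronskian_at_0 (nu eps : R) : - (1 / 2) < nu -> 0 < eps ->
  at_right 0 (fun x => forall lo hi, 0 < lo -> lo <= hi ->
    Rabs (hankel_wronskian nu lo hi x) < eps).
Proof.
  intros Hnu Heps. destruct (hankelK_bounds nu Hnu) as [C [HC HK]].
  destruct (bessel_entire_bounded_at_0 nu) as [B [HB HL]]; [lra|].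
  set (P := Rmax (nu - 1 / 2) 0) in *. set (e := nu + 1 / 2 - P).
  assert (He : 0 < e) by (unfold e, P, Rmax; destruct (Rle_dec (nu - 1 / 2) 0); lra).
  assert (HCB : 0 < 2 * C * B) by (repeat apply Rmult_lt_0_compat; lra).
  refine (filter_imp _ _ _ (filter_and _ _ (at_right_between 0 1 Rlt_0_1) (filter_and _ _ HL
    (filterlim_Rabs_lt _ 0 (eps / (2 * C * B)) (Rpower_at_0 e He) _))));
    [|now apply Rdiv_lt_0_compat].
  intros x (Hx & [HLx HLx'] & Hpow) lo hi Hlo Hhi.
  destruct (HK x x lo hi) as [HKx HKx']; try lra.
  set (b := Rpower x (- P) * Rpower x (- (nu + 1 / 2))) in *.
  unfold hankel_wronskian.
  rewrite Rabs_mult, (Rabs_pos_eq (Rpower x _)) by (left; apply Rpower_pos).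
  assert (Hsum : Rabs (hankelK nu lo hi x * bessel_entire' nu x -
    hankelK' nu lo hi x * bessel_entire nu x) <= 2 * C * B * b).
  { eapply Rle_trans; [apply Rabs_triang|]. rewrite Rabs_Ropp, !Rabs_mult.
    assert (Rabs (hankelK nu lo hi x) * Rabs (bessel_entire' nu x) <= C * b * B)
      by (apply Rmult_le_compat; auto using Rabs_pos).
    assert (Rabs (hankelK' nu lo hi x) * Rabs (bessel_entire nu x) <= C * b * B)
      by (apply Rmult_le_compat; auto using Rabs_pos).
    lra. }
  apply Rle_lt_trans with (2 * C * B * Rpower x e).
  - replace (Rpower x e) with (Rpower x (2 * nu + 1) * b)
      by (unfold b, e; rewrite <- !Rpower_plus; f_equal; field).
    rewrite <- Rmult_assoc, (Rmult_comm _ (Rpower x _)), Rmult_assoc.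
    apply Rmult_le_compat_l; [left; apply Rpower_pos|easy].
  - rewrite Rminus_0_r in Hpow. apply Rabs_def2 in Hpow.
    replace eps with (2 * C * B * (eps / (2 * C * B))) by (field; lra).
    now apply Rmult_lt_compat_l.
Qed.

Lemma bessel_weight_bounded (nu a b : R) : -1 < nu -> 0 < a -> exists M, 0 < M /\
  forall y, a <= y <= b -> Rabs (Rpower y (2 * nu) * bessel_entire nu y) <= M.
Proof.
  intros Hnu Ha.
  destruct (bounded_continuity (V := R_NormedModule)
    (fun y => Rpower y (2 * nu) * bessel_entire nu y) a b) as [M HM].
  { intros y Hy. apply (continuous_mult (fun y => Rpower y (2 * nu)) (bessel_entire nu)).
    - apply continuous_Rpower. lra.
    - now apply continuous_bessel_entire. }
  exists (Rmax M 1). pose proof (Rmax_l M 1). pose proof (Rmax_r M 1). split; [lra|].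
  intros y Hy. specialize (HM y Hy). simpl in HM. unfold norm in HM; simpl in HM.
  unfold abs in HM; simpl in HM. lra.
Qed.

(* [hankel_wronskian] is small near [0], and its derivative consists of boundary terms. *)
Lemma hankel_wronskian_vanishes (nu x : R) : - (1 / 2) < nu -> 0 < x ->
  filterlim (fun r => hankel_wronskian nu (/ r) r x) (Rbar_locally p_infty) (locally 0).
Proof.
  intros Hnu Hx. apply filterlim_locally. intros eps. pose proof (cond_pos eps).
  destruct (filter_ex (F := at_right 0) _ (filter_and _ _ (at_right_between 0 x Hx)
    (hankel_wronskian_at_0 nu (eps / 2) Hnu ltac:(lra)))) as [x0 [Hx0 Hnear]].
  destruct (bessel_weight_bounded nu x0 x) as [M [HM HMy]]; try lra.
  set (d := eps / (4 * M * x)).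
  assert (Hd : 0 < d) by (apply Rdiv_lt_0_compat; [easy|nra]).
  apply (filter_imp (fun r => 1 < r /\ forall y, x0 <= y ->
    Rabs (hankel_boundary nu y r) < d /\ Rabs (hankel_boundary nu y (/ r)) < d)).
  2: { apply filter_and; [now exists 1|]. apply hankel_boundary_vanishes; lra. }
  intros r [Hr Hbd].
  pose proof (Rinv_bounds_ge_1 r ltac:(lra)) as Hrinv.
  assert (Hvar : Rabs (hankel_wronskian nu (/ r) r x - hankel_wronskian nu (/ r) r x0) <=
    M * (2 * d) * (x - x0)).
  { apply (is_derive_Rabs_sub_le _ (fun y => - (Rpower y (2 * nu) * bessel_entire nu y *
      (hankel_boundary nu y r - hankel_boundary nu y (/ r))))); [lra| |]; intros y Hy.
    - apply is_derive_hankel_wronskian; lra.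
    - rewrite Rabs_Ropp, Rabs_mult. apply Rmult_le_compat; auto using Rabs_pos.
      eapply Rle_trans; [apply Rabs_triang|]. rewrite Rabs_Ropp.
      destruct (Hbd y); lra. }
  assert (Hsmall : M * (2 * d) * (x - x0) <= eps / 2).
  { replace (eps / 2) with (M * (2 * d) * x) by (unfold d; field; lra).
    apply Rmult_le_compat_l; [|lra]. apply Rmult_le_pos; lra. }
  specialize (Hnear (/ r) r ltac:(lra) ltac:(lra)).
  change (Rabs (hankel_wronskian nu (/ r) r x - 0) < eps). rewrite Rminus_0_r.
  replace (hankel_wronskian nu (/ r) r x) with
    ((hankel_wronskian nu (/ r) r x - hankel_wronskian nu (/ r) r x0) +
      hankel_wronskian nu (/ r) r x0) by ring.
  eapply Rle_lt_trans; [apply Rabs_triang|]. lra.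
Qed.

(** * The phase of Bessel functions *)

Lemma laplace_kernel_truncated_ge (nu : R) : exists c, 0 < c /\
  forall x r, 1 <= x -> 2 * x <= r ->
  c * Rpower x (- (nu + 1 / 2)) <= RInt (laplace_kernel (nu - 1 / 2) (2 * x)) (/ r) r.
Proof.
  destruct (RInt_laplace_kernel_ge (nu - 1 / 2)) as [c [Hc Hge]].
  replace (nu - 1 / 2 + 1) with (nu + 1 / 2) in Hge by field.
  exists (c * Rpower 2 (- (nu + 1 / 2))).
  split; [apply Rmult_lt_0_compat; [easy|apply Rpower_pos]|]. intros x r Hx Hr.
  rewrite Rmult_assoc, Rpower_mult_distr by lra.
  apply Hge; [lra|apply Rinv_0_lt_compat; lra| |nra].
  apply Rmult_le_reg_r with r; [lra|]. rewrite Rmult_assoc, Rinv_l; lra.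
Qed.

Lemma hankelK_entire_wronskian_vanishes (nu x : R) : - (1 / 2) < nu -> 0 < x ->
  filterlim (fun r => hankelK nu (/ r) r x * bessel_entire' nu x -
    hankelK' nu (/ r) r x * bessel_entire nu x) (Rbar_locally p_infty) (locally 0).
Proof.
  intros Hnu Hx. pose proof (Rpower_pos x (2 * nu + 1)) as Hpow.
  apply (filterlim_ext (fun r => / Rpower x (2 * nu + 1) * hankel_wronskian nu (/ r) r x)).
  { intros r. unfold hankel_wronskian. field. lra. }
  rewrite <- (Rmult_0_r (/ Rpower x (2 * nu + 1))).
  apply (is_lim_scal_l (fun r => hankel_wronskian nu (/ r) r x) _ p_infty 0).
  now apply hankel_wronskian_vanishes.
Qed.

(* [u] and [v] stand for the values of [x ^ (- nu) * J_nu] and of its derivative. *)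
Lemma hankel_phase_error (nu : R) : - (1 / 2) < nu -> exists C, 0 < C /\
  forall x lo hi u v, 1 <= x -> 0 < lo -> lo <= hi ->
  Rabs (cos (x - hankel_shift nu) * v + sin (x - hankel_shift nu) * u) *
    RInt (laplace_kernel (nu - 1 / 2) (2 * x)) lo hi <=
  Rabs (hankelK nu lo hi x * v - hankelK' nu lo hi x * u) +
    C * Rpower x (- (nu + 3 / 2)) * (Rabs u + Rabs v).
Proof.
  intros Hnu. destruct (hankelK_laplace_asymptotic nu Hnu) as [C [HC HK]].
  exists C. split; [easy|]. intros x lo hi u v Hx Hlo Hhi.
  destruct (HK x lo hi Hx Hlo Hhi) as [HK0 HK1].
  set (co := cos (x - hankel_shift nu)) in *. set (si := sin (x - hankel_shift nu)) in *.
  set (k := hankelK nu lo hi x) in *. set (k' := hankelK' nu lo hi x) in *.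
  set (p := Rpower x (- (nu + 3 / 2))) in *.
  assert (HG : 0 <= RInt (laplace_kernel (nu - 1 / 2) (2 * x)) lo hi).
  { apply RInt_ge_0; [easy|apply ex_RInt_laplace_kernel; lra|].
    intros s _. left. apply laplace_kernel_pos. }
  set (G := RInt (laplace_kernel (nu - 1 / 2) (2 * x)) lo hi) in *.
  rewrite <- (Rabs_pos_eq G), <- Rabs_mult by easy.
  replace ((co * v + si * u) * G) with
    ((k * v - k' * u) + (- ((k - co * G) * v) + (k' - - si * G) * u)) by ring.
  eapply Rle_trans; [apply Rabs_triang|]. apply Rplus_le_compat_l.
  eapply Rle_trans; [apply Rabs_triang|].
  rewrite Rabs_Ropp, (Rabs_mult _ v), (Rabs_mult _ u).
  assert (Rabs (k - co * G) * Rabs v <= C * p * Rabs v)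
    by (apply Rmult_le_compat_r; [apply Rabs_pos|easy]).
  assert (Rabs (k' - - si * G) * Rabs u <= C * p * Rabs u)
    by (apply Rmult_le_compat_r; [apply Rabs_pos|easy]).
  lra.
Qed.

Lemma bessel_entire_phase (nu : R) : - (1 / 2) < nu -> exists C, 0 < C /\ forall x, 1 <= x ->
  Rabs (cos (x - hankel_shift nu) * bessel_entire' nu x +
        sin (x - hankel_shift nu) * bessel_entire nu x) <=
  C / x * (Rabs (bessel_entire nu x) + Rabs (bessel_entire' nu x)).
Proof.
  intros Hnu. destruct (hankel_phase_error nu Hnu) as [C [HC Herr]].
  destruct (laplace_kernel_truncated_ge nu) as [c [Hc HG]].
  exists (C / c). split; [now apply Rdiv_lt_0_compat|]. intros x Hx.
  set (p := Rpower x (- (nu + 3 / 2))). assert (Hp : 0 < p) by apply Rpower_pos.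
  assert (Hxp : Rpower x (- (nu + 1 / 2)) = x * p).
  { unfold p. rewrite <- Rpower_succ by lra. f_equal. field. }
  assert (Hcxp : 0 < c * (x * p)) by (repeat apply Rmult_lt_0_compat; lra).
  apply le_epsilon. intros eps Heps. assert (Hx0 : 0 < x) by lra.
  assert (Htol : 0 < eps * (c * (x * p))) by now apply Rmult_lt_0_compat.
  destruct (filter_ex (F := Rbar_locally p_infty) _ (filter_and _ _ (p_infty_gt (2 * x))
    (filterlim_Rabs_lt _ 0 _ (hankelK_entire_wronskian_vanishes nu x Hnu Hx0) Htol)))
    as [r [Hr Hw]].
  rewrite Rminus_0_r in Hw. pose proof (Rinv_bounds_ge_1 r ltac:(lra)) as Hrinv.
  specialize (HG x r Hx ltac:(lra)). rewrite Hxp in HG.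
  specialize (Herr x (/ r) r (bessel_entire nu x) (bessel_entire' nu x) Hx
    ltac:(lra) ltac:(lra)). fold p in Herr.
  apply Rmult_le_reg_r with (c * (x * p)); [easy|].
  eapply Rle_trans; [apply Rmult_le_compat_l; [apply Rabs_pos|exact HG]|].
  eapply Rle_trans; [exact Herr|].
  replace ((C / c / x * (Rabs (bessel_entire nu x) + Rabs (bessel_entire' nu x)) + eps) *
      (c * (x * p)))
    with (C * p * (Rabs (bessel_entire nu x) + Rabs (bessel_entire' nu x)) +
      eps * (c * (x * p))) by (field; lra).
  lra.
Qed.

Lemma BesselJ_zero_cos_le (nu : R) : 0 <= nu -> exists C, 0 < C /\ forall x, 1 <= x ->
  BesselJ nu x = 0 -> Rabs (cos (x - hankel_shift nu)) <= C / x.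
Proof.
  intros Hnu. destruct (bessel_entire_phase nu) as [C [HC Hphase]]; [lra|].
  exists C. split; [easy|]. intros x Hx HJ. specialize (Hphase x Hx).
  pose proof (J_zero_N_neq0 nu _ _ (recessive_BesselJ nu Hnu) x ltac:(lra) HJ) as HN.
  rewrite BesselJ_eq in HJ by lra. pose proof (Rpower_pos (x / 2) nu) as Hpow.
  apply Rmult_integral in HJ. destruct HJ as [HJ|HL]; [lra|].
  rewrite HL, Rmult_0_r, Rplus_0_r, Rabs_mult, Rabs_R0, Rplus_0_l in Hphase.
  apply Rmult_le_reg_r in Hphase; [easy|]. apply Rabs_pos_lt. intros HL'. apply HN.
  unfold bessel_N. rewrite HL, HL'. ring.
Qed.

Lemma critical_point_sin_le (nu delta : R) : 0 <= nu -> exists C, 0 < C /\ forall x, 1 <= x ->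
  bessel_N nu x = delta * BesselJ nu x -> Rabs (sin (x - hankel_shift nu)) <= C / x.
Proof.
  intros Hnu. destruct (bessel_entire_phase nu) as [C [HC Hphase]]; [lra|].
  set (d := Rabs (delta - nu)). assert (Hd : 0 <= d) by apply Rabs_pos.
  exists (C * (1 + d) + d). split; [nra|]. intros x Hx HN. specialize (Hphase x Hx).
  pose proof (J_zero_N_neq0 nu _ _ (recessive_BesselJ nu Hnu) x ltac:(lra)) as HJ.
  rewrite HN, BesselJ_eq in HJ by lra. unfold bessel_N in HN.
  rewrite BesselJ_eq in HN by lra. pose proof (Rpower_pos (x / 2) nu) as Hpow.
  assert (HL : 0 < Rabs (bessel_entire nu x)).
  { apply Rabs_pos_lt. intros HL. rewrite HL in HJ. apply HJ; ring. }
  assert (HL' : bessel_entire' nu x = (delta - nu) / x * bessel_entire nu x).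
  { apply Rmult_eq_reg_l with (Rpower (x / 2) nu * x); [|nra].
    replace (Rpower (x / 2) nu * x * ((delta - nu) / x * bessel_entire nu x)) with
      (Rpower (x / 2) nu * ((delta - nu) * bessel_entire nu x)) by (field; lra). lra. }
  pose proof (Rabs_cos_le_1 (x - hankel_shift nu)) as Hcos.
  set (co := cos (x - hankel_shift nu)) in *. set (si := sin (x - hankel_shift nu)) in *.
  rewrite HL' in Hphase. set (L := bessel_entire nu x) in *.
  replace (co * ((delta - nu) / x * L) + si * L) with ((co * ((delta - nu) / x) + si) * L)
    in Hphase by ring.
  assert (Hquot : Rabs ((delta - nu) / x) = d / x).
  { unfold Rdiv. rewrite Rabs_mult, (Rabs_pos_eq (/ x)); [easy|].
    left. apply Rinv_0_lt_compat. lra. }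
  rewrite !Rabs_mult, Hquot in Hphase.
  replace (C / x * (Rabs L + d / x * Rabs L)) with (C / x * (1 + d / x) * Rabs L)
    in Hphase by ring.
  apply Rmult_le_reg_r in Hphase; [|easy].
  pose proof (Rinv_bounds_ge_1 x Hx) as Hxinv.
  replace si with ((co * ((delta - nu) / x) + si) - co * ((delta - nu) / x)) by ring.
  eapply Rle_trans; [apply Rabs_triang|]. rewrite Rabs_Ropp, Rabs_mult, Hquot.
  assert (Rabs co * (d / x) <= 1 * (d / x))
    by (apply Rmult_le_compat_r; [apply Rdiv_le_0_compat; lra|easy]).
  assert (C / x * (1 + d / x) <= C / x * (1 + d)).
  { apply Rmult_le_compat_l; [apply Rdiv_le_0_compat; lra|]. unfold Rdiv. nra. }
  replace ((C * (1 + d) + d) / x) with (C / x * (1 + d) + 1 * (d / x)) by (field; lra). lra.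
Qed.

Lemma phase_replaces_hankel_shift (nu C eps : R) (F : R -> R) (Z : R -> Prop) :
  0 <= nu -> 0 < eps -> (forall u v, Rabs (F u - F v) <= Rabs (u - v)) ->
  (forall x, 1 <= x -> Z x -> Rabs (F (x - hankel_shift nu)) <= C / x) ->
  Rbar_locally p_infty (fun x => Z x -> Rabs (F (phase nu x - PI / 4)) < eps).
Proof.
  intros Hnu Heps HF HZ. assert (Heps2 : 0 < eps / 2) by lra.
  refine (filter_imp _ _ _ (filter_and _ _ (p_infty_gt 1)
    (filter_and _ _ (eventually_div_lt C (eps / 2) Heps2)
      (filterlim_Rabs_lt _ 0 (eps / 2) (phase_asymptotic nu Hnu) Heps2)))).
  intros x (Hx & HCx & Hphase) HZx. specialize (HZ x ltac:(lra) HZx).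
  specialize (HF (phase nu x - PI / 4) (x - hankel_shift nu)).
  replace (phase nu x - PI / 4 - (x - hankel_shift nu))
    with (phase nu x - (x - nu * PI / 2) - 0) in HF by (unfold hankel_shift; field).
  pose proof (Rabs_triang_inv (F (phase nu x - PI / 4)) (F (x - hankel_shift nu))). lra.
Qed.

Lemma BesselJ_zero_phase (nu eps : R) : 0 <= nu -> 0 < eps ->
  Rbar_locally p_infty (fun x =>
    BesselJ nu x = 0 -> Rabs (cos (phase nu x - PI / 4)) < eps).
Proof.
  intros Hnu Heps. destruct (BesselJ_zero_cos_le nu Hnu) as [C [_ Hcos]].
  now apply (phase_replaces_hankel_shift nu C eps cos); try apply cos_lipschitz.
Qed.

Lemma critical_point_phase (nu delta eps : R) : 0 <= nu -> 0 < eps ->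
  Rbar_locally p_infty (fun x => bessel_N nu x = delta * BesselJ nu x ->
    Rabs (sin (phase nu x - PI / 4)) < eps).
Proof.
  intros Hnu Heps. destruct (critical_point_sin_le nu delta Hnu) as [C [_ Hsin]].
  now apply (phase_replaces_hankel_shift nu C eps sin); try apply sin_lipschitz.
Qed.

(** * Phase windows for the zeros *)

Lemma zero_seq_at_p_infty (nu : R) (J N : R -> R) : recessive_solution nu J N ->
  filterlim (fun k => zero_seq J (S k)) eventually (Rbar_locally p_infty).
Proof.
  intros HP. pose proof PI2_1.
  apply (is_lim_seq_le_p_loc INR); [|apply is_lim_seq_INR].
  exists 0%nat. intros k _. pose proof (zero_seq_ge nu J N HP k). pose proof (pos_INR k). nra.
Qed.

Lemma BesselJ_zero_phase_window (nu : R) : 0 <= nu ->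
  eventually (fun k => INR k * PI + 5 * PI / 8 <
    phase nu (zero_seq (BesselJ nu) (S k)) < INR k * PI + 7 * PI / 8).
Proof.
  intros Hnu. pose proof PI_RGT_0. assert (HP := recessive_BesselJ nu Hnu).
  assert (Hsin : 0 < sin (PI / 8)) by (apply sin_gt_0; lra).
  pose proof (zero_seq_at_p_infty nu _ _ HP _
    (BesselJ_zero_phase nu (sin (PI / 8)) Hnu Hsin)) as Hlarge.
  unfold filtermap in Hlarge. revert Hlarge. apply filter_imp. intros k Hcos.
  specialize (Hcos (zero_seq_zero nu _ _ HP k)).
  pose proof (phase_zero_seq_gt nu _ _ HP k). pose proof (phase_zero_seq_le nu _ _ HP k).
  set (t := phase nu (zero_seq (BesselJ nu) (S k))) in *.
  assert (Hu : Rabs (t - INR k * PI - 3 * PI / 4) < PI / 8); [|apply Rabs_def2 in Hu; lra].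
  apply Rabs_lt_of_Rabs_sin_lt; [lra|apply Rabs_le; lra|].
  rewrite <- (Rabs_sin_add_mul_PI _ (S k)), S_INR.
  replace (t - INR k * PI - 3 * PI / 4 + (INR k + 1) * PI) with (PI / 2 + (t - PI / 4))
    by field.
  now rewrite <- cos_sin.
Qed.

Lemma critical_point_phase_window (nu delta : R) : 0 <= nu ->
  eventually (fun k => let d := critical_point nu delta k in
    nu < d /\ INR k * PI < phase nu d < INR k * PI + 3 * PI / 8).
Proof.
  intros Hnu. pose proof PI_RGT_0. assert (HP := recessive_BesselJ nu Hnu).
  assert (Hsin : 0 < sin (PI / 8)) by (apply sin_gt_0; lra).
  destruct (critical_point_phase nu delta (sin (PI / 8)) Hnu Hsin) as [X HX].
  destruct (filter_and _ _ (BesselJ_zero_phase_window nu Hnu)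
    (zero_seq_at_p_infty nu _ _ HP _ (p_infty_gt X)))
    as [K HK].
  exists (S K). intros k Hk d. destruct k as [|k]; [lia|].
  destruct (HK k ltac:(lia)) as [Hwk HXk]. destruct (HK (S k) ltac:(lia)) as [HwSk _].
  destruct (critical_point_spec nu delta (S k) Hnu) as [Hgap HN]; [left; lia|].
  fold d in Hgap, HN.
  pose proof (zero_seq_gt_order nu _ _ HP k). rewrite S_INR in *. split; [lra|].
  specialize (HX d ltac:(lra) HN).
  pose proof (phase_incr nu (zero_seq (BesselJ nu) (S k)) d ltac:(lra) ltac:(lra)).
  pose proof (phase_incr nu d (zero_seq (BesselJ nu) (S (S k))) ltac:(lra) ltac:(lra)).
  assert (Hu : Rabs (phase nu d - (INR k + 1) * PI - PI / 4) < PI / 8);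
    [|apply Rabs_def2 in Hu; lra].
  apply Rabs_lt_of_Rabs_sin_lt; [lra|apply Rabs_le; lra|].
  rewrite <- (Rabs_sin_add_mul_PI _ (S k)), S_INR.
  now replace (phase nu d - (INR k + 1) * PI - PI / 4 + (INR k + 1) * PI)
    with (phase nu d - PI / 4) by ring.
Qed.

(** * The inverse of [h] *)

Lemma h_incr (nu a b : R) : 0 <= nu < a -> a < b -> h nu a < h nu b.
Proof.
  intros Ha Hab. apply Rmult_lt_reg_l with PI; [apply PI_RGT_0|]. now apply phase_incr.
Qed.

Lemma h_at_order (nu : R) : 0 <= nu -> h nu nu = 0.
Proof.
  intros [Hnu| <-]; unfold h; [|ring]. unfold g. rewrite Rdiv_diag by lra.
  rewrite acos_1. replace (1 - 1 ^ 2) with 0 by ring. rewrite sqrt_0. field. apply PI_neq0.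
Qed.

Lemma h_surjective (nu y : R) : 0 <= nu -> 0 < y -> exists x, nu <= x /\ h nu x = y.
Proof.
  intros Hnu Hy. pose proof PI_RGT_0. assert (HPIy : 0 < PI * y) by nra.
  assert (Hnu1 : nu < nu + 1) by lra.
  destruct (filter_ex (F := at_right nu) _ (filter_and _ _ (at_right_between nu (nu + 1) Hnu1)
    (filterlim_Rabs_lt _ 0 _ (filterlim_phase_turning_point nu Hnu) HPIy))) as [a [Ha Hpa]].
  destruct (filter_ex (F := Rbar_locally p_infty) _ (filter_and _ _ (p_infty_gt (nu + 1))
    (phase_at_p_infty nu Hnu _ (p_infty_gt (PI * y))))) as [b [Hb Hpb]].
  apply Rabs_def2 in Hpa.
  destruct (IVT_interv (fun x => phase nu x - PI * y) a b) as [x [Hx Hzero]]; try lra.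
  - intros t Ht. apply (continuity_pt_minus (phase nu) (fun _ => PI * y)).
    + eapply is_derive_continuity_pt. apply is_derive_phase. lra.
    + apply continuity_pt_const. now intros u v.
  - exists x. split; [lra|]. apply Rmult_eq_reg_l with PI; [|lra].
    unfold phase in Hzero. lra.
Qed.

Lemma h_inv_spec (nu y : R) : 0 <= nu -> 0 < y -> nu < h_inv nu y /\ h nu (h_inv nu y) = y.
Proof.
  intros Hnu Hy.
  assert (Hinv : nu <= h_inv nu y /\ h nu (h_inv nu y) = y)
    by (unfold h_inv; now apply epsilon_spec, h_surjective).
  destruct Hinv as [[Hlt|Heq] Hh]; [easy|].
  rewrite <- Heq, h_at_order in Hh by easy. lra.
Qed.

Lemma lt_h_inv (nu x y : R) : 0 <= nu < x -> 0 < y -> h nu x < y -> x < h_inv nu y.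
Proof.
  intros Hx Hy Hlt. destruct (h_inv_spec nu y ltac:(lra) Hy) as [Hnu Hinv].
  apply Rnot_le_lt. intros [Hle|Heq]; [|rewrite Heq in Hinv; lra].
  pose proof (h_incr nu (h_inv nu y) x ltac:(lra) Hle). lra.
Qed.

Lemma h_inv_lt (nu x y : R) : 0 <= nu < x -> 0 < y -> y < h nu x -> h_inv nu y < x.
Proof.
  intros Hx Hy Hlt. destruct (h_inv_spec nu y ltac:(lra) Hy) as [Hnu Hinv].
  apply Rnot_le_lt. intros [Hle|Heq]; [|rewrite <- Heq in Hinv; lra].
  pose proof (h_incr nu x (h_inv nu y) ltac:(lra) Hle). lra.
Qed.

Lemma h_asymptotic (nu : R) : 0 <= nu ->
  Rbar_locally p_infty (fun x => Rabs (h nu x - (x / PI - nu / 2)) < 1 / 8).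
Proof.
  intros Hnu. pose proof PI_RGT_0. assert (HPI8 : 0 < PI / 8) by lra.
  refine (filter_imp _ _ _ (filterlim_Rabs_lt _ 0 (PI / 8) (phase_asymptotic nu Hnu) HPI8)).
  intros x Hx. unfold phase in Hx.
  apply Rmult_lt_reg_l with PI; [easy|]. rewrite <- (Rabs_pos_eq PI), <- Rabs_mult by lra.
  rewrite (Rabs_pos_eq PI) by lra.
  replace (PI * (h nu x - (x / PI - nu / 2))) with (PI * h nu x - (x - nu * PI / 2) - 0)
    by (field; lra). lra.
Qed.

Lemma h_affine_asymptotic (nu c : R) : 0 <= nu ->
  eventually (fun k => nu < PI * (INR k + nu / 2 + c) /\
    Rabs (h nu (PI * (INR k + nu / 2 + c)) - (INR k + c)) < 1 / 8).
Proof.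
  intros Hnu. pose proof PI_RGT_0.
  assert (Hlim : filterlim (fun k => PI * (INR k + nu / 2 + c)) eventually
    (Rbar_locally p_infty)).
  { apply (filterlim_comp _ _ _ INR (fun t => PI * (t + nu / 2 + c)) _ (Rbar_locally p_infty));
      [apply is_lim_seq_INR|].
    intros P [M HM]. exists (M / PI - (nu / 2 + c)). intros t Ht. apply HM.
    replace M with (PI * (M / PI)) by (field; lra). apply Rmult_lt_compat_l; lra. }
  pose proof (Hlim _ (filter_and _ _ (p_infty_gt nu) (h_asymptotic nu Hnu))) as Hlarge.
  unfold filtermap in Hlarge. revert Hlarge. apply filter_imp. intros k [Hgt Hh]. split; [easy|].
  now replace (PI * (INR k + nu / 2 + c) / PI - nu / 2) with (INR k + c) in Hh
    by (field; lra).
Qed.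

Lemma critical_point_asymptotic_bounds (nu delta : R) : 0 <= nu ->
  eventually (fun k =>
    PI * (INR k + nu / 2 - 1 / 2) < h_inv nu (INR k) /\
    h_inv nu (INR k) < critical_point nu delta k /\
    critical_point nu delta k < h_inv nu (INR k + 3 / 8) /\
    h_inv nu (INR k + 3 / 8) < PI * (INR k + nu / 2 + 1 / 2)).
Proof.
  intros Hnu.
  refine (filter_imp _ _ _ (filter_and _ _ (ex_intro _ 1%nat (fun k Hk => Hk))
    (filter_and _ _ (critical_point_phase_window nu delta Hnu) (filter_and _ _
      (h_affine_asymptotic nu (- (1 / 2)) Hnu) (h_affine_asymptotic nu (1 / 2) Hnu))))).
  intros k (Hk & (Hgt & Hwin) & (Hlo & Hhlo) & Hhi & Hhhi).
  apply le_INR in Hk. simpl in Hk.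
  set (d := critical_point nu delta k) in *.
  assert (Hh : INR k < h nu d < INR k + 3 / 8) by (unfold phase in Hwin; split; nra).
  apply Rabs_def2 in Hhlo. apply Rabs_def2 in Hhhi.
  change (INR k + nu / 2 + - (1 / 2)) with (INR k + nu / 2 - 1 / 2) in *.
  repeat split; [apply lt_h_inv|apply h_inv_lt|apply lt_h_inv|apply h_inv_lt]; lra.
Qed.

Theorem proposition4p10 (delta : R) :
  (forall (nu : R) (k : nat),
     nu >= Rabs delta -> (2 <= k)%nat ->
     a' nu delta k > sqrt (nu ^ 2 + PI ^ 2 * (INR k - 5 / 4) ^ 2)) /\
  (forall nu : R,
     nu >= Rabs delta -> ~ (0 < nu /\ delta = - nu) ->
     exists K : nat, forall k : nat, (K <= k)%nat ->
       PI * (INR k + nu / 2 - 1 / 2) < h_inv nu (INR k) /\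
       h_inv nu (INR k) < a' nu delta k /\
       a' nu delta k < h_inv nu (INR k + 3 / 8) /\
       h_inv nu (INR k + 3 / 8) < PI * (INR k + nu / 2 + 1 / 2)) /\
  (forall nu : R,
     0 < nu -> delta = - nu ->
     exists K : nat, forall k : nat, (K <= k)%nat ->
       PI * (INR k + nu / 2 - 1 / 2) < h_inv nu (INR k) /\
       h_inv nu (INR k) < a' nu delta (S k) /\
       a' nu delta (S k) < h_inv nu (INR k + 3 / 8) /\
       h_inv nu (INR k + 3 / 8) < PI * (INR k + nu / 2 + 1 / 2)).
Proof.
  repeat split.
  - intros nu k Hnu Hk. apply a'_lower_bound; [lra|easy].
  - intros nu Hnu Hgen. pose proof (Rabs_pos delta).
    destruct (critical_point_asymptotic_bounds nu delta) as [K HK]; [lra|].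
    exists (S K). intros k Hk. rewrite a'_generic by (easy || lra || lia). apply HK. lia.
  - intros nu Hnu ->.
    destruct (critical_point_asymptotic_bounds nu (- nu)) as [K HK]; [lra|].
    exists K. intros k Hk. rewrite a'_opposite_order by easy. now apply HK.
Qed.
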